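(* Let $\lambda>0$ and let $P_4(\boldsymbol\theta)=\sum_{T\subset\{1,2,3,4\}}p_T\boldsymbol\theta^T$ with $p_\varnothing=1$, $p_T>0$ for all non-empty $T$, and $\widetilde b_T=\widetilde b_T(P_4)>0$ for all $T\subset\{1,2,3,4\}$ with $|T|>1$. Let $P_1(\theta_1)=1+p_1\theta_1$ and $S_i(\theta_i)=1+(-\widetilde p_i)^{-1}\theta_i$ for $i=2,3,4$, $S_{2,3}=1+\frac{p_{1,2,4}}{p_{1,4}}\theta_2+\frac{p_{1,3,4}}{p_{1,4}}\theta_3+\frac{p_{1,2,3,4}}{p_{1,4}}\theta_2\theta_3$, $S_{2,4}=1+\frac{p_{1,2,3}}{p_{1,3}}\theta_2+\frac{p_{1,3,4}}{p_{1,3}}\theta_4+\frac{p_{1,2,3,4}}{p_{1,3}}\theta_2\theta_4$, $S_{3,4}=1+\frac{p_{1,2,3}}{p_{1,2}}\theta_3+\frac{p_{1,2,4}}{p_{1,2}}\theta_4+\frac{p_{1,2,3,4}}{p_{1,2}}\theta_3\theta_4$, $S_{2,3,4}=1+\frac{p_{1,2}}{p_1}\theta_2+\frac{p_{1,3}}{p_1}\theta_3+\frac{p_{1,4}}{p_1}\theta_4+\frac{p_{1,2,3}}{p_1}\theta_2\theta_3+\frac{p_{1,2,4}}{p_1}\theta_2\theta_4+\frac{p_{1,3,4}}{p_1}\theta_3\theta_4+\frac{p_{1,2,3,4}}{p_1}\theta_2\theta_3\theta_4$. Write $a_T=-\widetilde p_T=p_{\{1,2,3,4\}\setminus T}/p_{1,2,3,4}$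 (so $a_2=-\widetilde p_2$, $a_{2,3}=-\widetilde p_{2,3}$, etc.). Define $\alpha_1=\frac{\widetilde b_{1,2}}{a_2}$, $\alpha_2=\frac{\widetilde b_{1,3}}{a_3}$, $\alpha_3=\frac{\widetilde b_{1,4}}{a_4}$, $\alpha_4=\frac{\widetilde b_{1,2,3}}{a_{2,3}}$, $\alpha_5=\frac{\widetilde b_{1,2,4}}{a_{2,4}}$, $\alpha_6=\frac{\widetilde b_{1,3,4}}{a_{3,4}}$, $\alpha_7=\frac{\widetilde b_{1,2}\widetilde b_{2,3}}{a_2a_{2,3}}$, $\alpha_8=\frac{\widetilde b_{1,2}\widetilde b_{2,4}}{a_2a_{2,4}}$, $\alpha_9=\frac{\widetilde b_{1,3}\widetilde b_{2,3}}{a_3a_{2,3}}$, $\alpha_{10}=\frac{\widetilde b_{1,3}\widetilde b_{3,4}}{a_3a_{3,4}}$, $\alpha_{11}=\frac{\widetilde b_{1,4}\widetilde b_{2,4}}{a_4a_{2,4}}$, $\alpha_{12}=\frac{\widetilde b_{1,4}\widetilde b_{3,4}}{a_4a_{3,4}}$, $\alpha_{13}=\frac{\widetilde b_{1,2,3,4}}{a_{2,3,4}}$, $\alpha_{14}=\frac{\widetilde b_{1,2}\widetilde b_{2,3,4}+\widetilde b_{2,3}\widetilde b_{1,2,4}+\widetilde b_{2,4}\widetilde b_{1,2,3}}{a_2a_{2,3,4}}$, $\alpha_{15}=\frac{\widetilde b_{1,3}\widetilde b_{2,3,4}+\widetilde b_{2,3}\widetilde b_{1,3,4}+\widetilde b_{3,4}\widetilde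 b_{1,2,3}}{a_3a_{2,3,4}}$, $\alpha_{16}=\frac{\widetilde b_{1,4}\widetilde b_{2,3,4}+\widetilde b_{2,4}\widetilde b_{1,3,4}+\widetilde b_{3,4}\widetilde b_{1,2,4}}{a_4a_{2,3,4}}$, $\alpha_{17}=\frac{2\widetilde b_{1,2}\widetilde b_{2,3}\widetilde b_{2,4}}{a_2^2a_{2,3,4}}$, $\alpha_{18}=\frac{2\widetilde b_{1,3}\widetilde b_{2,3}\widetilde b_{3,4}}{a_3^2a_{2,3,4}}$, $\alpha_{19}=\frac{2\widetilde b_{1,4}\widetilde b_{2,4}\widetilde b_{3,4}}{a_4^2a_{2,3,4}}$, $\alpha_{20}=\frac{\widetilde b_{2,3}(\widetilde b_{1,2}\widetilde b_{3,4}+\widetilde b_{1,3}\widetilde b_{2,4})}{a_2a_3a_{2,3,4}}$, $\alpha_{21}=\frac{\widetilde b_{2,4}(\widetilde b_{1,2}\widetilde b_{3,4}+\widetilde b_{1,4}\widetilde b_{2,3})}{a_2a_4a_{2,3,4}}$, $\alpha_{22}=\frac{\widetilde b_{3,4}(\widetilde b_{1,3}\widetilde b_{2,4}+\widetilde b_{1,4}\widetilde b_{2,3})}{a_3a_4a_{2,3,4}}$, $\alpha_{23}=\frac{\widetilde b_{1,2,3}\widetilde b_{2,3,4}}{a_{2,3}a_{2,3,4}}$, $\alpha_{24}=\frac{\widetilde b_{1,2,4}\widetilde b_{2,3,4}}{a_{2,4}a_{2,3,4}}$, $\alpha_{25}=\frac{\widetilde b_{1,3,4}\widetilde b_{2,3,4}}{a_{3,4}a_{2,3,4}}$,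 $\alpha_{26}=\frac{\widetilde b_{2,3}(\widetilde b_{1,2}\widetilde b_{2,3,4}+\widetilde b_{2,4}\widetilde b_{1,2,3})}{a_2a_{2,3}a_{2,3,4}}$, $\alpha_{27}=\frac{\widetilde b_{2,4}(\widetilde b_{1,2}\widetilde b_{2,3,4}+\widetilde b_{2,3}\widetilde b_{1,2,4})}{a_2a_{2,4}a_{2,3,4}}$, $\alpha_{28}=\frac{\widetilde b_{2,3}(\widetilde b_{1,3}\widetilde b_{2,3,4}+\widetilde b_{3,4}\widetilde b_{1,2,3})}{a_3a_{2,3}a_{2,3,4}}$, $\alpha_{29}=\frac{\widetilde b_{3,4}(\widetilde b_{1,3}\widetilde b_{2,3,4}+\widetilde b_{2,3}\widetilde b_{1,3,4})}{a_3a_{3,4}a_{2,3,4}}$, $\alpha_{30}=\frac{\widetilde b_{2,4}(\widetilde b_{1,4}\widetilde b_{2,3,4}+\widetilde b_{3,4}\widetilde b_{1,2,4})}{a_4a_{2,4}a_{2,3,4}}$, $\alpha_{31}=\frac{\widetilde b_{3,4}(\widetilde b_{1,4}\widetilde b_{2,3,4}+\widetilde b_{2,4}\widetilde b_{1,3,4})}{a_4a_{3,4}a_{2,3,4}}$, $\alpha_{32}=\frac{\widetilde b_{1,2}\widetilde b_{2,3}^2\widetilde b_{2,4}}{a_2^2a_{2,3}a_{2,3,4}}$, $\alpha_{33}=\frac{\widetilde b_{1,2}\widetilde b_{2,3}\widetilde b_{2,4}^2}{a_2^2a_{2,4}a_{2,3,4}}$, $\alpha_{34}=\frac{\widetilde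 b_{1,3}\widetilde b_{2,3}^2\widetilde b_{3,4}}{a_3^2a_{2,3}a_{2,3,4}}$, $\alpha_{35}=\frac{\widetilde b_{1,3}\widetilde b_{2,3}\widetilde b_{3,4}^2}{a_3^2a_{3,4}a_{2,3,4}}$, $\alpha_{36}=\frac{\widetilde b_{1,4}\widetilde b_{3,4}\widetilde b_{2,4}^2}{a_4^2a_{2,4}a_{2,3,4}}$, $\alpha_{37}=\frac{\widetilde b_{1,4}\widetilde b_{2,4}\widetilde b_{3,4}^2}{a_4^2a_{3,4}a_{2,3,4}}$, $\alpha_{38}=\frac{\widetilde b_{2,3}^2(\widetilde b_{1,2}\widetilde b_{3,4}+\widetilde b_{1,3}\widetilde b_{2,4})}{a_2a_3a_{2,3}a_{2,3,4}}$, $\alpha_{39}=\frac{\widetilde b_{2,4}^2(\widetilde b_{1,2}\widetilde b_{3,4}+\widetilde b_{1,4}\widetilde b_{2,3})}{a_2a_4a_{2,4}a_{2,3,4}}$, $\alpha_{40}=\frac{\widetilde b_{3,4}^2(\widetilde b_{1,3}\widetilde b_{2,4}+\widetilde b_{1,4}\widetilde b_{2,3})}{a_3a_4a_{3,4}a_{2,3,4}}$. For $\mathbf v=(v_1,\dots,v_{40})\in\mathbb N^{40}$ put $z_1(\mathbf v)=v_1+v_7+v_8+v_{14}+2v_{17}+v_{20}+v_{21}+v_{26}+v_{27}+2v_{32}+2v_{33}+v_{38}+v_{39}$, $z_2(\mathbf v)=v_2+v_9+v_{10}+v_{15}+2v_{18}+v_{20}+v_{22}+v_{28}+v_{29}+2v_{34}+2v_{35}+v_{38}+v_{40}$,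 $z_3(\mathbf v)=v_3+v_{11}+v_{12}+v_{16}+2v_{19}+v_{21}+v_{22}+v_{30}+v_{31}+2v_{36}+2v_{37}+v_{39}+v_{40}$, $z_4(\mathbf v)=v_4+v_7+v_9+v_{23}+v_{26}+v_{28}+v_{32}+v_{34}+v_{38}$, $z_5(\mathbf v)=v_5+v_8+v_{11}+v_{24}+v_{27}+v_{30}+v_{33}+v_{36}+v_{39}$, $z_6(\mathbf v)=v_6+v_{10}+v_{12}+v_{25}+v_{29}+v_{31}+v_{35}+v_{37}+v_{40}$, $z_7(\mathbf v)=\sum_{i=13}^{40}v_i$. Let $X_1\sim\gamma_{(P_1,\lambda)}$ and, given $X_1$, let $V_1,\dots,V_{40}$ be independent with $V_i\sim\mathcal P(\alpha_iX_1)$; write $\mathbf V=(V_1,\dots,V_{40})$. (a) If $(X_1,X_2,X_3,X_4)\sim\boldsymbol\gamma_{(P_4,\lambda)}$, the Laplace transform of $(X_2,X_3,X_4)$ given $X_1=x_1$ is $$L_{(X_2,X_3,X_4)}^{X_1=x_1}=\sum_{\mathbf v\in\mathbb N^{40}}\Big[\prod_{i=1}^{40}\mathbf P(V_i=v_i\mid X_1=x_1)\Big]S_2^{-z_1(\mathbf v)}S_3^{-z_2(\mathbf v)}S_4^{-z_3(\mathbf v)}S_{2,3}^{-z_4(\mathbf v)}S_{2,4}^{-z_5(\mathbf v)}S_{3,4}^{-z_6(\mathbf v)}S_{2,3,4}^{-(\lambda+z_7(\mathbf v))}.$$ (b) Given $X_1$ and $\mathbf V$, let the following be independent: $Y_2\sim\gamma_{(S_2,z_1(\mathbf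 V))}$, $Y_3\sim\gamma_{(S_3,z_2(\mathbf V))}$, $Y_4\sim\gamma_{(S_4,z_3(\mathbf V))}$, $(U_{1,2},U_{1,3})\sim\boldsymbol\gamma_{(S_{2,3},z_4(\mathbf V))}$, $(U_{2,2},U_{2,4})\sim\boldsymbol\gamma_{(S_{2,4},z_5(\mathbf V))}$, $(U_{3,3},U_{3,4})\sim\boldsymbol\gamma_{(S_{3,4},z_6(\mathbf V))}$, $(W_2,W_3,W_4)\sim\boldsymbol\gamma_{(S_{2,3,4},\lambda+z_7(\mathbf V))}$ (all infinitely divisible). Set $X_2=Y_2+U_{1,2}+U_{2,2}+W_2$, $X_3=Y_3+U_{1,3}+U_{3,3}+W_3$, $X_4=Y_4+U_{2,4}+U_{3,4}+W_4$. Then $(X_1,X_2,X_3,X_4)\sim\boldsymbol\gamma_{(P_4,\lambda)}$.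
   Context: Notation: $\mathbb N=\{0,1,2,\dots\}$, $\boldsymbol\theta^T=\prod_{t\in T}\theta_t$; braces are omitted in indices ($p_{1,2}=p_{\{1,2\}}$, etc.). For $T\subset[4]=\{1,2,3,4\}$, $\widetilde p_T=-p_{[4]\setminus T}/p_{[4]}$. For non-empty $S\subset[4]$, $$\widetilde b_S=\sum_{k=1}^{|S|}(k-1)!\sum_{\mathcal T\in\Pi_S^k}\ \prod_{T\in\mathcal T}\widetilde p_T,$$ where $\Pi_S^k$ is the set of partitions of $S$ into $k$ non-empty blocks. For a polynomial $P$ of degree at most one in each variable with $P(\mathbf 0)=1$ and $\lambda>0$, the multivariate gamma distribution $\boldsymbol\gamma_{(P,\lambda)}$ is the probability distribution of a random vector $\mathbf X$ with $\mathbb E[\exp(-\sum_i\theta_iX_i)]=[P(\boldsymbol\theta)]^{-\lambda}$ for $\boldsymbol\theta$ in a set with non-empty interior (in dimension one also written $\gamma_{(P,\lambda)}$); with shape parameter $0$ it is the point mass at the origin. It is infinitely divisible if $[P(\boldsymbol\theta)]^{-\lambda t}$ is the Laplace transform of a positive measure for every $t>0$. $\mathcal P(\mu)$ is the Poisson distribution with parameter $\mu$. The conditional Laplace transform is $L_{(X_2,X_3,X_4)}^{X_1=x_1}(\theta_2,\theta_3,\theta_4)=\mathbb E[e^{-\theta_2X_2-\theta_3X_3-\theta_4X_4}\mid X_1=x_1]$, and the formula gives a version of it for $x_1>0$, $\theta_i\ge0$. *)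

(* Defs.v *)
From HB Require Import structures.
From mathcomp Require Import all_boot all_order all_algebra.
From mathcomp Require Import all_classical all_reals all_analysis.
From mathcomp Require Import measurable_realfun.

Set Implicit Arguments.
Unset Strict Implicit.
Unset Printing Implicit Defensive.

Import Order.TTheory GRing.Theory Num.Theory.
Import numFieldNormedType.Exports.

Local Open Scope classical_set_scope.
Local Open Scope ring_scope.

Section multivariate_gamma.
Context {R : realType}.

Section on_a_measure_space.
Context d (T : measurableType d) (n : nat).
Implicit Types (X : T -> n.-tuple R) (P : 'rV[R]_n -> R).

Definition laplace (m : {measure set T -> \bar R}) X (theta : 'rV[R]_n) :
    \bar R :=
  (\int[m]_w (expR (- \sum_(i < n) theta 0 i * tnth (X w) i))%:E)%E.

(* The condition 0 < P theta makes the real power meaningful: [powR] takes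
   junk values at negative arguments. *)
Definition laplace_eq_power (m : {measure set T -> \bar R}) X P (l : R) :
    Prop :=
  exists2 Theta : set 'rV[R]_n, Theta° !=set0 &
    forall theta, Theta theta ->
      0 < P theta /\ laplace m X theta = (P theta `^ (- l))%:E.

(* The random vector X has the law gamma_(P, l); P is meant to be a polynomial
   function of degree at most one in each variable with P 0 = 1. *)
Definition mgamma (Pr : probability T R) X P (l : R) : Prop :=
  measurable_fun [set: T] X /\
  if l == 0 then Pr [set w | forall i, tnth (X w) i = 0] = 1%E
  else laplace_eq_power Pr X P l.

End on_a_measure_space.

Definition mgamma_law n (mu : probability (n.-tuple R) R)
    (P : 'rV[R]_n -> R) (l : R) : Prop := mgamma mu id P l.

Definition mgamma_infdiv n (P : 'rV[R]_n -> R) (l : R) : Prop :=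
  (exists mu : probability (n.-tuple R) R, mgamma_law mu P l) /\
  forall t : R, 0 < t ->
    exists mu : {measure set (n.-tuple R) -> \bar R},
      laplace_eq_power mu id P (l * t).

Definition on1 (f : R -> R) (theta : 'rV[R]_1) : R := f (theta 0 0).

Definition on2 (f : R -> R -> R) (theta : 'rV[R]_2) : R :=
  f (theta 0 0) (theta 0 1).

Definition on3 (f : R -> R -> R -> R) (theta : 'rV[R]_3) : R :=
  f (theta 0 0) (theta 0 1) (theta 0 ord_max).

End multivariate_gamma.

Section conditioning.
Context d (T : measurableType d) (R : realType) (Pr : probability T R).

(* g is, on D, a version of x |-> E[Z | X = x], the law of X being carried
   by D. *)
Definition cond_expectation_version (X : {RV Pr >-> R}) (D : set R)
    (Z : T -> R) (g : R -> \bar R) : Prop :=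
  [/\ distribution Pr X D = 1%E,
      Pr.-integrable [set: T] (EFin \o Z),
      measurable_fun D g &
      forall A : set R, measurable A -> A `<=` D ->
        (\int[Pr]_(w in X @^-1` A) (Z w)%:E =
         \int[distribution Pr X]_(x in A) g x)%E].

(* Given X, the V_i are independent and V_i is Poisson with parameter
   (tnth a i) * X. The second argument of [poisson_prob] is a dummy. *)
Definition cond_indep_poisson n (X : {RV Pr >-> R}) (a : n.-tuple R)
    (V : 'I_n -> {RV Pr >-> nat}) : Prop :=
  forall (A : set R) (B : 'I_n -> set nat), measurable A ->
    (Pr (X @^-1` A `&` \bigcap_(i in [set: 'I_n]) (V i @^-1` B i)) =
     \int[Pr]_(w in X @^-1` A)
        \prod_(i < n) poisson_prob (tnth a i * X w) 0%N (B i))%E.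

End conditioning.

Section polynomial_in_four_variables.
Context {R : realType}.
Implicit Types (p : {set 'I_4} -> R).

(* The subset of [4] = {1, 2, 3, 4} with elements s; the element k is encoded
   by the ordinal of value k - 1. *)
Definition idx4 (s : seq nat) : {set 'I_4} := [set i : 'I_4 | i.+1 \in s]%SET.

Definition affine4 p (theta : 'rV[R]_4) : R :=
  \sum_(T : {set 'I_4}) p T * \prod_(t in T) theta 0 t.

Definition ptilde p (T : {set 'I_4}) : R := - p (~: T)%SET / p [set: 'I_4]%SET.

Definition btilde p (S : {set 'I_4}) : R :=
  \sum_(1 <= k < #|S|.+1) (k.-1)`!%:R *
    \sum_(TT : {set {set 'I_4}} | finset.partition TT S && (#|TT| == k))
      \prod_(T in TT) ptilde p T.

End polynomial_in_four_variables.

Section parameters.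
Context {R : realType} (p : {set 'I_4} -> R).

Local Notation "''p[' i , .. , j ]" :=
  (p (idx4 (cons i%N .. (cons j%N nil) ..))).
Local Notation "''a[' i , .. , j ]" :=
  (- ptilde p (idx4 (cons i%N .. (cons j%N nil) ..))).
Local Notation "''b[' i , .. , j ]" :=
  (btilde p (idx4 (cons i%N .. (cons j%N nil) ..))).

Definition P1 (t1 : R) : R := 1 + 'p[1] * t1.

Definition S2 (t2 : R) : R := 1 + 'a[2]^-1 * t2.
Definition S3 (t3 : R) : R := 1 + 'a[3]^-1 * t3.
Definition S4 (t4 : R) : R := 1 + 'a[4]^-1 * t4.

Definition S23 (t2 t3 : R) : R :=
  1 + 'p[1, 2, 4] / 'p[1, 4] * t2 + 'p[1, 3, 4] / 'p[1, 4] * t3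
    + 'p[1, 2, 3, 4] / 'p[1, 4] * (t2 * t3).

Definition S24 (t2 t4 : R) : R :=
  1 + 'p[1, 2, 3] / 'p[1, 3] * t2 + 'p[1, 3, 4] / 'p[1, 3] * t4
    + 'p[1, 2, 3, 4] / 'p[1, 3] * (t2 * t4).

Definition S34 (t3 t4 : R) : R :=
  1 + 'p[1, 2, 3] / 'p[1, 2] * t3 + 'p[1, 2, 4] / 'p[1, 2] * t4
    + 'p[1, 2, 3, 4] / 'p[1, 2] * (t3 * t4).

Definition S234 (t2 t3 t4 : R) : R :=
  1 + 'p[1, 2] / 'p[1] * t2 + 'p[1, 3] / 'p[1] * t3 + 'p[1, 4] / 'p[1] * t4
    + 'p[1, 2, 3] / 'p[1] * (t2 * t3) + 'p[1, 2, 4] / 'p[1] * (t2 * t4)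
    + 'p[1, 3, 4] / 'p[1] * (t3 * t4)
    + 'p[1, 2, 3, 4] / 'p[1] * (t2 * t3 * t4).

(* alpha_1, ..., alpha_40 in this order: alpha_i is tnth alpha (i - 1). *)
Definition alpha : 40.-tuple R := [tuple
  'b[1, 2] / 'a[2];
  'b[1, 3] / 'a[3];
  'b[1, 4] / 'a[4];
  'b[1, 2, 3] / 'a[2, 3];
  'b[1, 2, 4] / 'a[2, 4];
  'b[1, 3, 4] / 'a[3, 4];
  'b[1, 2] * 'b[2, 3] / ('a[2] * 'a[2, 3]);
  'b[1, 2] * 'b[2, 4] / ('a[2] * 'a[2, 4]);
  'b[1, 3] * 'b[2, 3] / ('a[3] * 'a[2, 3]);
  'b[1, 3] * 'b[3, 4] / ('a[3] * 'a[3, 4]);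
  'b[1, 4] * 'b[2, 4] / ('a[4] * 'a[2, 4]);
  'b[1, 4] * 'b[3, 4] / ('a[4] * 'a[3, 4]);
  'b[1, 2, 3, 4] / 'a[2, 3, 4];
  ('b[1, 2] * 'b[2, 3, 4] + 'b[2, 3] * 'b[1, 2, 4] + 'b[2, 4] * 'b[1, 2, 3])
    / ('a[2] * 'a[2, 3, 4]);
  ('b[1, 3] * 'b[2, 3, 4] + 'b[2, 3] * 'b[1, 3, 4] + 'b[3, 4] * 'b[1, 2, 3])
    / ('a[3] * 'a[2, 3, 4]);
  ('b[1, 4] * 'b[2, 3, 4] + 'b[2, 4] * 'b[1, 3, 4] + 'b[3, 4] * 'b[1, 2, 4])
    / ('a[4] * 'a[2, 3, 4]);
  2 * 'b[1, 2] * 'b[2, 3] * 'b[2, 4] / ('a[2] ^+ 2 * 'a[2, 3, 4]);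
  2 * 'b[1, 3] * 'b[2, 3] * 'b[3, 4] / ('a[3] ^+ 2 * 'a[2, 3, 4]);
  2 * 'b[1, 4] * 'b[2, 4] * 'b[3, 4] / ('a[4] ^+ 2 * 'a[2, 3, 4]);
  'b[2, 3] * ('b[1, 2] * 'b[3, 4] + 'b[1, 3] * 'b[2, 4])
    / ('a[2] * 'a[3] * 'a[2, 3, 4]);
  'b[2, 4] * ('b[1, 2] * 'b[3, 4] + 'b[1, 4] * 'b[2, 3])
    / ('a[2] * 'a[4] * 'a[2, 3, 4]);
  'b[3, 4] * ('b[1, 3] * 'b[2, 4] + 'b[1, 4] * 'b[2, 3])
    / ('a[3] * 'a[4] * 'a[2, 3, 4]);
  'b[1, 2, 3] * 'b[2, 3, 4] / ('a[2, 3] * 'a[2, 3, 4]);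
  'b[1, 2, 4] * 'b[2, 3, 4] / ('a[2, 4] * 'a[2, 3, 4]);
  'b[1, 3, 4] * 'b[2, 3, 4] / ('a[3, 4] * 'a[2, 3, 4]);
  'b[2, 3] * ('b[1, 2] * 'b[2, 3, 4] + 'b[2, 4] * 'b[1, 2, 3])
    / ('a[2] * 'a[2, 3] * 'a[2, 3, 4]);
  'b[2, 4] * ('b[1, 2] * 'b[2, 3, 4] + 'b[2, 3] * 'b[1, 2, 4])
    / ('a[2] * 'a[2, 4] * 'a[2, 3, 4]);
  'b[2, 3] * ('b[1, 3] * 'b[2, 3, 4] + 'b[3, 4] * 'b[1, 2, 3])
    / ('a[3] * 'a[2, 3] * 'a[2, 3, 4]);
  'b[3, 4] * ('b[1, 3] * 'b[2, 3, 4] + 'b[2, 3] * 'b[1, 3, 4])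
    / ('a[3] * 'a[3, 4] * 'a[2, 3, 4]);
  'b[2, 4] * ('b[1, 4] * 'b[2, 3, 4] + 'b[3, 4] * 'b[1, 2, 4])
    / ('a[4] * 'a[2, 4] * 'a[2, 3, 4]);
  'b[3, 4] * ('b[1, 4] * 'b[2, 3, 4] + 'b[2, 4] * 'b[1, 3, 4])
    / ('a[4] * 'a[3, 4] * 'a[2, 3, 4]);
  'b[1, 2] * 'b[2, 3] ^+ 2 * 'b[2, 4] / ('a[2] ^+ 2 * 'a[2, 3] * 'a[2, 3, 4]);
  'b[1, 2] * 'b[2, 3] * 'b[2, 4] ^+ 2 / ('a[2] ^+ 2 * 'a[2, 4] * 'a[2, 3, 4]);
  'b[1, 3] * 'b[2, 3] ^+ 2 * 'b[3, 4] / ('a[3] ^+ 2 * 'a[2, 3] * 'a[2, 3, 4]);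
  'b[1, 3] * 'b[2, 3] * 'b[3, 4] ^+ 2 / ('a[3] ^+ 2 * 'a[3, 4] * 'a[2, 3, 4]);
  'b[1, 4] * 'b[3, 4] * 'b[2, 4] ^+ 2 / ('a[4] ^+ 2 * 'a[2, 4] * 'a[2, 3, 4]);
  'b[1, 4] * 'b[2, 4] * 'b[3, 4] ^+ 2 / ('a[4] ^+ 2 * 'a[3, 4] * 'a[2, 3, 4]);
  'b[2, 3] ^+ 2 * ('b[1, 2] * 'b[3, 4] + 'b[1, 3] * 'b[2, 4])
    / ('a[2] * 'a[3] * 'a[2, 3] * 'a[2, 3, 4]);
  'b[2, 4] ^+ 2 * ('b[1, 2] * 'b[3, 4] + 'b[1, 4] * 'b[2, 3])
    / ('a[2] * 'a[4] * 'a[2, 4] * 'a[2, 3, 4]);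
  'b[3, 4] ^+ 2 * ('b[1, 3] * 'b[2, 4] + 'b[1, 4] * 'b[2, 3])
    / ('a[3] * 'a[4] * 'a[3, 4] * 'a[2, 3, 4])].

End parameters.

Section exponents.
Local Open Scope nat_scope.
Variable v : 40.-tuple nat.

Local Notation "''v_' k" := (nth 0 v k.-1) (at level 8, k at level 2).

Definition z1 : nat :=
  'v_1 + 'v_7 + 'v_8 + 'v_14 + 2 * 'v_17 + 'v_20 + 'v_21 + 'v_26 + 'v_27
    + 2 * 'v_32 + 2 * 'v_33 + 'v_38 + 'v_39.
Definition z2 : nat :=
  'v_2 + 'v_9 + 'v_10 + 'v_15 + 2 * 'v_18 + 'v_20 + 'v_22 + 'v_28 + 'v_29
    + 2 * 'v_34 + 2 * 'v_35 + 'v_38 + 'v_40.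
Definition z3 : nat :=
  'v_3 + 'v_11 + 'v_12 + 'v_16 + 2 * 'v_19 + 'v_21 + 'v_22 + 'v_30 + 'v_31
    + 2 * 'v_36 + 2 * 'v_37 + 'v_39 + 'v_40.
Definition z4 : nat :=
  'v_4 + 'v_7 + 'v_9 + 'v_23 + 'v_26 + 'v_28 + 'v_32 + 'v_34 + 'v_38.
Definition z5 : nat :=
  'v_5 + 'v_8 + 'v_11 + 'v_24 + 'v_27 + 'v_30 + 'v_33 + 'v_36 + 'v_39.
Definition z6 : nat :=
  'v_6 + 'v_10 + 'v_12 + 'v_25 + 'v_29 + 'v_31 + 'v_35 + 'v_37 + 'v_40.
Definition z7 : nat := \sum_(13 <= i < 41) 'v_i.

End exponents.

Section mixture.
Context {R : realType} (p : {set 'I_4} -> R) (lambda : R).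

Definition cond_laplace (t2 t3 t4 x1 : R) : \bar R :=
  (\esum_(v in [set: 40.-tuple nat])
     ((\prod_(i < 40) poisson_pmf (tnth (alpha p) i * x1) (tnth v i))
      * S2 p t2 ^- z1 v * S3 p t3 ^- z2 v * S4 p t4 ^- z3 v
      * S23 p t2 t3 ^- z4 v * S24 p t2 t4 ^- z5 v * S34 p t3 t4 ^- z6 v
      * S234 p t2 t3 t4 `^ (- (lambda + (z7 v)%:R)))%:E)%E.

Context d (T : measurableType d) (Pr : probability T R).

(* Given (X1, V), the random elements Y2, Y3, Y4, (U12, U13), (U22, U24),
   (U33, U34) and (W2, W3, W4) are independent with laws G2 V, ..., G234 V.
   V takes countably many values and the laws depend on V only, so it suffices
   to condition on the events {X1 in A} and {V = v}. *)
Definition cond_indep_given_X1_V (X1 : {RV Pr >-> R})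
    (V : 'I_40 -> {RV Pr >-> nat}) (Y2 Y3 Y4 : {RV Pr >-> R})
    (U12 U13 U22 U24 U33 U34 W2 W3 W4 : {RV Pr >-> R})
    (G2 G3 G4 : 40.-tuple nat -> probability (1.-tuple R) R)
    (G23 G24 G34 : 40.-tuple nat -> probability (2.-tuple R) R)
    (G234 : 40.-tuple nat -> probability (3.-tuple R) R) : Prop :=
  forall (A : set R) (v : 40.-tuple nat) (B2 B3 B4 : set (1.-tuple R))
      (B23 B24 B34 : set (2.-tuple R)) (B234 : set (3.-tuple R)),
    measurable A -> measurable B2 -> measurable B3 -> measurable B4 ->
    measurable B23 -> measurable B24 -> measurable B34 -> measurable B234 ->
    let C := [set w | A (X1 w) /\ [tuple V i w | i < 40] = v] in
    (Pr (C `&` [set w | [/\ B2 [tuple Y2 w], B3 [tuple Y3 w],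
                           B4 [tuple Y4 w] &
                       [/\ B23 [tuple U12 w; U13 w],
                           B24 [tuple U22 w; U24 w],
                           B34 [tuple U33 w; U34 w] &
                           B234 [tuple W2 w; W3 w; W4 w]]]]) =
     Pr C * G2 v B2 * G3 v B3 * G4 v B4
          * G23 v B23 * G24 v B24 * G34 v B34 * G234 v B234)%E.

End mixture.

(* Main.v *)
(* Put x_i = t_i + a_i for i = 2, 3, 4, and let b_T stand for btilde_T. In these
   coordinates S_234 is (x2 x3 x4 - b23 x4 - b24 x3 - b34 x2 - b234) / a_234,
   the other S are of the same form, and P_4 factors as
     S_234 * (1 + p_1 (t_1 + sum_i alpha_i (1 - m_i))),
   where m_i is the product of the inverses of the S to which one unit of v_i
   contributes. Since the generating function of a Poisson variable is
   exponential, the series over v in the theorem is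
     S_234 ^ (- lambda) * exp (- x_1 sum_i alpha_i (1 - m_i)),
   and its integral against the gamma law of X_1 is P_4 ^ (- lambda).
   For (b) this computes the Laplace transform of the mixture; for (a) it shows
   that the two measures A |-> E[Z; X_1 in A] and A |-> E[g(X_1); X_1 in A] have
   the same Laplace transform. A Laplace transform that is a power of a
   polynomial of degree one in each variable on an open set is the same power on
   the whole orthant, one variable at a time. The laws are infinitely divisible
   because S_234 ^ (- l) is a positive series of products of one-dimensional
   gamma transforms, for every l > 0. *)
From HB Require Import structures.
Require Import Defs.
From mathcomp Require Import all_boot all_order all_algebra.
From mathcomp Require Import all_classical all_reals all_analysis.
From mathcomp Require Import measurable_realfun ring lra.

Set Implicit Arguments.
Unset Strict Implicit.
Unset Printing Implicit Defensive.

Import Order.TTheory GRing.Theory Num.Theory.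
Import numFieldNormedType.Exports.

Local Open Scope classical_set_scope.
Local Open Scope ring_scope.

(** * Densities and gamma integrals *)

(** All arguments stay on the real line, without analytic continuation. Along an axis its substitute
    is a comparison, after exponential tilting, with [B] times a gamma variable of shape [l]:
    transforms that agree near one point have equal moments there, hence agree wherever the gamma
    transform is finite on both sides of that point. The obstacle is that the open set may lie
    outside the orthant and that [P] may vanish between it and the origin. The set is therefore
    contracted towards the origin: a finite measure keeps its transform finite on the way, and a
    finite transform cannot coexist with a non-positive base. Uniqueness for the measures in (a)
    needs only the moments of [exp (- n * Y)], a variable in [0, 1], together with a double
    exponential that tends to an indicator. The forty rates share one table of exponents: the
    denominator of [alpha_i] and the ratio [m_i] are the same monomial, taken at the [a_T] and at
    the inverses of the [S], and this reduces the factorization to two partial fraction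
    identities. *)

Section density_measure.
Local Open Scope ereal_scope.
Context d (T : measurableType d) (R : realType).
Implicit Types m : {measure set T -> \bar R}.

Import HBNNSimple.

(** [m] is arbitrary, not even sigma-finite, so the integration formula is proved on simple
    functions and passed to the limit by monotone convergence. This supplies the exponential
    tiltings and the laws with a given density used below. *)
Lemma density_measure_ex m (g : T -> R) :
  measurable_fun setT g -> (forall x, 0 <= g x)%R ->
  exists nu : {measure set T -> \bar R},
    (forall A, measurable A -> nu A = \int[m]_(x in A) (g x)%:E) /\
    forall f : T -> \bar R, measurable_fun setT f -> (forall x, 0 <= f x) ->
      \int[nu]_x f x = \int[m]_x (f x * (g x)%:E).
Proof.
move=> mg g0.
have mge : measurable_fun setT (fun x => (g x)%:E) by exact/measurable_EFinP.
pose n0 (A : set T) : \bar R := \int[m]_(x in A) (g x)%:E.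
have n00 : n0 set0 = 0 by rewrite /n0 integral_set0.
have n0_ge0 A : 0 <= n0 A by apply: integral_ge0 => x _; rewrite lee_fin.
have n0_sa : semi_sigma_additive n0.
  move=> F mF tF mUF; rewrite /n0 ge0_integral_bigcup//; last first.
    by move=> x _; rewrite lee_fin.
    exact: measurable_funS mge.
  apply: is_cvg_ereal_nneg_natsum_cond => n _ _.
  by apply: integral_ge0 => x _; rewrite lee_fin.
pose nu : {measure set T -> \bar R} :=
  HB.pack n0 (isMeasure.Build _ _ _ n0 n00 n0_ge0 n0_sa).
exists nu; split => // f mf f0.
pose f_ := nnsfun_approx measurableT mf.
have cf x : (f_ n x)%:E @[n --> \oo] --> f x.
  by apply: cvg_nnsfun_approx.
have ndf x : {homo (fun n => (f_ n x)%:E) : a b / (a <= b)%N >-> a <= b}.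
  by move=> a b ab; rewrite lee_fin; exact/lefP/nd_nnsfun_approx.
transitivity (limn (fun n => \int[nu]_x (f_ n x)%:E)).
  rewrite -monotone_convergence//.
  - by apply: eq_integral => x _; apply/esym/cvg_lim.
  - by move=> n; exact/measurable_EFinP.
  - by move=> n x _; rewrite lee_fin.
transitivity (limn (fun n => \int[m]_x ((f_ n x)%:E * (g x)%:E))); last first.
  rewrite -monotone_convergence//.
  - apply: eq_integral => x _; apply/cvg_lim => //.
    exact: cvgeZr.
  - move=> n; apply: emeasurable_funM => //; exact/measurable_EFinP.
  - by move=> n x _; rewrite mule_ge0// lee_fin.
  - by move=> x _ a b ab; rewrite lee_wpmul2r ?lee_fin// -lee_fin ndf.
apply: congr_lim; apply/funext => n.
under eq_integral do rewrite fimfunE -fsumEFin//.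
rewrite ge0_integral_fsum//; last 2 first.
- by move=> y; exact/measurable_EFinP/measurable_funM.
- by move=> y x _; rewrite nnfun_muleindic_ge0.
transitivity (\int[m]_x (\sum_(k \in range (f_ n))
    ((k * \1_(f_ n @^-1` [set k]) x)%:E * (g x)%:E))); last first.
  apply: eq_integral => x _; rewrite fimfunE -fsumEFin//.
  by rewrite ge0_mule_fsuml// => y; rewrite nnfun_muleindic_ge0.
rewrite ge0_integral_fsum//; last 2 first.
- move=> y; apply: emeasurable_funM => //.
  by exact/measurable_EFinP/measurable_funM.
- move=> y x _; apply: mule_ge0; last by rewrite lee_fin.
  exact: nnfun_muleindic_ge0.
apply: eq_fsbigr => r _; rewrite integralZl_indic_nnsfun// integral_indic//= setIT.
under eq_integral do rewrite EFinM -muleA.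
(* Membership of [r] in the range has been discarded; a negative [r] has an empty preimage, and both
   sides vanish. *)
have [r0|r0] := leP 0%R r; last first.
  rewrite preimage_nnfun0// /n0 integral_set0 mule0.
  by rewrite integral0_eq// => x _; rewrite indic0 mul0e mule0.
rewrite ge0_integralZl//; last 2 first.
- apply: emeasurable_funM => //; exact/measurable_EFinP.
- by move=> x _; rewrite mule_ge0// lee_fin.
congr (_ * _); rewrite /n0 integral_mkcond; apply: eq_integral => x _.
rewrite patchE indicE; case: ifPn => _; by rewrite ?mul1e ?mul0e.
Qed.

End density_measure.

(** The hypothesis means that the measures with densities [g1] and [g2] have the same image under
    [Z1] and [Z2], and [f] is integrated against that image. This is how identities known on events
    pass to test functions. *)
Lemma ge0_integral_comp_unique d1 d2 d (T1 : measurableType d1)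
    (T2 : measurableType d2) (T : measurableType d) (R : realType)
    (m1 : {measure set T1 -> \bar R}) (m2 : {measure set T2 -> \bar R})
    (Z1 : T1 -> T) (Z2 : T2 -> T) (g1 : T1 -> R) (g2 : T2 -> R) :
  measurable_fun setT Z1 -> measurable_fun setT Z2 ->
  measurable_fun setT g1 -> measurable_fun setT g2 ->
  (forall x, 0 <= g1 x) -> (forall x, 0 <= g2 x) ->
  (forall B, measurable B -> \int[m1]_(x in Z1 @^-1` B) (g1 x)%:E =
                             \int[m2]_(x in Z2 @^-1` B) (g2 x)%:E)%E ->
  forall f : T -> \bar R, measurable_fun setT f -> (forall x, 0 <= f x)%E ->
  (\int[m1]_x (f (Z1 x) * (g1 x)%:E) = \int[m2]_x (f (Z2 x) * (g2 x)%:E))%E.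
Proof.
move=> mZ1 mZ2 mg1 mg2 g10 g20 H f mf f0.
have [n1 [n1E n1i]] := density_measure_ex m1 mg1 g10.
have [n2 [n2E n2i]] := density_measure_ex m2 mg2 g20.
rewrite -(n1i _ (measurableT_comp mf mZ1) (fun x => f0 (Z1 x))).
rewrite -(n2i _ (measurableT_comp mf mZ2) (fun x => f0 (Z2 x))).
have := ge0_integral_pushforward mZ1 n1 measurableT mf (fun y _ => f0 y).
rewrite preimage_setT => <-.
have := ge0_integral_pushforward mZ2 n2 measurableT mf (fun y _ => f0 y).
rewrite preimage_setT => <-.
apply: eq_measure_integral => A mA _; rewrite /= /pushforward n1E ?n2E ?H//.
- by rewrite -[X in measurable X]setTI; exact: mZ2.
- by rewrite -[X in measurable X]setTI; exact: mZ1.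
Qed.

(** * The gamma integral over the whole line *)

Section gamma_integral.
Context {R : realType}.
Local Notation leb := (@lebesgue_measure R).

Lemma ge0_integralT_shift (k : R) (f : measurableTypeR R -> \bar R) :
  measurable_fun setT f -> (forall x, 0 <= f x)%E ->
  (\int[leb]_x f (x + k : R)%R = \int[leb]_x f x)%E.
Proof.
move=> mf f0.
have mk : measurable_fun setT ((fun x => x + k) : measurableTypeR R -> measurableTypeR R).
  by apply: measurable_funD => //; exact: measurable_id.
have := ge0_integral_pushforward mk leb measurableT mf (fun y _ => f0 y).
rewrite preimage_setT => <-.
apply: eq_measure_integral => A mA _; apply/esym/lebesgue_measure_unique => //.
move=> _ [[a b]] _ <-; rewrite -[RHS]/(leb ((fun x : R => x + k) @^-1` `]a, b]%classic)).
rewrite (_ : _ @^-1` _ = `]a - k, b - k]%classic); last first.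
  by apply/seteqP; split=> x /=; rewrite !in_itv/= lerBrDr ltrBlDr.
rewrite !lebesgue_measure_itv/= !lte_fin ltrD2r.
by case: ifPn => // _; rewrite -!EFinB; congr EFin; lra.
Qed.

Lemma ge0_integralT_opp (f : measurableTypeR R -> \bar R) :
  measurable_fun setT f -> (forall x, 0 <= f x)%E ->
  (\int[leb]_x f (- x)%R = \int[leb]_x f x)%E.
Proof.
move=> mf f0.
have mk : measurable_fun setT (-%R : measurableTypeR R -> measurableTypeR R).
  by [].
have := ge0_integral_pushforward mk leb measurableT mf (fun y _ => f0 y).
rewrite preimage_setT => <-.
by apply: eq_measure_integral => A mA _; exact: lebesgue_measureN.
Qed.

Lemma measurable_log_gamma (l s : R) :
  measurable_fun setT (fun y : measurableTypeR R => expR (l * y - s * expR y)).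
Proof.
apply: measurableT_comp => //; apply: measurable_funB; apply: measurable_funM => //.
Qed.

(* Euler's integral in the variable [y = ln x]. *)
Lemma gamma_integral (l : R) : 0 < l ->
  exists2 c : R, 0 < c & forall s, 0 < s ->
    (\int[leb]_y (c * expR (l * y - s * expR y))%:E = (s `^ (- l))%:E)%E.
Proof.
move=> l0; pose g (s : R) (y : measurableTypeR R) : R := expR (l * y - s * expR y).
have mg s : measurable_fun setT (fun y => (g s y)%:E).
  by apply/measurable_EFinP; exact: measurable_log_gamma.
have g_ge0 s x : (0 <= (g s x)%:E)%E by rewrite lee_fin expR_ge0.
(* The substitution [y + ln s] turns [exp y] into [s * exp y] and produces the factor [s ^ l]. *)
have shift s : 0 < s ->
    (\int[leb]_y (g s y)%:E = (s `^ (- l))%:E * \int[leb]_y (g 1 y)%:E)%E.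
  move=> s0; rewrite -(ge0_integralT_shift (ln s) (mg 1) (g_ge0 1)).
  rewrite -ge0_integralZl//; last 2 first.
  - apply/measurable_EFinP; apply: measurableT_comp (measurable_log_gamma _ _) _.
    by apply: measurable_funD => //; exact: measurable_id.
  - by rewrite lee_fin powR_ge0.
  apply: eq_integral => y _; rewrite -EFinM; congr EFin.
  rewrite /g /powR gt_eqF// -expRD (expRD y) lnK ?posrE//; congr expR.
  ring.
(* For [y < 0] drop the double exponential: [exp (l * y)] is [1 / l] times a reflected exponential
   density. For [y >= 0] the bounds [y ^ 2 / 2 <= exp y] and [(y - (l + 1)) ^ 2 >= 0] give
   [l * y - exp y <= (l + 1) ^ 2 / 2 - y], hence the constant. *)
pose bnd (y : measurableTypeR R) : R := l^-1 * exponential_pdf l (- y)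
  + expR ((l + 1) ^+ 2 / 2) * exponential_pdf 1 y.
have g_le y : g 1 y <= bnd y.
  rewrite /g /bnd mul1r; have [y0|y0] := leP 0 y.
    rewrite (exponential_pdfE _ y0) mul1r mulN1r -expRD.
    rewrite -[leLHS]add0r lerD//.
      by rewrite mulr_ge0 ?exponential_pdf_ge0 ?invr_ge0 ?ltW.
    rewrite ler_expR.
    have : y ^+ 2 / 2 <= expR y.
      by apply: le_trans (expR_ge1Dxn 1 y0); rewrite lerDr.
    have : 0 <= (y - (l + 1)) ^+ 2 by apply: sqr_ge0.
    by rewrite !expr2; nra.
  have yn : 0 <= - y by rewrite oppr_ge0 ltW.
  rewrite (exponential_pdfE _ yn) mulrA mulVf ?gt_eqF//.
  rewrite mul1r mulrNN -[leLHS]addr0 lerD//.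
    by rewrite ler_expR gerBl expR_ge0.
  by rewrite mulr_ge0 ?exponential_pdf_ge0 ?expR_ge0.
have fin : (\int[leb]_y (g 1 y)%:E < +oo)%E.
  have mp1 : measurable_fun setT (fun y : measurableTypeR R => (exponential_pdf l y)%:E).
    by apply/measurable_EFinP; exact: measurable_exponential_pdf.
  have mp2 : measurable_fun setT (fun y : measurableTypeR R => (exponential_pdf 1 y)%:E).
    by apply/measurable_EFinP; exact: measurable_exponential_pdf.
  have mp1N : measurable_fun setT
      (fun y : measurableTypeR R => (exponential_pdf l (- y)%R)%:E).
    by apply: (measurableT_comp mp1).
  apply: (@le_lt_trans _ _ (\int[leb]_y (bnd y)%:E)%E).
    apply: ge0_le_integral => //.
    - apply/measurable_EFinP; apply: measurable_funD; apply: measurable_funM => //;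
      exact/measurable_EFinP.
    - by move=> y _; rewrite lee_fin.
  have p1 (y : measurableTypeR R) : (0 <= (exponential_pdf l y)%:E)%E.
    by rewrite lee_fin exponential_pdf_ge0// ltW.
  have p2 (y : measurableTypeR R) : (0 <= (exponential_pdf 1 y)%:E)%E.
    by rewrite lee_fin exponential_pdf_ge0.
  have c1 : (0 <= l^-1%:E)%E by rewrite lee_fin invr_ge0 ltW.
  have c2 : (0 <= (expR ((l + 1) ^+ 2 / 2))%:E)%E by rewrite lee_fin expR_ge0.
  rewrite /bnd; under eq_integral do rewrite EFinD !EFinM.
  rewrite ge0_integralD//.
  - rewrite !ge0_integralZl//= (ge0_integralT_opp mp1)//.
    by rewrite !integral_exponential_pdf// !mule1 -EFinD ltry.
  - by move=> x _; rewrite mule_ge0.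
  - by apply: emeasurable_funM.
  - by move=> x _; rewrite mule_ge0.
  - by apply: emeasurable_funM.
have pos : (0 < \int[leb]_y (g 1 y)%:E)%E.
  have H : (0 < \int[leb]_(y in `[0%R, 1%R]) (expR (- expR 1))%:E)%E.
    rewrite integral_cst//= lebesgue_measure_itv/= lte01 oppr0 adde0 mule1.
    by rewrite lte_fin expR_gt0.
  apply: (lt_le_trans H); apply: (@le_trans _ _ (\int[leb]_(y in `[0%R, 1%R]) (g 1 y)%:E)%E).
    apply: ge0_le_integral => //.
    - exact: measurable_funS (mg 1).
    - move=> y /=; rewrite in_itv/= => /andP[y0 y1].
      rewrite lee_fin ler_expR mul1r -[leLHS]add0r lerD//.
        by rewrite mulr_ge0// ltW.
      by rewrite lerN2 ler_expR.
  by apply: ge0_subset_integral.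
(* The inverse of [Gamma l], which is the integral of [g 1]. *)
exists (fine (\int[leb]_y (g 1 y)%:E))^-1.
  by rewrite invr_gt0 fine_gt0// pos.
move=> s s0; under eq_integral do rewrite EFinM.
have c0 : (0 <= (fine (\int[leb]_y (g 1 y)%:E))^-1%:E)%E.
  by rewrite lee_fin invr_ge0 fine_ge0// ltW.
rewrite (ge0_integralZl _ measurableT (mg s))// (shift s s0) muleCA.
rewrite -[X in (_ * (_ * X))%E]fineK ?ge0_fin_numE ?ltW//.
have /gt_eqF I0 : 0 < fine (\int[leb]_y (g 1 y)%:E) by rewrite fine_gt0// pos.
by rewrite -EFinM mulVf ?I0 ?mulr1.
Qed.
End gamma_integral.

(** * Moment generating functions *)

Section exp_series.
Context {R : realType}.
Implicit Types t h : R.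

Lemma cvg_series_exp_coeff t : series (exp_coeff t) @ \oo --> expR t.
Proof. exact: is_cvg_series_exp_coeff. Qed.

Lemma series_exp_coeff_le t n : 0 <= t -> series (exp_coeff t) n <= expR t.
Proof.
move=> t0; apply: nondecreasing_cvgn_le; last exact: is_cvg_series_exp_coeff.
by apply: nondecreasing_series => k _ _; exact: exp_coeff_ge0.
Qed.

(** Gives a majorant of exponential series that is integrable as soon as the transforms at [h] and
    at [- h] are finite. *)
Lemma expR_normr_le t : expR `|t| <= expR t + expR (- t).
Proof.
have [t0|t0] := leP 0 t; first by rewrite ger0_norm// lerDl expR_ge0.
by rewrite ltr0_norm// lerDr expR_ge0.
Qed.

Lemma normr_series_exp_coeff t n :
  `|series (exp_coeff t) n| <= expR t + expR (- t).
Proof.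
apply: le_trans (expR_normr_le t).
apply: le_trans (series_exp_coeff_le n (normr_ge0 t)).
by rewrite -normed_series_exp_coeff; exact: ler_norm_sum.
Qed.

Lemma normr_exp_coeff t n : `|exp_coeff t n| <= expR t + expR (- t).
Proof.
have -> : `|exp_coeff t n| = exp_coeff `|t| n.
  by rewrite /exp_coeff/= normrM normrX normfV (@ger0_norm _ _`!%:R).
apply: le_trans (expR_normr_le t).
apply: le_trans (series_exp_coeff_le n.+1 (normr_ge0 t)).
rewrite /series/= big_nat_recr//= lerDr sumr_ge0// => k _.
by rewrite divr_ge0// exprn_ge0.
Qed.

(** A one-sided identity theorem. If [c k] is the first non-zero coefficient, the later terms at
    [h = q * s] form a geometric tail of order [q ^ (k + 1)], too small to cancel the term of order
    [q ^ k]. *)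
Lemma power_series_eq0 (c : nat -> R) (r : R) : 0 < r ->
  (forall h, 0 < h -> h < r -> series (fun k => c k * h ^+ k) @ \oo --> (0 : R)) ->
  forall k, c k = 0.
Proof.
move=> r0 cvg0.
suff H k : (forall j, (j < k)%N -> c j = 0) -> c k = 0.
  by move=> k; elim/ltn_ind: k => k IH; exact: H.
move=> cj0.
pose s := r / 2; have s0 : 0 < s by rewrite divr_gt0.
have sr : s < r by rewrite /s; lra.
have [K K0 cK] : exists2 K, 0 < K & forall j, `|c j * s ^+ j| <= K.
  have c0 := cvg_series_cvg_0 (cvgP _ (cvg0 s s0 sr)).
  have /pinfty_ex_gt0[K K0 HK] := cvg_seq_bounded (cvgP _ c0).
  by exists K => // j; exact: HK.
have tail q n : 0 <= q -> q <= 2^-1 -> `|c k| * (q * s) ^+ k <=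
    `|series (fun j => c j * (q * s) ^+ j) (k.+1 + n)%N| + 2 * K * q ^+ k.+1.
  move=> q0 q2.
  have -> : series (fun j => c j * (q * s) ^+ j) (k.+1 + n)%N =
      c k * (q * s) ^+ k + \sum_(k.+1 <= j < k.+1 + n) c j * (q * s) ^+ j.
    rewrite /series/= (@big_cat_nat _ _ _ k.+1)//= ?leq_addr//; congr (_ + _).
    rewrite big_nat_recr//= big_nat big1 ?add0r// => j /andP[_ jk].
    by rewrite cj0 ?mul0r.
  set S := \sum_(_ <= _ < _) _.
  have HS : `|S| <= 2 * K * q ^+ k.+1.
    apply: (le_trans (ler_norm_sum _ _ _)).
    apply: (@le_trans _ _ (\sum_(k.+1 <= j < k.+1 + n) K * q ^+ j)).
      apply: ler_sum => j _; rewrite (_ : _ * _ = c j * s ^+ j * q ^+ j); last first.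
        by rewrite exprMn; ring.
      rewrite normrM.
      rewrite ler_pM//.
      by rewrite ger0_norm ?exprn_ge0.
    rewrite -mulr_sumr (_ : 2 * K * _ = K * (2 * q ^+ k.+1)); last by ring.
    rewrite ler_pM2l// -{1}[k.+1]add0n big_addn addnC addnK.
    under eq_bigr do rewrite exprD.
    rewrite -mulr_suml ler_wpM2r ?exprn_ge0//.
    elim: n {S} => [|n IH]; first by rewrite big_nil.
    rewrite big_nat_recl//=; under eq_bigr do rewrite exprS.
    rewrite -mulr_sumr expr0.
    have : q * \sum_(0 <= i < n) q ^+ i <= 2^-1 * 2.
      by apply: ler_pM => //; apply: sumr_ge0 => i _; rewrite exprn_ge0.
    by rewrite mulVf//; lra.
  have -> : `|c k| * (q * s) ^+ k = `|c k * (q * s) ^+ k|.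
    have qs0 : 0 <= q * s by rewrite mulr_ge0// ltW.
    by rewrite normrM [in RHS](ger0_norm (exprn_ge0 _ qs0)).
  have := ler_normD (c k * (q * s) ^+ k + S) (- S).
  by rewrite addrK normrN; lra.
have main q : 0 < q -> q <= 2^-1 -> `|c k| * s ^+ k <= 2 * K * q.
  move=> q0 q2; have H n := tail q n (ltW q0) q2; move: (2 * K) H => K' H.
  have : `|c k| * (q * s) ^+ k <= K' * q ^+ k.+1.
    rewrite leNgt; apply/negP => lt.
    have qs0 : 0 < q * s by rewrite mulr_gt0.
    have qsr : q * s < r by have : q * s <= 2^-1 * s by [rewrite ler_pM2r|]; lra.
    have e0 : 0 < `|c k| * (q * s) ^+ k - K' * q ^+ k.+1 by rewrite subr_gt0.
    have /cvgrPdist_lt/(_ _ e0)[N _ HN] := cvg0 _ qs0 qsr.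
    have := HN (k.+1 + N)%N (leq_addl _ _); rewrite /= sub0r normrN.
    by have := H N; lra.
  rewrite exprMn exprS (_ : _ * (_ * _) = `|c k| * s ^+ k * q ^+ k); last by ring.
  by rewrite mulrA ler_pM2r ?exprn_gt0.
apply/eqP; rewrite -normr_eq0 eq_le normr_ge0 andbT leNgt; apply/negP => ck0.
have sk : 0 < `|c k| * s ^+ k by rewrite mulr_gt0// exprn_gt0.
set a := _ * _ in main sk.
(* With this [q] the bound [a <= 2 * K * q] of [main] would give [a <= a / 2]. *)
pose q := Num.min 2^-1 (a / (4 * K)).
have q0 : 0 < q by rewrite lt_min invr_gt0 ltr0n/= divr_gt0// mulr_gt0.
have := main q q0; rewrite ge_min lexx => /(_ isT).
have : q <= a / (4 * K) by rewrite ge_min lexx orbT.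
rewrite ler_pdivlMr ?mulr_gt0//; lra.
Qed.

End exp_series.

Section mgf.
Context d (T : measurableType d) (R : realType).
Implicit Types (m : {measure set T -> \bar R}) (Y : T -> R).
Local Open Scope ereal_scope.

Definition mgf m Y (h : R) : \bar R := \int[m]_x (expR (h * Y x))%:E.

Lemma measurable_mgf_fun Y (h : R) : measurable_fun setT Y ->
  measurable_fun setT (fun x => (expR (h * Y x))%:E).
Proof.
by move=> mY; apply/measurable_EFinP; apply: measurableT_comp => //;
  exact: measurable_funM.
Qed.

Lemma mgf_ge0 m Y h : 0 <= mgf m Y h.
Proof. by apply: integral_ge0 => x _; rewrite lee_fin expR_ge0. Qed.

Lemma integrable_mgf m Y h : measurable_fun setT Y -> mgf m Y h < +oo ->
  m.-integrable setT (fun x => (expR (h * Y x))%:E).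
Proof.
move=> mY fin; apply/integrableP; split; first exact: measurable_mgf_fun.
by under eq_integral do rewrite gee0_abs ?lee_fin ?expR_ge0//.
Qed.

Lemma integrable_cosh m Y h : measurable_fun setT Y ->
    mgf m Y h < +oo -> mgf m Y (- h)%R < +oo ->
  m.-integrable setT (fun x => (expR (h * Y x) + expR (- (h * Y x)))%:E).
Proof.
move=> mY fin1 fin2.
have -> : (fun x => (expR (h * Y x) + expR (- (h * Y x)))%:E) =
    (fun x => (expR (h * Y x))%:E) \+ (fun x => (expR (- h * Y x))%:E).
  by apply/funext => x /=; rewrite mulNr.
by apply: integrableD => //; exact: integrable_mgf.
Qed.

(** One term of the exponential series of [|h * Y|] is at most the whole sum, so [|Y| ^ k] is
    bounded by [k! / |h| ^ k] times [exp (h * Y) + exp (- h * Y)]. *)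
Lemma integrable_moment m Y (h : R) k : measurable_fun setT Y -> (h != 0)%R ->
    mgf m Y h < +oo -> mgf m Y (- h)%R < +oo ->
  m.-integrable setT (fun x => (Y x ^+ k)%:E).
Proof.
move=> mY h0 fin1 fin2.
have ic := integrable_cosh mY fin1 fin2.
apply: (le_integrable _ _ _ (integrableZl measurableT (k`!%:R / `|h| ^+ k)%R ic)) => //.
  by apply/measurable_EFinP; exact: measurable_funX.
move=> x _ /=; rewrite lee_fin.
rewrite [leRHS]ger0_norm; last by rewrite mulr_ge0// ?addr_ge0 ?expR_ge0.
rewrite mulrAC ler_pdivlMr ?exprn_gt0 ?normr_gt0//.
rewrite -normrX -normrM -exprMn mulrC -ler_pdivrMl ?ltr0n ?fact_gt0//.
have := normr_exp_coeff (h * Y x) k; apply: le_trans.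
by rewrite /exp_coeff/= normrM normfV (@ger0_norm _ _`!%:R)// [X in (_ <= X)%R]mulrC (mulrC h).
Qed.

Lemma mgf_series m Y (h : R) : measurable_fun setT Y -> (h != 0)%R ->
    mgf m Y h < +oo -> mgf m Y (- h)%R < +oo ->
  series (fun k => h ^+ k / k`!%:R * \int[m]_x (Y x ^+ k))%R @ \oo -->
    fine (mgf m Y h).
Proof.
move=> mY h0 fin1 fin2.
set u := series _; suff : (u n)%:E @[n --> \oo] --> (fine (mgf m Y h))%:E.
  exact: fine_cvg.
rewrite /u {u} fineK ?ge0_fin_numE ?mgf_ge0//.
pose f_ n x := (series (exp_coeff (h * Y x)) n)%:E.
have mf n : measurable_fun setT (f_ n).
  apply/measurable_EFinP; rewrite /series/=.
  apply: (@measurable_sum _ _ _ _ _ _ (fun k x => exp_coeff (h * Y x) k)) => k.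
  by apply: measurable_funM => //; apply: measurable_funX; exact: measurable_funM.
have cf : {ae m, forall x, setT x -> f_ ^~ x @ \oo --> (expR (h * Y x))%:E}.
  apply: aeW => x _; apply: cvg_EFin; first exact: nearW.
  exact: cvg_series_exp_coeff.
have df : {ae m, forall x n, setT x ->
    `|f_ n x| <= (expR (h * Y x) + expR (- (h * Y x)))%:E}.
  apply: aeW => x n _; rewrite lee_fin; exact: normr_series_exp_coeff.
have [_ _] := dominated_convergence measurableT mf (measurable_mgf_fun _ mY)
  cf (integrable_cosh mY fin1 fin2) df.
apply: cvg_trans; apply: near_eq_cvg; apply: nearW => n /=.
under eq_integral do rewrite /f_ /series/= -sumEFin.
have iY k := integrable_moment k mY h0 fin1 fin2.
have iek k : m.-integrable setT (fun x => (exp_coeff (h * Y x) k)%:E).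
  rewrite (_ : (fun x => _) = (fun x => (h ^+ k / k`!%:R)%:E * (Y x ^+ k)%:E)).
    exact: integrableZl.
  apply/funext => x; rewrite /exp_coeff/= -EFinM exprMn; congr EFin; ring.
rewrite integral_sum// /series/= -sumEFin; apply: eq_bigr => k _.
rewrite EFinM fineK; last by rewrite integrable_fin_num.
rewrite -integralZl//; apply: eq_integral => x _.
rewrite /exp_coeff/= -EFinM exprMn; congr EFin; ring.
Qed.

(** The odd terms cancel and the even ones are non-negative, so integration term by term is valid
    even when both sides are infinite. *)
Lemma mgfDN m Y (h : R) : measurable_fun setT Y ->
  mgf m Y h + mgf m Y (- h)%R = \sum_(k <oo)
    \int[m]_x (exp_coeff (h * Y x) k + exp_coeff (- (h * Y x)) k)%:E.
Proof.
move=> mY; have mm h' := measurable_mgf_fun h' mY.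
have p h' x : 0 <= (expR (h' * Y x))%:E by rewrite lee_fin expR_ge0.
rewrite /mgf -ge0_integralD//.
have ge0 t k : (0 <= exp_coeff t k + exp_coeff (- t) k :> R)%R.
  rewrite /exp_coeff/= -mulrDl mulr_ge0// exprNn -{1}[(t ^+ k)%R]mul1r -mulrDl.
  rewrite -signr_odd; case: (boolP (odd k)) => odd_k; first by rewrite expr1 subrr mul0r.
  by rewrite expr0 mulr_ge0 ?exprn_even_ge0 ?addr_ge0.
rewrite -integral_nneseries//; last 2 first.
- move=> k; apply/measurable_EFinP; apply: measurable_funD.
    apply: measurable_funM => //; apply: measurable_funX; exact: measurable_funM.
  apply: measurable_funM => //; apply: measurable_funX; apply: measurableT_comp => //.
  exact: measurable_funM.
- by move=> k x _; rewrite lee_fin.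
apply: eq_integral => x _; apply/esym/cvg_lim => //.
rewrite mulNr; set t := (h * Y x)%R.
rewrite -EFinD (_ : (fun n => _) = fun n =>
    (series (exp_coeff t) n + series (exp_coeff (- t)) n)%:E); last first.
  by apply/funext => n; rewrite /series/= -big_split/= sumEFin.
apply: cvg_EFin; first exact: nearW.
by apply: cvgD; exact: cvg_series_exp_coeff.
Qed.

End mgf.

(* Equality of the moment generating functions near 0 forces equality of all
   moments, hence of the even series [mgf h + mgf (- h)] for every h. *)
Lemma mgf_unique d1 d2 (T1 : measurableType d1) (T2 : measurableType d2)
    (R : realType) (m1 : {measure set T1 -> \bar R})
    (m2 : {measure set T2 -> \bar R}) (Y1 : T1 -> R) (Y2 : T2 -> R) (r h : R) :
  measurable_fun setT Y1 -> measurable_fun setT Y2 -> 0 < r ->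
  (forall s, `|s| < r -> mgf m1 Y1 s = mgf m2 Y2 s /\ (mgf m2 Y2 s < +oo)%E) ->
  (mgf m2 Y2 h < +oo)%E -> (mgf m2 Y2 (- h) < +oo)%E ->
  mgf m1 Y1 h = mgf m2 Y2 h.
Proof.
move=> mY1 mY2 r0 eqm fin fin'.
have [->|h0] := eqVneq h 0; first by have [] := eqm 0 _; rewrite ?normr0.
pose s := r / 2.
have [s0 sr] : 0 < s /\ s < r by rewrite /s; split; lra.
have nsr : `|s| < r by rewrite gtr0_norm.
have nsr' : `|- s| < r by rewrite normrN.
have sn0 : s != 0 by rewrite gt_eqF.
have f1 u : `|u| < r -> (mgf m1 Y1 u < +oo)%E by move=> ur; have [->] := eqm u ur.
have f2 u : `|u| < r -> (mgf m2 Y2 u < +oo)%E by move=> ur; have [] := eqm u ur.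
have mom k : \int[m1]_x (Y1 x ^+ k) = \int[m2]_x (Y2 x ^+ k).
  pose c k := k`!%:R^-1 * (\int[m1]_x (Y1 x ^+ k) - \int[m2]_x (Y2 x ^+ k)).
  have : c k = 0.
    apply: (power_series_eq0 r0) => u u0 ur.
    have un0 : u != 0 by rewrite gt_eqF.
    have nur : `|u| < r by rewrite gtr0_norm.
    have nur' : `|- u| < r by rewrite normrN.
    have c1 := mgf_series mY1 un0 (f1 _ nur) (f1 _ nur').
    have c2 := mgf_series mY2 un0 (f2 _ nur) (f2 _ nur').
    have [e _] := eqm u nur; have := cvgB c1 c2; rewrite e subrr => cB.
    suff -> : series (fun k => c k * u ^+ k) =
      series (fun j => u ^+ j / j`!%:R * \int[m1]_x (Y1 x ^+ j)) \-
      series (fun j => u ^+ j / j`!%:R * \int[m2]_x (Y2 x ^+ j)) by exact: cB.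
    apply/funext => n; rewrite /series/= -sumrB.
    by apply: eq_bigr => j _; rewrite /c; ring.
  move/eqP; rewrite mulf_eq0 invr_eq0 pnatr_eq0 gtn_eqF ?fact_gt0//= subr_eq0.
  by move/eqP.
have sum_eq : (mgf m1 Y1 h + mgf m1 Y1 (- h) = mgf m2 Y2 h + mgf m2 Y2 (- h))%E.
  rewrite !mgfDN//; apply: eq_eseriesr => k _.
  have E (d : measure_display) (T : measurableType d) (m : {measure set T -> \bar R})
      (Y : T -> R) : measurable_fun setT Y ->
      (mgf m Y s < +oo)%E -> (mgf m Y (- s) < +oo)%E ->
    (\int[m]_x (exp_coeff (h * Y x) k + exp_coeff (- (h * Y x)) k)%:E =
     ((h ^+ k + (- h) ^+ k) / k`!%:R * \int[m]_x (Y x ^+ k)%R)%:E)%E.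
    move=> mY fs fs'; have iY := integrable_moment k mY sn0 fs fs'.
    rewrite EFinM fineK ?integrable_fin_num// -integralZl//.
    apply: eq_integral => x _; rewrite -EFinM /exp_coeff/= -mulNr !exprMn.
    congr EFin; ring.
  rewrite (E _ _ m1 Y1 mY1 (f1 _ nsr) (f1 _ nsr')).
  by rewrite (E _ _ m2 Y2 mY2 (f2 _ nsr) (f2 _ nsr')) mom.
(* So far only the two-sided sums agree. They are finite, hence so is each transform of [m1], and
   the full moment series can be compared at [h] itself. *)
have [g1 g2] : (mgf m1 Y1 h < +oo)%E /\ (mgf m1 Y1 (- h) < +oo)%E.
  have : (mgf m1 Y1 h + mgf m1 Y1 (- h) < +oo)%E by rewrite sum_eq lte_add_pinfty.
  move=> lt; split; apply: le_lt_trans lt.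
    by rewrite leeDl// mgf_ge0.
  by rewrite leeDr// mgf_ge0.
have c1 := mgf_series mY1 h0 g1 g2.
have c2 := mgf_series mY2 h0 fin fin'.
rewrite -[LHS]fineK ?ge0_fin_numE ?mgf_ge0// -[RHS]fineK ?ge0_fin_numE ?mgf_ge0//.
congr EFin; move: c1 c2; under eq_fun do rewrite mom.
by move=> c1 c2; apply: cvg_unique c1 c2.
Qed.

(** * Extension of the Laplace transform to the orthant *)

Section affine_power.
Context d (T : measurableType d) (R : realType).
Variables (m : {measure set T -> \bar R}) (Y : T -> R).
Hypothesis mY : measurable_fun setT Y.
Variables (l A B : R).
Hypothesis l0 : 0 < l.

Definition mgf_power (s : R) :=
  0 < A + B * s /\ mgf m Y (- s) = ((A + B * s) `^ (- l))%:E.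

(* The tilted measure is compared with the law of [B] times a gamma variable,
   written in logarithmic coordinates. *)
Lemma mgf_power_local (s0 r : R) : 0 < r ->
  (forall s, `|s - s0| < r -> mgf_power s) ->
  forall s, 0 < A + B * s -> A + B * s < 2 * (A + B * s0) -> mgf_power s.
Proof.
move=> r0 H s us us2.
pose u0 := A + B * s0; have u00 : 0 < u0 by have [] := H s0 _; rewrite ?subrr ?normr0.
have mw : measurable_fun setT (fun x => expR (- s0 * Y x)).
  by apply: measurableT_comp => //; exact: measurable_funM.
have [m1 [_ m1i]] := density_measure_ex m mw (fun x => expR_ge0 _).
have mgf1 h : mgf m1 Y h = mgf m Y (- (s0 - h)).
  rewrite /mgf m1i; last 2 first.
  - exact: measurable_mgf_fun.
  - by move=> x; rewrite lee_fin expR_ge0.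
  by apply: eq_integral => x _; rewrite -EFinM -expRD; congr (expR _)%:E; ring.
have [c c0 Hc] := gamma_integral l0.
have mg : measurable_fun setT (fun y : measurableTypeR R =>
    c * expR (l * y - u0 * expR y)).
  by apply: measurable_funM => //; exact: measurable_log_gamma.
have [m2 [_ m2i]] := density_measure_ex lebesgue_measure mg
  (fun y => mulr_ge0 (ltW c0) (expR_ge0 _)).
pose G (y : measurableTypeR R) : R := B * expR y.
have mG : measurable_fun setT G by apply: measurable_funM.
have mgf2 h : 0 < A + B * (s0 - h) ->
    mgf m2 G h = ((A + B * (s0 - h)) `^ (- l))%:E.
  move=> uh; rewrite /mgf m2i; last 2 first.
  - exact: measurable_mgf_fun.
  - by move=> x; rewrite lee_fin expR_ge0.
  rewrite -Hc//; apply: eq_integral => y _; rewrite -EFinM mulrCA -expRD.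
  by congr (_ * expR _)%:E; rewrite /G /u0; ring.
split => //; have -> : s = s0 - (s0 - s) by ring.
rewrite -mgf1 -mgf2; last by rewrite subKr.
apply: (mgf_unique mY mG r0) => [h hr| |].
- have [|uh Hh] := H (s0 - h); first by rewrite addrAC subrr sub0r normrN.
  by rewrite mgf1 mgf2// Hh; split => //; rewrite ltry.
- by rewrite mgf2 ?ltry ?subKr.
(* The mirror image [2 * s0 - s] of [s] must lie in the domain too; this is the origin of the factor
   2 in the hypothesis. *)
- rewrite mgf2 ?ltry//; move: us2; rewrite /u0; lra.
Qed.

(** One local step from the midpoint of [s0] and [s] reaches [s]. If all positive values of
    [A + B * s] below [q * (2 * u0)] are settled and [q >= 1], the midpoints settle those below
    [3 / 2 * q * (2 * u0)], so every positive value is reached. [B] may have either sign or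
    vanish. *)
Lemma mgf_power_extend (s0 r : R) : 0 < r ->
  (forall s, `|s - s0| < r -> mgf_power s) ->
  forall s, 0 < A + B * s -> mgf_power s.
Proof.
move=> r0 H.
pose u0 := A + B * s0; have u00 : 0 < u0 by have [] := H s0 _; rewrite ?subrr ?normr0.
have step n s : 0 < A + B * s -> A + B * s < (3 / 2) ^+ n * (2 * u0) -> mgf_power s.
  elim: n s => [|n IH] s us; first by rewrite expr0 mul1r; exact: mgf_power_local H _ us.
  set q := (3 / 2) ^+ n in IH.
  have q1 : 1 <= q by apply: exprn_ege1; lra.
  rewrite exprS -/q => us2.
  pose s' := (s0 + s) / 2; have u' : A + B * s' = (u0 + (A + B * s)) / 2.
    by rewrite /s' /u0; field.
  (* Around the midpoint [A + B * v] may move by less than [e] and remain positive and within reach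
     of the induction hypothesis. Dividing by [|B| + 1] makes this a radius for [v], also when
     [B = 0]. *)
  pose e := Num.min ((u0 + (A + B * s)) / 2) (q * (2 * u0) - (u0 + (A + B * s)) / 2).
  have qu : u0 <= q * u0 by rewrite ler_peMl// ltW.
  have e0 : 0 < e by rewrite lt_min; apply/andP; split; nra.
  have B1 : 0 < `|B| + 1 by rewrite ltr_wpDl.
  apply: (@mgf_power_local s' (e / (`|B| + 1))) => //; first by rewrite divr_gt0.
    move=> v; rewrite ltr_pdivlMr// => ve.
    have : `|B * (v - s')| < e.
      apply: le_lt_trans ve; rewrite normrM mulrDr mulr1 mulrC lerDl//.
    rewrite ltr_norml lt_min => /andP[lo /andP[hi1 hi2]].
    have lo1 : - ((u0 + (A + B * s)) / 2) < B * (v - s').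
      by apply: le_lt_trans lo; rewrite lerN2 ge_min lexx.
    have uv : A + B * v = (u0 + (A + B * s)) / 2 + B * (v - s') by rewrite -u'; ring.
    by apply: IH; rewrite uv; lra.
  by rewrite u'; lra.
move=> s us.
have [n Hn] : exists n : nat, A + B * s < (3 / 2) ^+ n * (2 * u0).
  pose a := (A + B * s) / (2 * u0); exists (2 * (Num.truncn a).+1)%N.
  have bern n : 1 + n%:R * 2^-1 <= (3 / 2 : R) ^+ n.
    elim: n => [|n IH]; first by rewrite mul0r addr0.
    have n0 : 0 <= n%:R :> R by [].
    by rewrite exprS -natr1; lra.
  have /lt_le_trans : a < (Num.truncn a).+1%:R by rewrite truncnS_gt.
  have := bern (2 * (Num.truncn a).+1)%N.
  rewrite natrM mulrAC divff// mul1r => bn.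
  rewrite -ltr_pdivrMr ?mulr_gt0//; apply; apply: le_trans bn.
  by rewrite lerDr.
exact: step Hn.
Qed.

(** A finite transform forces a positive base. By convexity the transform is at most [K] on the
    segment from [s0] to [s]. If [A + B * s] were not positive, the affine function would take
    arbitrarily small positive values on that segment, where the transform, being a negative power,
    exceeds [K]. *)
Lemma mgf_power_fin (s0 r : R) : 0 < r ->
  (forall s, `|s - s0| < r -> mgf_power s) ->
  forall s, (mgf m Y (- s) < +oo)%E -> mgf_power s.
Proof.
move=> r0 H s fin.
pose u0 := A + B * s0; have u00 : 0 < u0 by have [] := H s0 _; rewrite ?subrr ?normr0.
have [us|us] := ltP 0 (A + B * s); first exact: mgf_power_extend H _ us.
exfalso.
pose K := fine (mgf m Y (- s)) + fine (mgf m Y (- s0)).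
have [_ fs0] : mgf_power s0 by apply: H; rewrite subrr normr0.
have bnd t : 0 <= t -> t <= 1 ->
    (mgf m Y (- (s0 + t * (s - s0))) <= K%:E)%E.
  move=> t0 t1; rewrite EFinD !fineK ?ge0_fin_numE ?mgf_ge0//; last first.
    by rewrite fs0 ltry.
  have mm h := measurable_mgf_fun h mY.
  have p h x : (0 <= (expR (h * Y x))%:E)%E by rewrite lee_fin expR_ge0.
  rewrite /mgf -ge0_integralD//; apply: ge0_le_integral => //.
    exact: emeasurable_funD.
  move=> x _; rewrite -EFinD lee_fin.
  have E : - (s0 + t * (s - s0)) * Y x = - s0 * Y x + t * ((s0 - s) * Y x) by ring.
  have [sY|sY] := leP ((s0 - s) * Y x) 0.
    rewrite -[leLHS]add0r lerD ?expR_ge0// ler_expR E gerDl.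
    by rewrite mulr_ge0_le0.
  rewrite -[leLHS]addr0 lerD ?expR_ge0// ler_expR E.
  have := ler_wpM2r (ltW sY) t1; lra.
have K0 : 0 <= K by rewrite addr_ge0// fine_ge0// mgf_ge0.
(* Chosen so that [e ^ (- l) >= K + 1]; below, [t] is the parameter of the point of the segment
   where the affine function equals [e]. *)
pose e := Num.min u0 ((K + 1)^-1 `^ l^-1).
have e0 : 0 < e by rewrite lt_min u00 powR_gt0// invr_gt0 ltr_wpDl.
have eu0 : e <= u0 by rewrite ge_min lexx.
have ee : e <= (K + 1)^-1 `^ l^-1 by rewrite ge_min lexx orbT.
pose t := (u0 - e) / (u0 - (A + B * s)).
have den0 : 0 < u0 - (A + B * s) by lra.
have t0 : 0 <= t by apply: divr_ge0; [rewrite subr_ge0|exact: ltW].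
have t1 : t <= 1 by rewrite ler_pdivrMr// mul1r; lra.
have ut : A + B * (s0 + t * (s - s0)) = e.
  rewrite (_ : _ + _ = u0 - t * (u0 - (A + B * s))); last by rewrite /u0; ring.
  by rewrite divfK ?gt_eqF// subKr.
have [_ Ht] : mgf_power (s0 + t * (s - s0)) by apply: mgf_power_extend H _ _; rewrite ?ut.
have := bnd t t0 t1; rewrite Ht ut lee_fin powRN.
have el : e `^ l <= (K + 1)^-1.
  have K1 : 0 <= (K + 1)^-1 by rewrite invr_ge0 addr_ge0.
  rewrite -[leRHS](powRr1 K1) -[X in _ <= _ `^ X](mulVf (lt0r_neq0 l0)) powRrM.
  by apply: ge0_ler_powR => //; rewrite ?nnegrE ?powR_ge0// ltW.
have el0 : 0 < e `^ l by rewrite powR_gt0.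
move: el; rewrite -[e `^ l]invrK lef_pV2 ?posrE ?invr_gt0// ?ltr_wpDl//.
lra.
Qed.

End affine_power.

Section laplace_extension.
Context d (T : measurableType d) (R : realType) (n : nat).
Variables (m : {measure set T -> \bar R}) (X : T -> n.-tuple R).
Variables (P : 'rV[R]_n -> R) (l : R).
Implicit Type t : 'rV[R]_n.
Hypothesis mX : measurable_fun setT X.
Hypothesis l0 : 0 < l.

Definition row_set (t : 'rV[R]_n) (i : 'I_n) (s : R) : 'rV[R]_n :=
  \row_j (if j == i then s else t 0 j).

Definition affine_in_each (Q : 'rV[R]_n -> R) :=
  forall t i, exists A B, forall s, Q (row_set t i s) = A + B * s.

Hypothesis affP : affine_in_each P.

Definition laplace_power_at (t : 'rV[R]_n) :=
  0 < P t /\ laplace m X t = (P t `^ (- l))%:E.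

Lemma row_set_id t i : row_set t i (t 0 i) = t.
Proof. by apply/rowP => j; rewrite mxE; case: eqP => // ->. Qed.

Lemma measurable_tnth_comp i : measurable_fun setT (fun w => tnth (X w) i).
Proof. exact: (measurableT_comp (measurable_tnth i) mX). Qed.

Lemma measurable_laplace_fun (t : 'rV[R]_n) :
  measurable_fun setT (fun w => expR (- \sum_(i < n) t 0 i * tnth (X w) i)).
Proof.
apply: measurableT_comp => //; apply: measurableT_comp => //.
apply: (@measurable_sum _ _ _ _ _ _ (fun i w => t 0 i * tnth (X w) i)) => i.
by apply: measurable_funM => //; exact: measurable_tnth_comp.
Qed.

Lemma laplace_ge0 t : (0 <= laplace m X t)%E.
Proof. by apply: integral_ge0 => w _; rewrite lee_fin expR_ge0. Qed.

(** The exponential of all coordinates other than [i] is absorbed into the measure as a density,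
    which reduces a line parallel to an axis to the one-variable lemmas. *)
Lemma laplace_line t i : exists m' : {measure set T -> \bar R},
  forall s, laplace m X (row_set t i s) = mgf m' (fun w => tnth (X w) i) (- s).
Proof.
pose t0 := row_set t i 0.
have [m' [_ H]] := density_measure_ex m (measurable_laplace_fun t0)
  (fun w => expR_ge0 _).
exists m' => s; rewrite /mgf H; last 2 first.
- by apply: measurable_mgf_fun; exact: measurable_tnth_comp.
- by move=> w; rewrite lee_fin expR_ge0.
apply: eq_integral => w _; rewrite -EFinM -expRD; congr (expR _)%:E.
rewrite (bigD1 i)//= [X in _ = _ - X](bigD1 i)//= !mxE eqxx mul0r add0r.
rewrite opprD mulNr; congr (_ - _); apply: eq_bigr => j ji.
by rewrite !mxE (negbTE ji).
Qed.

(** Moves a point of the box about [c] to an arbitrary point of the product of the [D i], one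
    coordinate at a time. Either positivity of [P] or finiteness of the transform is enough at each
    point; both alternatives occur in the applications. *)
Lemma laplace_power_fill (c : 'I_n -> R) (e : R) (D : 'I_n -> set R) : 0 < e ->
  (forall i s, `|s - c i| < e -> D i s) ->
  (forall t, (forall i, `|t 0 i - c i| < e) -> laplace_power_at t) ->
  (forall t, (forall i, D i (t 0 i)) -> 0 < P t \/ (laplace m X t < +oo)%E) ->
  forall t, (forall i, D i (t 0 i)) -> laplace_power_at t.
Proof.
move=> e0 sub box dom t Dt.
(* The first [k] coordinates are free in the [D i]; the others still lie in the box. *)
suff H k : forall t, (forall i, D i (t 0 i)) ->
    (forall i : 'I_n, (k <= i)%N -> `|t 0 i - c i| < e) -> laplace_power_at t.
  by apply: (H n) => // i; rewrite leqNgt ltn_ord.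
elim: k => {t Dt} [|k IH] t Dt kt; first by apply: box => i; exact: kt.
have [kn|nk] := ltnP k n; last first.
  by apply: IH => // i ki; have := leq_ltn_trans ki (ltn_ord i); rewrite ltnNge nk.
pose i := Ordinal kn.
have [A [B AB]] := affP t i; have [m' Hm'] := laplace_line t i.
pose Y w := tnth (X w) i.
have conv s : laplace_power_at (row_set t i s) <-> mgf_power m' Y l A B s.
  by rewrite /laplace_power_at /mgf_power AB Hm'.
have near_c s : `|s - c i| < e -> mgf_power m' Y l A B s.
  move=> sc; apply/conv; apply: IH => [j|j kj]; rewrite mxE.
    by case: eqP => [->|_]; [exact: sub|exact: Dt].
  case: eqP => [->//|/eqP ji]; apply: kt.
  by rewrite ltn_neqAle kj andbT; apply: contra ji => /eqP kj'; exact/eqP/val_inj.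
rewrite -(row_set_id t i); apply/conv.
have [Pt|Lt] := dom t Dt.
  apply: (mgf_power_extend (measurable_tnth_comp i) l0 e0 near_c).
  by rewrite -AB row_set_id.
apply: (mgf_power_fin (measurable_tnth_comp i) l0 e0 near_c).
by rewrite -Hm' row_set_id.
Qed.

(** [exp (- q * a) <= 1 + exp (- a)] for [q] between 0 and 1, and the constant 1 is integrable
    because [m] is finite. *)
Lemma laplace_power_scale (t : 'rV[R]_n) (q : R) : (m setT < +oo)%E ->
  0 <= q -> q <= 1 -> (laplace m X t < +oo)%E -> (laplace m X (q *: t) < +oo)%E.
Proof.
move=> mfin q0 q1 fin.
apply: (@le_lt_trans _ _ (\int[m]_w (1%:E +
  (expR (- \sum_(i < n) t 0 i * tnth (X w) i))%:E))%E).
  apply: ge0_le_integral => //.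
  - by apply/measurable_EFinP; exact: measurable_laplace_fun.
  - by apply: emeasurable_funD => //; apply/measurable_EFinP; exact: measurable_laplace_fun.
  move=> w _; rewrite -EFinD lee_fin.
  set a := \sum_(i < n) t 0 i * tnth (X w) i.
  have -> : \sum_(i < n) (q *: t) 0 i * tnth (X w) i = q * a.
    by rewrite /a mulr_sumr; apply: eq_bigr => i _; rewrite mxE mulrA.
  have [a0|a0] := leP 0 a.
    apply: (@le_trans _ _ 1); last by rewrite lerDl expR_ge0.
    by rewrite -expR0 ler_expR oppr_le0 mulr_ge0.
  rewrite -[leLHS]add0r lerD// ler_expR lerN2.
  by rewrite -[leLHS]mul1r ler_nM2r.
have mt := (measurable_EFinP _ _).2 (measurable_laplace_fun t).
rewrite ge0_integralD//.
by rewrite integral_cst// mul1e lte_add_pinfty.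
Qed.

(** Positivity of [P] is known near 0 and on the orthant, while the given open set may be elsewhere.
    A box in it is contracted by powers of [q < 1] until it enters the neighbourhood of 0; on the
    way finiteness of the transform takes the place of positivity. *)
Theorem laplace_power_extend (rho : R) : (m setT < +oo)%E -> 0 < rho ->
  (forall t, (forall i, `|t 0 i| < rho) -> 0 < P t) ->
  (forall t, (forall i, 0 <= t 0 i) -> 0 < P t) ->
  laplace_eq_power m X P l ->
  forall t, (forall i, 0 <= t 0 i) -> laplace_power_at t.
Proof.
move=> mfin rho0 Prho Ppos [S [t0 /nbhs_ballP[e /= e0 ball_sub]] HS].
have box0 t : (forall i, `|t 0 i - t0 0 i| < e) -> laplace_power_at t.
  move=> tt0; apply: HS; apply: ball_sub; split => // i j.
  by rewrite (ord1 i) /ball/= distrC; exact: tt0.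
pose M := 1 + \sum_i `|t0 0 i|.
have M0 : 0 < M by rewrite ltr_pwDl// sumr_ge0.
have tM i : `|t0 0 i| <= M.
  by rewrite /M (bigD1 i)//= addrCA lerDl addr_ge0// sumr_ge0.
(* [M] bounds the coordinates of [t0], so the centre moves from step [k] to step [k + 1] by at most
   half of the radius [q ^ k * e]. The box of half the radius at step [k + 1] therefore lies in the
   box of step [k]. *)
pose h := Num.min 2^-1 (e / (2 * M)).
have h0 : 0 < h by rewrite lt_min invr_gt0 ltr0n/= divr_gt0// mulr_gt0.
have h2 : h <= 2^-1 by rewrite ge_min lexx.
have hM : h * M <= e / 2.
  have : h <= e / (2 * M) by rewrite ge_min lexx orbT.
  by rewrite -(ler_pM2r M0) => /le_trans; apply; rewrite invfM mulrA divfK ?gt_eqF.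
pose q := 1 - h; have [q0 q1] : 0 < q /\ q < 1 by rewrite /q; split; lra.
have boxk k t : (forall i, `|t 0 i - q ^+ k * t0 0 i| < q ^+ k * e) ->
    laplace_power_at t.
  elim: k t => [|k IH] t Ht.
    by apply: box0 => i; have := Ht i; rewrite expr0 !mul1r.
  have qk0 : 0 < q ^+ k by rewrite exprn_gt0.
  have qk1 : 0 < q ^+ k.+1 by rewrite exprn_gt0.
  pose D i : set R := [set s | `|s - q ^+ k.+1 * t0 0 i| < q ^+ k.+1 * e].
  apply: (@laplace_power_fill (fun i => q ^+ k.+1 * t0 0 i) (q ^+ k.+1 * e / 2) D) => //.
  - by rewrite divr_gt0// mulr_gt0.
  - move=> j s; rewrite /D/= => /lt_trans; apply.
    by rewrite ltr_pdivrMr// ltr_pMr ?mulr_gt0// ltr1n.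
  - move=> t' Ht'; apply: IH => i.
    have -> : t' 0 i - q ^+ k * t0 0 i =
      (t' 0 i - q ^+ k.+1 * t0 0 i) - q ^+ k * (h * t0 0 i).
      by rewrite exprS /q; ring.
    apply: le_lt_trans (ler_normB _ _) _.
    have : `|q ^+ k * (h * t0 0 i)| <= q ^+ k * (e / 2).
      rewrite normrM gtr0_norm// ler_pM2l// normrM gtr0_norm//.
      by apply: le_trans hM; rewrite ler_pM2l.
    have := Ht' i; have : q ^+ k.+1 * e / 2 <= q ^+ k * e / 2.
      by rewrite ler_pM2r// ler_pM2r// exprS ger_pMl// ltW.
    lra.
  - move=> t' Ht'; right.
    have -> : t' = q ^+ k.+1 *: (q ^- k.+1 *: t') by rewrite scalerA divff ?scale1r ?gt_eqF.
    apply: laplace_power_scale => //; first exact: ltW.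
      by rewrite exprn_ile1// ltW.
    have [_ ->] : laplace_power_at (q ^- k.+1 *: t'); last by rewrite ltry.
    apply: box0 => i; rewrite mxE.
    have := Ht' i; rewrite /D/= -(ltr_pM2l (_ : 0 < q ^- k.+1)) ?invr_gt0//.
    rewrite -{1}(gtr0_norm (_ : 0 < q ^- k.+1)) ?invr_gt0// -normrM mulrBr.
    by rewrite !mulrA mulVf ?gt_eqF// !mul1r.
have [k qk] : exists k, q ^+ k * (e + M) < rho.
  have eM : 0 < rho / (e + M) by rewrite divr_gt0// addr_gt0.
  have : `|q| < 1 by rewrite gtr0_norm.
  move=> /cvg_expr/cvgrPdist_lt/(_ _ eM)[k _ /(_ k (leqnn _))]/=.
  rewrite sub0r normrN gtr0_norm ?exprn_gt0// => qk.
  by exists k; rewrite -ltr_pdivlMr// addr_gt0.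
have boxr t : (forall i, `|t 0 i| < rho) -> laplace_power_at t.
  pose D (i : 'I_n) : set R := [set s | `|s| < rho].
  apply: (@laplace_power_fill (fun i => q ^+ k * t0 0 i) (q ^+ k * e) D) => //.
  - by rewrite mulr_gt0// exprn_gt0.
  - move=> i s; rewrite /D/= => Hs; apply: le_lt_trans qk.
    rewrite -[s](subrK (q ^+ k * t0 0 i)) mulrDr; apply: le_trans (ler_normD _ _) _.
    rewrite lerD ?(ltW Hs)// normrM gtr0_norm ?exprn_gt0//.
    by rewrite ler_pM2l ?exprn_gt0.
  - exact: boxk.
  - by move=> t' Ht'; left; exact: Prho.
pose D (i : 'I_n) : set R := [set s | 0 <= s].
(* The box of radius [rho / 2] about [rho / 2] lies both in the orthant and in the cube of radius
   [rho]. *)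
apply: (@laplace_power_fill (fun i => rho / 2) (rho / 2) D) => //.
- by rewrite divr_gt0.
- by move=> i s; rewrite /D/= ltr_norml => /andP[]; lra.
- move=> t Ht; apply: boxr => i; have := Ht i.
  by rewrite ltr_norml => /andP[? ?]; rewrite ltr_norml; apply/andP; split; lra.
- by move=> t Ht; left; exact: Ppos.
Qed.

End laplace_extension.

(** * Uniqueness of Laplace transforms *)

Section laplace_uniqueness.
Context {R : realType}.

(** The exponent equals [- n * exp (n * (c - y))], as in a Gumbel distribution function. The
    prefactor [n] sends the boundary case [y = c] to 0, so the limit is the indicator of the open
    ray. *)
Lemma cvg_gumbel_indic (c y : R) :
  expR (- (n%:R * expR (n%:R * c)) * expR (- n%:R * y)) @[n --> \oo] -->
  (\1_[set x | c < x] y : R).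
Proof.
have E n : - (n%:R * expR (n%:R * c)) * expR (- n%:R * y) =
    - (n%:R * expR (n%:R * (c - y))).
  have -> : n%:R * (c - y) = n%:R * c + - n%:R * y by ring.
  by rewrite expRD; ring.
under eq_fun do rewrite E.
rewrite indicE; have [cy|yc] := ltP c y.
  rewrite mem_set//= (_ : true%:R = expR 0 :> R); last by rewrite expR0.
  apply: (@cvg_comp _ _ _ (fun n : nat => - (n%:R * expR (n%:R * (c - y)))) expR
    _ (nbhs (0 : R))); last exact: continuous_expR.
  suff H : n%:R * expR (n%:R * (c - y)) @[n --> \oo] --> (0 : R).
    by have := cvgN H; rewrite oppr0; exact.
  (* By [exp x >= x ^ 2 / 2] the term is at most [K / n], and [1 / n <= 2 / (n + 1)]. *)
  pose K := 2 / (y - c) ^+ 2.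
  apply: (@squeeze_cvgr _ _ _ _ (fun=> 0) (fun n => K * n.+1%:R^-1 * 2)).
  - near=> n; rewrite mulr_ge0 ?expR_ge0//=.
    have [->|n0] := eqVneq n 0%N; first by rewrite mul0r !mulr_ge0 ?invr_ge0 ?sqr_ge0.
    have n1 : 1 <= n%:R :> R by rewrite ler1n lt0n.
    have n0' : 0 < n%:R :> R by rewrite ltr0n lt0n.
    have yc : 0 < y - c by rewrite subr_gt0.
    have nyc : 0 <= n%:R * (y - c) by rewrite mulr_ge0// ltW.
    have ge : (n%:R * (y - c)) ^+ 2 / 2 <= expR (n%:R * (y - c)).
      by apply: le_trans (expR_ge1Dxn 1 nyc); rewrite lerDr.
    have -> : n%:R * (c - y) = - (n%:R * (y - c)) by ring.
    rewrite expRN ler_pdivrMr ?expR_gt0//.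
    apply: (@le_trans _ _ (K * n.+1%:R^-1 * 2 * ((n%:R * (y - c)) ^+ 2 / 2))); last first.
      by rewrite ler_wpM2l// !mulr_ge0 ?invr_ge0 ?sqr_ge0.
    have -> : K * n.+1%:R^-1 * 2 * ((n%:R * (y - c)) ^+ 2 / 2) =
        2 * n%:R ^+ 2 / n.+1%:R.
      have yn : y - c != 0 by rewrite gt_eqF.
      by rewrite /K; field; rewrite yn andbT nat1r pnatr_eq0.
    by rewrite ler_pdivlMr ?ltr0n// -natr1; nra.
  - exact: cvg_cst.
  - rewrite -[X in _ --> X](_ : K * 0 * 2 = 0); last by ring.
    by apply: cvgMr_tmp; apply: cvgMl_tmp; exact: cvg_harmonic.
rewrite memNset//=; last by rewrite /= ltNge yc.
apply: (@squeeze_cvgr _ _ _ _ (fun=> 0) (fun n => expR (- n%:R))).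
- near=> n; rewrite expR_ge0/= ler_expR lerN2 ler_peMr//.
  by rewrite -expR0 ler_expR mulr_ge0// subr_ge0.
- exact: cvg_cst.
- exact: cvgn_expR.
Unshelve. all: by end_near.
Qed.

(** The transforms at the integers [n * k] are the moments of [exp (- n * Y)], which takes values in
    [0, 1] and so has a transform given everywhere by its moment series. Evaluating that transform
    at [- n * exp (n * c)] and letting [n] grow isolates the event [Y > c], and rays determine a
    finite measure on the line. *)
Lemma laplace_nat_unique d1 d2 (T1 : measurableType d1) (T2 : measurableType d2)
    (m1 : {measure set T1 -> \bar R}) (m2 : {measure set T2 -> \bar R})
    (Y1 : T1 -> R) (Y2 : T2 -> R) :
  measurable_fun setT Y1 -> measurable_fun setT Y2 ->
  (forall x, 0 <= Y1 x) -> (forall x, 0 <= Y2 x) ->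
  (m1 setT < +oo)%E -> (m2 setT < +oo)%E ->
  (forall k, mgf m1 Y1 (- k%:R) = mgf m2 Y2 (- k%:R)) ->
  forall A, measurable A -> m1 (Y1 @^-1` A) = m2 (Y2 @^-1` A).
Proof.
move=> mY1 mY2 Y10 Y20 fin1 fin2 H.
pose V d (T : measurableType d) (Y : T -> R) n x := expR (- n%:R * Y x).
have mV d (T : measurableType d) (Y : T -> R) n : measurable_fun setT Y ->
    measurable_fun setT (V _ _ Y n).
  by move=> mY; apply: measurableT_comp => //; exact: measurable_funM.
have V01 d (T : measurableType d) (Y : T -> R) n x : 0 <= Y x ->
    0 <= V _ _ Y n x <= 1.
  move=> Y0; rewrite /V expR_ge0/= -expR0 ler_expR mulNr oppr_le0.
  by rewrite mulr_ge0.
have mgffin d (T : measurableType d) (m : {measure set T -> \bar R}) (Y : T -> R) n h :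
    measurable_fun setT Y -> (forall x, 0 <= Y x) -> (m setT < +oo)%E ->
    (mgf m (V _ _ Y n) h < +oo)%E.
  move=> mY Y0 fin.
  apply: (@le_lt_trans _ _ (\int[m]_x (expR `|h|)%:E)%E).
    apply: ge0_le_integral => //.
    - exact/measurable_mgf_fun/mV.
    - move=> x _; rewrite lee_fin ler_expR.
      have /andP[v0 v1] := V01 _ _ Y n x (Y0 x).
      apply: le_trans (ler_norm _) _; rewrite normrM -[leRHS]mulr1.
      by rewrite ler_wpM2l// ger0_norm.
  by rewrite integral_cst// lte_mul_pinfty// ?lee_fin ?expR_ge0.
have mgfeq n h : mgf m1 (V _ _ Y1 n) h = mgf m2 (V _ _ Y2 n) h.
  (* [mgf_series] excludes [h = 0]; there the claim is equality of the total masses, which is the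
     hypothesis at [k = 0]. *)
  have [->|h0] := eqVneq h 0.
    have := H 0%N; rewrite /mgf.
    under eq_integral do rewrite mulNr mul0r oppr0 expR0.
    under [in X in _ = X -> _]eq_integral do rewrite mulNr mul0r oppr0 expR0.
    under [in X in _ -> X = _]eq_integral do rewrite mul0r expR0.
    by under [in X in _ -> _ = X]eq_integral do rewrite mul0r expR0.
  have c1 := mgf_series (mV _ _ _ n mY1) h0 (mgffin _ _ m1 Y1 n _ mY1 Y10 fin1)
    (mgffin _ _ m1 Y1 n _ mY1 Y10 fin1).
  have c2 := mgf_series (mV _ _ _ n mY2) h0 (mgffin _ _ m2 Y2 n _ mY2 Y20 fin2)
    (mgffin _ _ m2 Y2 n _ mY2 Y20 fin2).
  rewrite -[LHS]fineK ?ge0_fin_numE ?mgf_ge0 ?mgffin//.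
  rewrite -[RHS]fineK ?ge0_fin_numE ?mgf_ge0 ?mgffin//.
  congr EFin.
  have mom k : \int[m1]_x (V _ _ Y1 n x ^+ k) = \int[m2]_x (V _ _ Y2 n x ^+ k).
    have Vk d (T : measurableType d) (Y : T -> R) x :
        V _ _ Y n x ^+ k = expR (- (n * k)%:R * Y x).
      by rewrite /V -expRM_natl; congr expR; rewrite natrM; ring.
    congr fine; under eq_integral do rewrite Vk.
    by under [RHS]eq_integral do rewrite Vk; exact: H.
  apply: cvg_unique c1 _ => //; move: c2.
  suff -> : (fun k => h ^+ k / k`!%:R * \int[m2]_x (V _ _ Y2 n x ^+ k)) =
    (fun k => h ^+ k / k`!%:R * \int[m1]_x (V _ _ Y1 n x ^+ k)) by [].
  by apply/funext => k; rewrite mom.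
have lim d (T : measurableType d) (m : {measure set T -> \bar R}) (Y : T -> R) c :
    measurable_fun setT Y -> (forall x, 0 <= Y x) -> (m setT < +oo)%E ->
    mgf m (V _ _ Y n) (- (n%:R * expR (n%:R * c))) @[n --> \oo] -->
    m (Y @^-1` `]c, +oo[%classic).
  move=> mY Y0 fin.
  have mA : measurable (Y @^-1` `]c, +oo[).
    by rewrite -[X in measurable X]setTI; exact: mY.
  pose a n : R := - (n%:R * expR (n%:R * c)).
  pose f_ n x := (expR (a n * V _ _ Y n x))%:E.
  have mf n : measurable_fun setT (f_ n) by exact/measurable_mgf_fun/mV.
  have cf : {ae m, forall x, setT x -> f_ ^~ x @ \oo -->
      (\1_(Y @^-1` `]c, +oo[) x)%:E}.
    apply: aeW => x _; apply: cvg_EFin; first exact: nearW.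
    have := @cvg_gumbel_indic c (Y x); rewrite !indicE.
    rewrite (_ : (x \in _) = (Y x \in [set x | c < x]))//.
    by apply/idP/idP => /set_mem Yc; apply/mem_set; move: Yc;
      rewrite /= in_itv/= andbT.
  have df : {ae m, forall x n, setT x -> (`|f_ n x| <= 1%:E)%E}.
    apply: aeW => x n _; rewrite lee_fin ger0_norm ?expR_ge0//.
    have /andP[v0 v1] := V01 _ _ Y n x (Y0 x).
    by rewrite -expR0 ler_expR mulr_le0_ge0// oppr_le0 mulr_ge0// expR_ge0.
  have i1 : m.-integrable setT (fun=> 1%:E).
    apply/integrableP; split => //.
    by under eq_integral do rewrite abse1; rewrite integral_cst// mul1e.
  have mi : measurable_fun setT (fun x => (\1_(Y @^-1` `]c, +oo[) x : R)%:E).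
    by apply/measurable_EFinP; exact: measurable_indic.
  have [_ _] := dominated_convergence measurableT mf mi cf i1 df.
  by rewrite integral_indic// setIT.
have ray c : m1 (Y1 @^-1` `]c, +oo[%classic) = m2 (Y2 @^-1` `]c, +oo[%classic).
  have l1 := lim _ _ m1 Y1 c mY1 Y10 fin1.
  have l2 := lim _ _ m2 Y2 c mY2 Y20 fin2.
  have E : (fun n => mgf m1 (V _ _ Y1 n) (- (n%:R * expR (n%:R * c)))) =
      (fun n => mgf m2 (V _ _ Y2 n) (- (n%:R * expR (n%:R * c)))).
    by apply/funext => n; exact: mgfeq.
  by rewrite E in l1; exact: (cvg_unique _ l1 l2).
move=> A mA.
pose G : set (set R) := [set A | exists x, A = `]x, +oo[%classic].
pose g (n : nat) : set R := `]-n%:R, +oo[%classic.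
have Gg n : G (g n) by exists (- n%:R).
have gT : \bigcup_n g n = setT.
  rewrite -subTset => x _; exists (Num.truncn `|x|).+1 => //.
  rewrite /g/= in_itv/= andbT ltrNl.
  apply: le_lt_trans (truncnS_gt _); rewrite -normrN; exact: ler_norm.
have GI : setI_closed G.
  move=> _ _ [x ->] [y ->]; exists (Num.max x y).
  by apply/seteqP; split => z /=; rewrite !in_itv/= !andbT gt_max => /andP.
have mG : measurable = <<s G >> by exact: RGenOInfty.measurableE.
apply: (@measure_unique _ R _ G g mG GI Gg gT (pushforward m1 Y1) (pushforward m2 Y2)) => //.
- by move=> _ [c ->]; exact: ray.
- move=> k; have /le_lt_trans : (m1 (Y1 @^-1` g k) <= m1 setT)%E; last exact.
  apply: le_measure; rewrite ?inE//.
  by rewrite -[X in measurable X]setTI; apply: mY1 => //; exact: measurable_itv.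
Qed.
End laplace_uniqueness.

(** * Sums over set partitions *)

Section partition_sum.
Context {R : comNzRingType} {T : finType}.
Implicit Types (w : {set T} -> R) (F : nat -> R) (S B : {set T}).

(** [btilde] is the case of weight [(k - 1)!] for [k] blocks. The weight is left arbitrary for the
    sake of the recursion, where removing a block shifts [F]. *)
Definition partition_sum w F S : R :=
  \sum_(P : {set {set T}} | finset.partition P S) F #|P| * \prod_(B in P) w B.

Lemma partition_sum0 w F : partition_sum w F finset.set0 = F 0%N.
Proof.
rewrite /partition_sum (big_pred1 finset.set0); last first.
  by move=> P /=; rewrite partition_set0.
by rewrite cards0 big_set0 mulr1.
Qed.

(* Splits off the block containing [x]. *)
Lemma partition_sum_rec w F S x : x \in S ->
  partition_sum w F S = \sum_(B : {set T} | (x \in B) && (B \subset S))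
    w B * partition_sum w (F \o succn) (S :\: B)%SET.
Proof.
move=> xS; rewrite /partition_sum.
rewrite (partition_big (fun P => finset.pblock P x)
  (fun B => (x \in B) && (B \subset S))) /=; last first.
  move=> P partP; have xc : x \in finset.cover P by rewrite (cover_partition partP).
  by rewrite mem_pblock xc/= (partitionS partP)// pblock_mem.
apply: eq_bigr => B /andP[xB BS]; rewrite mulr_sumr.
have xBn : B != finset.set0 by apply/finset.set0Pn; exists x.
have Bnot Q : finset.partition Q (S :\: B)%SET -> B \notin Q.
  move=> partQ; apply/negP => BQ; have /fintype.subsetP/(_ x xB) := partitionS partQ BQ.
  by rewrite !inE xB.
(* Partitions of [S] in which [B] is the block of [x] correspond to partitions of the rest of [S],
   by removing and adding [B]. *)
rewrite (reindex_onto (fun Q => B |: Q)%SET (fun P => P :\ B)%SET) /=; last first.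
  move=> P /andP[partP /eqP BP]; rewrite finset.setD1K// -BP pblock_mem//.
  by rewrite (cover_partition partP).
apply: eq_big => [Q|Q].
  apply/idP/idP.
    case/andP => /andP[partBQ /eqP pb] /eqP QE; have BBQ : B \in (B |: Q)%SET by rewrite !inE eqxx.
    by rewrite -{1}QE partitionD1.
  move=> partQ; have BQ := Bnot _ partQ.
  have partBQ : finset.partition (B |: Q)%SET S.
    have := partitionU1 partQ xBn; rewrite -finset.setI_eq0 finset.setIDA finset.setIC -finset.setIDA finset.setDv.
    rewrite finset.setI0 eqxx => /(_ isT); congr finset.partition.
    by rewrite -{1}(finset.setIidPr BS) finset.setID.
  rewrite partBQ /= finset.setU1K// eqxx andbT; apply/eqP/def_pblock => //.
    exact: partition_trivIset partBQ.
  by rewrite !inE eqxx.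
move=> /andP[/andP[partBQ _] /eqP QE].
have BQ : B \notin Q by rewrite -QE !inE eqxx.
by rewrite cardsU1 BQ/= big_setU1//= add1n; ring.
Qed.

End partition_sum.

(** * The subsets of a four-element set *)

Section four_elements.
Context {R : realType}.
Implicit Types p : {set 'I_4} -> R.

(** Each partition contributes for exactly one [k], its number of blocks. The empty set is
    different: the sum in [btilde] starts at 1, while the empty partition has 0 blocks. *)
Lemma btilde_partition_sum p S : S != finset.set0 ->
  btilde p S = partition_sum (ptilde p) (fun k => (k.-1)`!%:R) S.
Proof.
move=> S0; rewrite /btilde /partition_sum.
under eq_bigr do rewrite mulr_sumr big_mkcondr/=.
rewrite exchange_big/=; apply: eq_bigr => P partP.
have PS : (0 < #|P| <= #|S|)%N.
  apply/andP; split.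
    rewrite card_gt0; apply: contraNneq S0 => P0.
    by move: partP; rewrite P0 /finset.partition /finset.cover big_set0 eq_sym => /andP[].
  rewrite (card_partition partP) -sum1_card; apply: leq_sum => B BP.
  by rewrite card_gt0; exact: partition_neq0 partP BP.
rewrite (bigD1_seq #|P|) ?iota_uniq ?mem_index_iota ?ltnS//= eqxx [X in _ + X]big1 ?addr0//.
by move=> k kP; rewrite eq_sym (negbTE kP).
Qed.

(** Membership bits make inclusion, difference and complement compute, and turn a sum over subsets
    into four sums over booleans. *)
Definition set4 (b1 b2 b3 b4 : bool) : {set 'I_4} :=
  [set i : 'I_4 | nth false [:: b1; b2; b3; b4] i]%SET.

Lemma set4E (S : {set 'I_4}) : S = set4 (@Ordinal 4 0 isT \in S)
  (@Ordinal 4 1 isT \in S) (@Ordinal 4 2 isT \in S) (@Ordinal 4 3 isT \in S).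
Proof.
apply/finset.setP => -[[|[|[|[|//]]]] i4]; rewrite !inE/=; congr (_ \in S); exact: val_inj.
Qed.

Lemma sum_set4 (K : pred {set 'I_4}) (F : {set 'I_4} -> R) :
  \sum_(S | K S) F S = \sum_(b1 : bool) \sum_(b2 : bool) \sum_(b3 : bool)
    \sum_(b4 : bool) if K (set4 b1 b2 b3 b4) then F (set4 b1 b2 b3 b4) else 0.
Proof.
rewrite big_mkcond/= !pair_big/=.
rewrite (reindex (fun b : bool * bool * bool * bool =>
  set4 b.1.1.1 b.1.1.2 b.1.2 b.2))/=; first by [].
exists (fun S : {set 'I_4} => (@Ordinal 4 0 isT \in S, @Ordinal 4 1 isT \in S,
  @Ordinal 4 2 isT \in S, @Ordinal 4 3 isT \in S)) => [[[[b1 b2] b3] b4] _|S _].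
  by rewrite !inE.
by rewrite -set4E.
Qed.

Lemma in_set4 b1 b2 b3 b4 i : (i \in set4 b1 b2 b3 b4) = nth false [:: b1; b2; b3; b4] i.
Proof. by rewrite inE. Qed.

Lemma subset_set4 b1 b2 b3 b4 c1 c2 c3 c4 :
  (set4 b1 b2 b3 b4 \subset set4 c1 c2 c3 c4) =
  [&& b1 ==> c1, b2 ==> c2, b3 ==> c3 & b4 ==> c4].
Proof.
apply/fintype.subsetP/and4P => [H|[H1 H2 H3 H4]].
  by split; apply/implyP => b; [have := H (@Ordinal 4 0 isT)|
    have := H (@Ordinal 4 1 isT)|have := H (@Ordinal 4 2 isT)|
    have := H (@Ordinal 4 3 isT)]; rewrite !in_set4/= => /(_ b).
by move=> [[|[|[|[|//]]]] i4]; rewrite !in_set4/=; exact/implyP.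
Qed.

Lemma setD_set4 b1 b2 b3 b4 c1 c2 c3 c4 :
  (set4 b1 b2 b3 b4 :\: set4 c1 c2 c3 c4)%SET =
  set4 (~~ c1 && b1) (~~ c2 && b2) (~~ c3 && b3) (~~ c4 && b4).
Proof.
by apply/finset.setP => -[[|[|[|[|//]]]] i4]; rewrite !inE/=.
Qed.

Lemma idx4E s : idx4 s = set4 (1 \in s)%N (2 \in s)%N (3 \in s)%N (4 \in s)%N.
Proof.
by apply/finset.setP => -[[|[|[|[|//]]]] i4]; rewrite !inE/=.
Qed.

Lemma set4_0 : set4 false false false false = finset.set0.
Proof. by apply/finset.setP => -[[|[|[|[|//]]]] i4]; rewrite !inE/=. Qed.

Lemma set4_T : set4 true true true true = [set: 'I_4]%SET.
Proof. by apply/finset.setP => -[[|[|[|[|//]]]] i4]; rewrite !inE/=. Qed.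

Lemma ptilde_set4 p b1 b2 b3 b4 : ptilde p (set4 b1 b2 b3 b4) =
  - (p (set4 (~~ b1) (~~ b2) (~~ b3) (~~ b4)) / p (set4 true true true true)).
Proof.
rewrite /ptilde mulNr set4_T; congr (- (p _ / _)).
by apply/finset.setP => -[[|[|[|[|//]]]] i4]; rewrite !inE/=.
Qed.

End four_elements.

Section btilde_values.
Context {R : realType}.
Implicit Types (p w : {set 'I_4} -> R) (F : nat -> R).

(** This is [partition_sum_rec] at the least element; together with the three lemmas that follow,
    four rounds of rewriting evaluate every [btilde]. *)
Lemma partition_sum_set4_1 w F b2 b3 b4 :
  partition_sum w F (set4 true b2 b3 b4) =
  \sum_(c2 : bool) \sum_(c3 : bool) \sum_(c4 : bool)
    if [&& c2 ==> b2, c3 ==> b3 & c4 ==> b4] then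
      w (set4 true c2 c3 c4) *
      partition_sum w (F \o succn) (set4 false (~~ c2 && b2) (~~ c3 && b3) (~~ c4 && b4))
    else 0.
Proof.
rewrite (@partition_sum_rec _ _ _ _ _ (@Ordinal 4 0 isT)) ?in_set4//.
rewrite sum_set4 big_bool/= [X in _ + X]big1 => [|c2 _]; last first.
  by rewrite big1// => c3 _; rewrite big1// => c4 _; rewrite in_set4.
rewrite addr0; do 3 (apply: eq_bigr => ? _).
by rewrite in_set4/= subset_set4/= setD_set4.
Qed.

Lemma partition_sum_set4_2 w F b3 b4 :
  partition_sum w F (set4 false true b3 b4) =
  \sum_(c3 : bool) \sum_(c4 : bool)
    if (c3 ==> b3) && (c4 ==> b4) then
      w (set4 false true c3 c4) *
      partition_sum w (F \o succn) (set4 false false (~~ c3 && b3) (~~ c4 && b4))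
    else 0.
Proof.
rewrite (@partition_sum_rec _ _ _ _ _ (@Ordinal 4 1 isT)) ?in_set4//.
rewrite sum_set4 big_bool/= [X in X + _]big1 => [|c2 _]; last first.
  by rewrite big1// => c3 _; rewrite big1// => c4 _; rewrite subset_set4 andbF.
rewrite add0r big_bool/= [X in _ + X]big1 => [|c3 _]; last first.
  by rewrite big1// => c4 _; rewrite in_set4.
rewrite addr0; do 2 (apply: eq_bigr => ? _).
by rewrite in_set4/= subset_set4/= setD_set4.
Qed.

Lemma partition_sum_set4_3 w F b4 :
  partition_sum w F (set4 false false true b4) =
  \sum_(c4 : bool) if c4 ==> b4 then w (set4 false false true c4) *
    partition_sum w (F \o succn) (set4 false false false (~~ c4 && b4)) else 0.
Proof.
rewrite (@partition_sum_rec _ _ _ _ _ (@Ordinal 4 2 isT)) ?in_set4//.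
rewrite sum_set4 big_bool/= [X in X + _]big1 => [|c2 _]; last first.
  by rewrite big1// => c3 _; rewrite big1// => c4 _; rewrite subset_set4 andbF.
rewrite add0r big_bool/= [X in X + _]big1 => [|c3 _]; last first.
  by rewrite big1// => c4 _; rewrite subset_set4 andbF.
rewrite add0r big_bool/= [X in _ + X]big1 => [|c4 _]; last by rewrite in_set4.
rewrite addr0; apply: eq_bigr => ? _.
by rewrite in_set4/= subset_set4/= setD_set4.
Qed.

Lemma partition_sum_set4_4 w F :
  partition_sum w F (set4 false false false true) = w (set4 false false false true) * F 1%N.
Proof.
rewrite (@partition_sum_rec _ _ _ _ _ (@Ordinal 4 3 isT)) ?in_set4//.
rewrite sum_set4 !big_bool/= !in_set4/= !subset_set4/= !setD_set4/=.
by rewrite set4_0 partition_sum0 !addr0 !add0r.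
Qed.

Definition partition_sum_set4E := (partition_sum_set4_1, partition_sum_set4_2,
  partition_sum_set4_3, partition_sum_set4_4).

Local Notation a p b1 b2 b3 b4 := (- ptilde p (set4 b1 b2 b3 b4)).
Local Notation t := true.
Local Notation f := false.

Lemma set4_neq0 b1 b2 b3 b4 : [|| b1, b2, b3 | b4] -> set4 b1 b2 b3 b4 != finset.set0.
Proof.
move=> b; rewrite -set4_0; apply: contraTneq b => /finset.setP E.
have := E (@Ordinal 4 0 isT); have := E (@Ordinal 4 1 isT).
have := E (@Ordinal 4 2 isT); have := E (@Ordinal 4 3 isT).
by rewrite !in_set4/= => -> -> -> ->.
Qed.

Local Ltac btilde_tac := rewrite btilde_partition_sum ?set4_neq0//;
  do 4 rewrite ?partition_sum_set4E ?big_bool/=;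
  rewrite ?set4_0 ?partition_sum0 /= ?factE /=; ring.

(** In these closed forms a partition into [k] blocks has the coefficient [(- 1) ^ k * (k - 1)!],
    because they are written in the [a_T], the negatives of the [ptilde]. *)
Lemma btilde12 p : btilde p (set4 t t f f) =
  a p t f f f * a p f t f f - a p t t f f.
Proof. by btilde_tac. Qed.

Lemma btilde13 p : btilde p (set4 t f t f) =
  a p t f f f * a p f f t f - a p t f t f.
Proof. by btilde_tac. Qed.

Lemma btilde14 p : btilde p (set4 t f f t) =
  a p t f f f * a p f f f t - a p t f f t.
Proof. by btilde_tac. Qed.

Lemma btilde23 p : btilde p (set4 f t t f) =
  a p f t f f * a p f f t f - a p f t t f.
Proof. by btilde_tac. Qed.

Lemma btilde24 p : btilde p (set4 f t f t) =
  a p f t f f * a p f f f t - a p f t f t.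
Proof. by btilde_tac. Qed.

Lemma btilde34 p : btilde p (set4 f f t t) =
  a p f f t f * a p f f f t - a p f f t t.
Proof. by btilde_tac. Qed.

Lemma btilde123 p : btilde p (set4 t t t f) =
  a p t f f f * a p f t t f + a p f t f f * a p t f t f + a p f f t f * a p t t f f - a p t t t f
  - 2 * (a p t f f f * a p f t f f * a p f f t f).
Proof. by btilde_tac. Qed.

Lemma btilde124 p : btilde p (set4 t t f t) =
  a p t f f f * a p f t f t + a p f t f f * a p t f f t + a p f f f t * a p t t f f - a p t t f t
  - 2 * (a p t f f f * a p f t f f * a p f f f t).
Proof. by btilde_tac. Qed.

Lemma btilde134 p : btilde p (set4 t f t t) =
  a p t f f f * a p f f t t + a p f f t f * a p t f f t + a p f f f t * a p t f t f - a p t f t t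
  - 2 * (a p t f f f * a p f f t f * a p f f f t).
Proof. by btilde_tac. Qed.

Lemma btilde234 p : btilde p (set4 f t t t) =
  a p f t f f * a p f f t t + a p f f t f * a p f t f t + a p f f f t * a p f t t f - a p f t t t
  - 2 * (a p f t f f * a p f f t f * a p f f f t).
Proof. by btilde_tac. Qed.

Lemma btilde1234 p : btilde p (set4 t t t t) =
  - a p t t t t + a p t f f f * a p f t t t + a p f t f f * a p t f t t
  + a p f f t f * a p t t f t + a p f f f t * a p t t t f
  + a p t t f f * a p f f t t + a p t f t f * a p f t f t + a p t f f t * a p f t t f
  - 2 * (a p t f f f * a p f t f f * a p f f t t + a p t f f f * a p f f t f * a p f t f t
   + a p t f f f * a p f f f t * a p f t t f + a p f t f f * a p f f t f * a p t f f t
   + a p f t f f * a p f f f t * a p t f t f + a p f f t f * a p f f f t * a p t t f f)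
  + 6 * (a p t f f f * a p f t f f * a p f f t f * a p f f f t).
Proof. by btilde_tac. Qed.

End btilde_values.

(** * The factorization of the polynomial *)

Section partial_fractions.
Context {R : fieldType}.
Implicit Types x y z b c e : R.

(* [pf_coef2] and [pf_coef3] give the coefficients of b12 and b123 in the sum of
   [sum_mixture]; the others follow by permuting the variables. *)
Lemma pf_coef2 x y z b c e g : x != 0 -> y != 0 -> z != 0 ->
  x * y - b != 0 -> x * z - c != 0 ->
  x * y * z - b * z - c * y - e * x - g != 0 ->
  let D := x * y * z - b * z - c * y - e * x - g in
  let u := x^-1 in let v := y^-1 in let w := z^-1 in
  let ub := (x * y - b)^-1 in let uc := (x * z - c)^-1 in let q := D^-1 in
  u + b * u * ub + c * u * uc + g * u * q + 2 * b * c * u ^+ 2 * q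
  + b * e * u * v * q + c * e * u * w * q + b * g * u * ub * q + c * g * u * uc * q
  + b ^+ 2 * c * u ^+ 2 * ub * q + b * c ^+ 2 * u ^+ 2 * uc * q
  + b ^+ 2 * e * u * v * ub * q + c ^+ 2 * e * u * w * uc * q
  = (y * z - e) * q.
Proof.
move=> x0 y0 z0 xyb xzc D0 /=; field.
by rewrite x0 y0 z0 xyb xzc D0.
Qed.

Lemma pf_coef3 x y z b c e g : x != 0 -> y != 0 ->
  x * y - b != 0 -> x * y * z - b * z - c * y - e * x - g != 0 ->
  let D := x * y * z - b * z - c * y - e * x - g in
  let u := x^-1 in let v := y^-1 in let ub := (x * y - b)^-1 in let q := D^-1 in
  ub + c * u * q + e * v * q + g * ub * q + b * c * u * ub * q + b * e * v * ub * q
  = z * q.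
Proof.
move=> x0 y0 xyb D0 /=; field.
by rewrite x0 y0 xyb D0.
Qed.

End partial_fractions.

(** * The forty exponent vectors and numerators *)

Section mixture_monomials.

(* Row [k] lists the coefficients of [z_(k+1)], that is the exponents of the
   inverses of S2, S3, S4, S23, S24, S34, S234 attached to alpha_1, ..., alpha_40. *)
Definition mixture_exponents : seq (seq nat) := [::
  [:: 1; 0; 0; 0; 0; 0; 1; 1; 0; 0; 0; 0; 0; 1; 0; 0; 2; 0; 0; 1; 1; 0; 0; 0;
      0; 1; 1; 0; 0; 0; 0; 2; 2; 0; 0; 0; 0; 1; 1; 0];
  [:: 0; 1; 0; 0; 0; 0; 0; 0; 1; 1; 0; 0; 0; 0; 1; 0; 0; 2; 0; 1; 0; 1; 0; 0;
      0; 0; 0; 1; 1; 0; 0; 0; 0; 2; 2; 0; 0; 1; 0; 1];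
  [:: 0; 0; 1; 0; 0; 0; 0; 0; 0; 0; 1; 1; 0; 0; 0; 1; 0; 0; 2; 0; 1; 1; 0; 0;
      0; 0; 0; 0; 0; 1; 1; 0; 0; 0; 0; 2; 2; 0; 1; 1];
  [:: 0; 0; 0; 1; 0; 0; 1; 0; 1; 0; 0; 0; 0; 0; 0; 0; 0; 0; 0; 0; 0; 0; 1; 0;
      0; 1; 0; 1; 0; 0; 0; 1; 0; 1; 0; 0; 0; 1; 0; 0];
  [:: 0; 0; 0; 0; 1; 0; 0; 1; 0; 0; 1; 0; 0; 0; 0; 0; 0; 0; 0; 0; 0; 0; 0; 1;
      0; 0; 1; 0; 0; 1; 0; 0; 1; 0; 0; 1; 0; 0; 1; 0];
  [:: 0; 0; 0; 0; 0; 1; 0; 0; 0; 1; 0; 1; 0; 0; 0; 0; 0; 0; 0; 0; 0; 0; 0; 0;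
      1; 0; 0; 0; 1; 0; 1; 0; 0; 0; 1; 0; 1; 0; 0; 1];
  [:: 0; 0; 0; 0; 0; 0; 0; 0; 0; 0; 0; 0; 1; 1; 1; 1; 1; 1; 1; 1; 1; 1; 1; 1;
      1; 1; 1; 1; 1; 1; 1; 1; 1; 1; 1; 1; 1; 1; 1; 1]]%N.

Definition mixture_exponent (k i : nat) : nat :=
  nth 0 (nth [::] mixture_exponents k) i.

Lemma sum_iota40 (V : nmodType) (F : nat -> V) :
  (\sum_(i < 40) F i = \sum_(i <- iota 0 40) F i)%R.
Proof. by rewrite -(big_mkord xpredT) /index_iota subn0. Qed.

Lemma zE (v : 40.-tuple nat) :
  [/\ z1 v = \sum_(i < 40) mixture_exponent 0 i * tnth v i,
      z2 v = \sum_(i < 40) mixture_exponent 1 i * tnth v i,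
      z3 v = \sum_(i < 40) mixture_exponent 2 i * tnth v i &
   [/\ z4 v = \sum_(i < 40) mixture_exponent 3 i * tnth v i,
      z5 v = \sum_(i < 40) mixture_exponent 4 i * tnth v i,
      z6 v = \sum_(i < 40) mixture_exponent 5 i * tnth v i &
      z7 v = \sum_(i < 40) mixture_exponent 6 i * tnth v i]]%N.
Proof.
have E k : (\sum_(i < 40) mixture_exponent k i * tnth v i =
    \sum_(i <- iota 0 40) mixture_exponent k i * nth 0 v i)%N.
  rewrite -(sum_iota40 (fun i => mixture_exponent k i * nth 0 v i)%N).
  by apply: eq_bigr => i _; rewrite (tnth_nth 0%N).
rewrite !E /z1 /z2 /z3 /z4 /z5 /z6 /z7 /index_iota /= !big_cons !big_nil.
rewrite /mixture_exponent /= !mul0n !mul1n !add0n !addn0.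
by split; [| | |split]; rewrite ?addnA.
Qed.

Context {R : fieldType}.

(** One monomial serves twice: at the inverses of the [S] it is the ratio [m_i], at the [a_T] it is
    the denominator of [alpha_i]. Hence [alpha_i * m_i] is a numerator times the monomial at the
    inverses of the products [a_T * S_T], which are polynomials in the shifted variables. *)
Definition mixture_monomial (u2 u3 u4 u23 u24 u34 u234 : R) (i : nat) : R :=
  u2 ^+ mixture_exponent 0 i * u3 ^+ mixture_exponent 1 i
  * u4 ^+ mixture_exponent 2 i * u23 ^+ mixture_exponent 3 i
  * u24 ^+ mixture_exponent 4 i * u34 ^+ mixture_exponent 5 i
  * u234 ^+ mixture_exponent 6 i.

Lemma prod_mixture_monomial u2 u3 u4 u23 u24 u34 u234 (v : 40.-tuple nat) :
  \prod_(i < 40) mixture_monomial u2 u3 u4 u23 u24 u34 u234 i ^+ tnth v i =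
  u2 ^+ z1 v * u3 ^+ z2 v * u4 ^+ z3 v * u23 ^+ z4 v * u24 ^+ z5 v
  * u34 ^+ z6 v * u234 ^+ z7 v.
Proof.
have [-> -> -> [-> -> -> ->]] := zE v; rewrite !expr_sum -!big_split /=.
by apply: eq_bigr => i _; rewrite /mixture_monomial !exprMn -!exprM.
Qed.

Definition mixture_numerators (b12 b13 b14 b23 b24 b34 b123 b124 b134 b234 b1234 : R) :
  seq R := [::
  b12;
  b13;
  b14;
  b123;
  b124;
  b134;
  b12 * b23;
  b12 * b24;
  b13 * b23;
  b13 * b34;
  b14 * b24;
  b14 * b34;
  b1234;
  b12 * b234 + b23 * b124 + b24 * b123;
  b13 * b234 + b23 * b134 + b34 * b123;
  b14 * b234 + b24 * b134 + b34 * b124;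
  2 * b12 * b23 * b24;
  2 * b13 * b23 * b34;
  2 * b14 * b24 * b34;
  b23 * (b12 * b34 + b13 * b24);
  b24 * (b12 * b34 + b14 * b23);
  b34 * (b13 * b24 + b14 * b23);
  b123 * b234;
  b124 * b234;
  b134 * b234;
  b23 * (b12 * b234 + b24 * b123);
  b24 * (b12 * b234 + b23 * b124);
  b23 * (b13 * b234 + b34 * b123);
  b34 * (b13 * b234 + b23 * b134);
  b24 * (b14 * b234 + b34 * b124);
  b34 * (b14 * b234 + b24 * b134);
  b12 * b23 ^+ 2 * b24;
  b12 * b23 * b24 ^+ 2;
  b13 * b23 ^+ 2 * b34;
  b13 * b23 * b34 ^+ 2;
  b14 * b34 * b24 ^+ 2;
  b14 * b24 * b34 ^+ 2;
  b23 ^+ 2 * (b12 * b34 + b13 * b24);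
  b24 ^+ 2 * (b12 * b34 + b14 * b23);
  b34 ^+ 2 * (b13 * b24 + b14 * b23)].

(** Both sides are linear in the [b_T] with 1 in [T]. The coefficients of [b12], [b13], [b14] are
    instances of [pf_coef2], those of [b123], [b124], [b134] are instances of [pf_coef3], and
    [b1234] occurs once, over [D]. *)
Lemma sum_mixture (b12 b13 b14 b23 b24 b34 b123 b124 b134 b234 b1234 x2 x3 x4 : R) :
  let D := x2 * x3 * x4 - b23 * x4 - b24 * x3 - b34 * x2 - b234 in
  x2 != 0 -> x3 != 0 -> x4 != 0 -> x2 * x3 - b23 != 0 -> x2 * x4 - b24 != 0 ->
  x3 * x4 - b34 != 0 -> D != 0 ->
  \sum_(i < 40)
    (mixture_numerators b12 b13 b14 b23 b24 b34 b123 b124 b134 b234 b1234)`_i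
    * mixture_monomial x2^-1 x3^-1 x4^-1 (x2 * x3 - b23)^-1 (x2 * x4 - b24)^-1
        (x3 * x4 - b34)^-1 D^-1 i =
  (b12 * (x3 * x4 - b34) + b13 * (x2 * x4 - b24) + b14 * (x2 * x3 - b23)
   + b123 * x4 + b124 * x3 + b134 * x2 + b1234) / D.
Proof.
move=> D x20 x30 x40 D23 D24 D34 D0.
have D32 : x3 * x2 - b23 != 0 by rewrite mulrC.
have D42 : x4 * x2 - b24 != 0 by rewrite mulrC.
have D43 : x4 * x3 - b34 != 0 by rewrite mulrC.
have E3 : x3 * x2 * x4 - b23 * x4 - b34 * x2 - b24 * x3 - b234 = D by rewrite /D; ring.
have E4 : x4 * x2 * x3 - b24 * x3 - b34 * x2 - b23 * x4 - b234 = D by rewrite /D; ring.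
have F24 : x2 * x4 * x3 - b24 * x3 - b23 * x4 - b34 * x2 - b234 = D by rewrite /D; ring.
have F34 : x3 * x4 * x2 - b34 * x2 - b23 * x4 - b24 * x3 - b234 = D by rewrite /D; ring.
have h12 := pf_coef2 x20 x30 x40 D23 D24 D0.
have := @pf_coef2 _ x3 x2 x4 b23 b34 b24 b234 x30 x20 x40 D32 D34.
rewrite E3 (mulrC x3 x2) => /(_ D0) h13.
have := @pf_coef2 _ x4 x2 x3 b24 b34 b23 b234 x40 x20 x30 D42 D43.
rewrite E4 (mulrC x4 x2) (mulrC x4 x3) => /(_ D0) h14.
have h123 := pf_coef3 x20 x30 D23 D0.
have := @pf_coef3 _ x2 x4 x3 b24 b23 b34 b234 x20 x40 D24; rewrite F24 => /(_ D0) h124.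
have := @pf_coef3 _ x3 x4 x2 b34 b23 b24 b234 x30 x40 D34; rewrite F34 => /(_ D0) h134.
cbv zeta in h12, h13, h14, h123, h124, h134.
rewrite -/D in h12 h123.
rewrite !mulrDl -!mulrA -h12 -h13 -h14 -h123 -h124 -h134.
rewrite (sum_iota40 (fun i => (mixture_numerators _ _ _ _ _ _ _ _ _ _ _)`_i
  * mixture_monomial _ _ _ _ _ _ _ i)).
rewrite /= !big_cons big_nil /mixture_monomial /mixture_exponent /=.
(* Once the partial fractions are substituted, the two sides agree as polynomials in the seven
   inverses, which can become independent variables. *)
move: (x2^-1) (x3^-1) (x4^-1) ((x2 * x3 - b23)^-1) ((x2 * x4 - b24)^-1)
  ((x3 * x4 - b34)^-1) (D^-1) => u2 u3 u4 u23 u24 u34 q.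
by ring.
Qed.

End mixture_monomials.

Section mixture_identity.
Context {R : realType} (p : {set 'I_4} -> R).
Hypothesis p0 : p finset.set0 = 1.
Hypothesis p_gt0 : forall T : {set 'I_4}, T != finset.set0 -> 0 < p T.
Hypothesis b_gt0 : forall T : {set 'I_4}, (1 < #|T|)%N -> 0 < btilde p T.

Local Notation t := true.
Local Notation f := false.
Local Notation N := (p (set4 t t t t)).
Local Notation A b1 b2 b3 b4 := (- ptilde p (set4 b1 b2 b3 b4)).
Local Notation B b1 b2 b3 b4 := (btilde p (set4 b1 b2 b3 b4)).

Lemma p_set4_gt0 b1 b2 b3 b4 : 0 < p (set4 b1 b2 b3 b4).
Proof.
case: (boolP [|| b1, b2, b3 | b4]) => [b|]; first by rewrite p_gt0// set4_neq0.
by rewrite !negb_or => /and4P[/negbTE-> /negbTE-> /negbTE-> /negbTE->]; rewrite set4_0 p0.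
Qed.

Lemma a_gt0 b1 b2 b3 b4 : 0 < A b1 b2 b3 b4.
Proof. by rewrite ptilde_set4 opprK divr_gt0// p_set4_gt0. Qed.

Lemma card_set4 b1 b2 b3 b4 : #|set4 b1 b2 b3 b4| = (b1 + b2 + b3 + b4)%N.
Proof.
rewrite -sum1_card big_mkcond !big_ord_recl big_ord0 !in_set4/= addn0 !addnA.
by case: b1 b2 b3 b4 => [] [] [] [].
Qed.

Lemma b_set4_gt0 (b1 b2 b3 b4 : bool) : (1 < b1 + b2 + b3 + b4)%N -> 0 < B b1 b2 b3 b4.
Proof. by move=> b; rewrite b_gt0// card_set4. Qed.

(** Lets every polynomial below be expressed in the [a_T] and the single scale [N]. *)
Lemma p_set4E b1 b2 b3 b4 :
  p (set4 b1 b2 b3 b4) = A (~~ b1) (~~ b2) (~~ b3) (~~ b4) * N.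
Proof.
by rewrite ptilde_set4 opprK !negbK divfK// gt_eqF// p_set4_gt0.
Qed.

Lemma affine4E (th : 'rV[R]_4) (t1 t2 t3 t4 : R) :
  th 0 (@Ordinal 4 0 isT) = t1 -> th 0 (@Ordinal 4 1 isT) = t2 ->
  th 0 (@Ordinal 4 2 isT) = t3 -> th 0 (@Ordinal 4 3 isT) = t4 ->
  affine4 p th =
  1 + p (set4 t f f f) * t1 + p (set4 f t f f) * t2 + p (set4 f f t f) * t3
  + p (set4 f f f t) * t4 + p (set4 t t f f) * (t1 * t2) + p (set4 t f t f) * (t1 * t3)
  + p (set4 t f f t) * (t1 * t4) + p (set4 f t t f) * (t2 * t3)
  + p (set4 f t f t) * (t2 * t4) + p (set4 f f t t) * (t3 * t4)
  + p (set4 t t t f) * (t1 * t2 * t3) + p (set4 t t f t) * (t1 * t2 * t4)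
  + p (set4 t f t t) * (t1 * t3 * t4) + p (set4 f t t t) * (t2 * t3 * t4)
  + p (set4 t t t t) * (t1 * t2 * t3 * t4).
Proof.
move=> e1 e2 e3 e4; rewrite /affine4 sum_set4 !big_bool/=.
have E b1 b2 b3 b4 : \prod_(i in set4 b1 b2 b3 b4) th 0 i =
    (if b1 then t1 else 1) * (if b2 then t2 else 1) * (if b3 then t3 else 1)
    * (if b4 then t4 else 1).
  rewrite big_mkcond/= !big_ord_recl big_ord0 !in_set4/=.
  rewrite -e1 -e2 -e3 -e4 mulr1 !mulrA.
  by do !congr (_ * _); [case: b1|case: b2|case: b3|case: b4] => //; congr (th 0 _); exact: val_inj.
rewrite !E set4_0 p0; ring.
Qed.

Lemma SE (t2 t3 t4 : R) :
  [/\ S2 p t2 = (t2 + A f t f f) / A f t f f,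
      S3 p t3 = (t3 + A f f t f) / A f f t f,
      S4 p t4 = (t4 + A f f f t) / A f f f t &
  [/\ S23 p t2 t3 = ((t2 + A f t f f) * (t3 + A f f t f) - B f t t f) / A f t t f,
      S24 p t2 t4 = ((t2 + A f t f f) * (t4 + A f f f t) - B f t f t) / A f t f t,
      S34 p t3 t4 = ((t3 + A f f t f) * (t4 + A f f f t) - B f f t t) / A f f t t &
      S234 p t2 t3 t4 =
        ((t2 + A f t f f) * (t3 + A f f t f) * (t4 + A f f f t)
         - B f t t f * (t4 + A f f f t) - B f t f t * (t3 + A f f t f)
         - B f f t t * (t2 + A f t f f) - B f t t t) / A f t t t]].
Proof.
rewrite /S2 /S3 /S4 /S23 /S24 /S34 /S234 !idx4E /=.
rewrite btilde23 btilde24 btilde34 btilde234.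
rewrite !(p_set4E t f, p_set4E t t f, p_set4E t t t f) /=.
have N0 : N != 0 by rewrite gt_eqF// p_set4_gt0.
have A0 b1 b2 b3 b4 : A b1 b2 b3 b4 != 0 by rewrite gt_eqF// a_gt0.
move: (A0 f t f f) (A0 f f t f) (A0 f f f t) (A0 f t t f) (A0 f t f t) (A0 f f t t) (A0 f t t t).
move: (A f t f f) (A f f t f) (A f f f t) (A f t t f) (A f t f t) (A f f t t) (A f t t t).
move=> a2 a3 a4 a23 a24 a34 a234 n2 n3 n4 n23 n24 n34 n234.
by split; [| | |split]; field; rewrite ?n2 ?n3 ?n4 ?n23 ?n24 ?n34 ?n234 ?N0.
Qed.

Lemma alphaE (i : 'I_40) : tnth (alpha p) i =
  (mixture_numerators (B t t f f) (B t f t f) (B t f f t) (B f t t f) (B f t f t)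
    (B f f t t) (B t t t f) (B t t f t) (B t f t t) (B f t t t) (B t t t t))`_i
  / mixture_monomial (A f t f f) (A f f t f) (A f f f t) (A f t t f) (A f t f t)
      (A f f t t) (A f t t t) i.
Proof.
rewrite (tnth_nth 0) /= !idx4E /= /mixture_monomial /mixture_exponent.
case: i => i i40 /=; do 40 (case: i i40 => [|i] i40;
  first by rewrite /= ?expr0 ?expr1 ?mulr1 ?mul1r).
by [].
Qed.

End mixture_identity.

Section mixture_ratios.
Context {R : realType} (p : {set 'I_4} -> R).
Hypothesis p0 : p finset.set0 = 1.
Hypothesis p_gt0 : forall T : {set 'I_4}, T != finset.set0 -> 0 < p T.
Hypothesis b_gt0 : forall T : {set 'I_4}, (1 < #|T|)%N -> 0 < btilde p T.

Local Notation t := true.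
Local Notation f := false.
Local Notation N := (p (set4 t t t t)).
Local Notation A b1 b2 b3 b4 := (- ptilde p (set4 b1 b2 b3 b4)).
Local Notation B b1 b2 b3 b4 := (btilde p (set4 b1 b2 b3 b4)).

Lemma alpha_gt0 i : 0 < tnth (alpha p) i.
Proof.
have A0 := a_gt0 p0 p_gt0; have B0 := b_set4_gt0 b_gt0.
rewrite (alphaE p i) divr_gt0//; last first.
  by rewrite /mixture_monomial !mulr_gt0 ?exprn_gt0.
set s := mixture_numerators _ _ _ _ _ _ _ _ _ _ _.
have /allP : all (fun x => 0 < x) s.
  by rewrite /s /= !(mulr_gt0, addr_gt0, exprn_gt0) ?B0.
by apply; apply: mem_nth.
Qed.

Lemma S_ge1 (t2 t3 t4 : R) : 0 <= t2 -> 0 <= t3 -> 0 <= t4 ->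
  [/\ 1 <= S2 p t2, 1 <= S3 p t3, 1 <= S4 p t4 &
  [/\ 1 <= S23 p t2 t3, 1 <= S24 p t2 t4, 1 <= S34 p t3 t4 &
      1 <= S234 p t2 t3 t4]].
Proof.
move=> h2 h3 h4; have P0 := p_set4_gt0 p0 p_gt0; have A0 := a_gt0 p0 p_gt0.
have AV b1 b2 b3 b4 : 0 <= (A b1 b2 b3 b4)^-1 by rewrite invr_ge0 ltW.
have PP b1 b2 b3 b4 c1 c2 c3 c4 : 0 <= p (set4 b1 b2 b3 b4) / p (set4 c1 c2 c3 c4).
  by rewrite divr_ge0// ltW.
rewrite /S2 /S3 /S4 /S23 /S24 /S34 /S234 !idx4E /=.
by split; [| | |split]; rewrite -?addrA lerDl;
  do ?[exact: PP|exact: AV|assumption|apply: addr_ge0|apply: mulr_ge0].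
Qed.

Definition mixture_ratio (t2 t3 t4 : R) : nat -> R :=
  mixture_monomial (S2 p t2)^-1 (S3 p t3)^-1 (S4 p t4)^-1 (S23 p t2 t3)^-1
    (S24 p t2 t4)^-1 (S34 p t3 t4)^-1 (S234 p t2 t3 t4)^-1.

Lemma mixture_ratio_gt0_le1 t2 t3 t4 i : 0 <= t2 -> 0 <= t3 -> 0 <= t4 ->
  0 < mixture_ratio t2 t3 t4 i <= 1.
Proof.
move=> h2 h3 h4; have [s2 s3 s4 [s23 s24 s34 s234]] := S_ge1 h2 h3 h4.
have V (x : R) : 1 <= x -> 0 < x^-1 <= 1.
  by move=> x1; rewrite invr_gt0 invf_le1 (lt_le_trans ltr01 x1)// x1.
have X (x : R) n : 0 < x <= 1 -> 0 < x ^+ n <= 1.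
  by move=> /andP[x0 x1]; rewrite exprn_gt0// exprn_ile1// ltW.
have M (x y : R) : 0 < x <= 1 -> 0 < y <= 1 -> 0 < x * y <= 1.
  by move=> /andP[x0 x1] /andP[y0 y1]; rewrite mulr_gt0//= (mulr_ile1 (ltW x0) (ltW y0)).
by rewrite /mixture_ratio /mixture_monomial; do 6 (apply: (M _ _); last by apply: (X _ _); apply: (V _)); apply: (X _ _); apply: (V _).
Qed.

Lemma sum_alpha_ratio t2 t3 t4 : 0 <= t2 -> 0 <= t3 -> 0 <= t4 ->
  let x2 := t2 + A f t f f in let x3 := t3 + A f f t f in let x4 := t4 + A f f f t in
  \sum_(i < 40) tnth (alpha p) i * mixture_ratio t2 t3 t4 i =
  (B t t f f * (x3 * x4 - B f f t t) + B t f t f * (x2 * x4 - B f t f t)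
   + B t f f t * (x2 * x3 - B f t t f) + B t t t f * x4 + B t t f t * x3
   + B t f t t * x2 + B t t t t) / (A f t t t * S234 p t2 t3 t4).
Proof.
move=> h2 h3 h4 x2 x3 x4; have [s2 s3 s4 [s23 s24 s34 s234]] := S_ge1 h2 h3 h4.
have A0 b1 b2 b3 b4 : A b1 b2 b3 b4 != 0 by rewrite gt_eqF// a_gt0.
have [E2 E3 E4 [E23 E24 E34 E234]] := SE p0 p_gt0 t2 t3 t4.
have nz (s : R) : 1 <= s -> s != 0 by move=> s1; rewrite gt_eqF// (lt_le_trans ltr01).
have F (s a e : R) : a != 0 -> s = e / a -> e = a * s.
  by move=> a0 ->; rewrite mulrC divfK.
have F2 := F _ _ _ (A0 _ _ _ _) E2; have F3 := F _ _ _ (A0 _ _ _ _) E3.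
have F4 := F _ _ _ (A0 _ _ _ _) E4; have F23 := F _ _ _ (A0 _ _ _ _) E23.
have F24 := F _ _ _ (A0 _ _ _ _) E24; have F34 := F _ _ _ (A0 _ _ _ _) E34.
have F234 := F _ _ _ (A0 _ _ _ _) E234.
rewrite -/x2 in F2 F23 F24 F234; rewrite -/x3 in F3 F23 F34 F234.
rewrite -/x4 in F4 F24 F34 F234.
have := @sum_mixture _ (B t t f f) (B t f t f) (B t f f t) (B f t t f) (B f t f t)
  (B f f t t) (B t t t f) (B t t f t) (B t f t t) (B f t t t) (B t t t t) x2 x3 x4.
cbv zeta => H.
rewrite -F234 -H; last 7 first.
- by rewrite F2 mulf_neq0// nz.
- by rewrite F3 mulf_neq0// nz.
- by rewrite F4 mulf_neq0// nz.
- by rewrite F23 mulf_neq0// nz.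
- by rewrite F24 mulf_neq0// nz.
- by rewrite F34 mulf_neq0// nz.
- by rewrite F234 mulf_neq0// nz.
apply: eq_bigr => i _; rewrite (alphaE p i) -[LHS]mulrA; congr (_ * _).
rewrite F23 F24 F34 F234 F2 F3 F4 mulrC /mixture_ratio /mixture_monomial.
by rewrite !invfM !exprMn !exprVn; ring.
Qed.

Lemma affine4_mixture (th : 'rV[R]_4) t1 t2 t3 t4 :
  th 0 (@Ordinal 4 0 isT) = t1 -> th 0 (@Ordinal 4 1 isT) = t2 ->
  th 0 (@Ordinal 4 2 isT) = t3 -> th 0 (@Ordinal 4 3 isT) = t4 ->
  0 <= t2 -> 0 <= t3 -> 0 <= t4 ->
  affine4 p th = S234 p t2 t3 t4 * (1 + p (idx4 [:: 1]) *
    (t1 + \sum_(i < 40) tnth (alpha p) i * (1 - mixture_ratio t2 t3 t4 i))).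
Proof.
move=> e1 e2 e3 e4 h2 h3 h4; rewrite (affine4E p0 e1 e2 e3 e4).
under eq_bigr do rewrite mulrBr mulr1.
rewrite sumrB sum_alpha_ratio//.
(* At the origin every ratio is 1, so the plain sum of the [alpha_i] is the closed form of
   [sum_alpha_ratio] taken at 0. *)
have R0 i : mixture_ratio 0 0 0 i = 1.
  rewrite /mixture_ratio /S2 /S3 /S4 /S23 /S24 /S34 /S234 !(mulr0, mul0r, addr0).
  by rewrite !invr1 /mixture_monomial !expr1n !mulr1.
have <- : \sum_(i < 40) tnth (alpha p) i * mixture_ratio 0 0 0 i =
    \sum_(i < 40) tnth (alpha p) i by apply: eq_bigr => i _; rewrite R0 mulr1.
rewrite sum_alpha_ratio// !add0r.
have -> : S234 p 0 0 0 = 1 by rewrite /S234 !(mulr0, mul0r, addr0).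
have [_ _ _ [_ _ _ E234]] := SE p0 p_gt0 t2 t3 t4.
have [_ _ _ [_ _ _ /(lt_le_trans ltr01) /gt_eqF s0]] := S_ge1 h2 h3 h4.
have NA : A t t t t = N^-1 by rewrite ptilde_set4 opprK /= set4_0 p0 mul1r.
have N0 : N != 0 by rewrite gt_eqF// p_set4_gt0.
rewrite idx4E /=.
rewrite !(p_set4E p0 p_gt0 f, p_set4E p0 p_gt0 t f, p_set4E p0 p_gt0 t t f, p_set4E p0 p_gt0 t t t f) /=.
have A0 b1 b2 b3 b4 : A b1 b2 b3 b4 != 0 by rewrite gt_eqF// a_gt0.
(* With [p_1 = a_234 * N] the factor [a_234] cancels, and multiplying by [S234] clears the only
   denominator that depends on the [t_i]. What is left has only [a_234] and [N] as denominators. *)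
have E (s a n c M0 M : R) : s != 0 -> a != 0 ->
    s * (1 + a * n * (c + (M0 / (a * 1) - M / (a * s)))) =
    s * (1 + a * n * c + n * M0) - n * M.
  by move=> sn an; field; rewrite sn an.
rewrite E ?s0// E234.
rewrite btilde12 btilde13 btilde14 btilde23 btilde24 btilde34 btilde123 btilde124
  btilde134 btilde234 btilde1234 NA.
move: N0 (A0 f t t t).
move: (N) (A t f f f) (A f t f f) (A f f t f) (A f f f t) (A t t f f) (A t f t f)
  (A t f f t) (A f t t f) (A f t f t) (A f f t t) (A t t t f) (A t t f t) (A t f t t)
  (A f t t t).
move=> n a1 a2 a3 a4 a12 a13 a14 a23 a24 a34 a123 a124 a134 a234 n0 a0.
by field; rewrite n0 a0.
Qed.

End mixture_ratios.

(** * Poisson series *)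

Section esum_tuple.
Context {R : realType}.
Local Open Scope ereal_scope.

(** Natural numbers that are not codes contribute 0. Results on series, such as scaling and exchange
    with an integral, thereby pass to sums over tuples. *)
Lemma esum_countE (I : countType) (a : I -> \bar R) : (forall i, 0 <= a i) ->
  \esum_(i in setT) a i = \sum_(n <oo) oapp a 0 (@pickle_inv I n).
Proof.
move=> a0; pose b n := oapp a 0 (@pickle_inv I n).
have b0 n : 0 <= b n by rewrite /b; case: pickle_inv => //=.
have bE i : a i = b (pickle i) by rewrite /b pickleK_inv.
rewrite nneseries_esumT//; under eq_esum do rewrite bE.
rewrite -(@esum_image _ _ _ setT (@pickle I) b); last first.
  by move=> x y _ _; exact: (pcan_inj pickleK).
rewrite esum_mkcond; apply: eq_esum => n _.
case: ifPn => //; rewrite notin_setE => nI; rewrite /b.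
have := @pickle_invK I n; case: pickle_inv => //= i iE.
by exfalso; apply: nI; exists i.
Qed.

Lemma esumZl (I : countType) (c : R) (a : I -> \bar R) : (0 <= c)%R ->
  (forall i, 0 <= a i) ->
  \esum_(i in setT) (c%:E * a i) = c%:E * \esum_(i in setT) a i.
Proof.
move=> c0 a0; rewrite !esum_countE//; last by move=> i; rewrite mule_ge0.
rewrite -nneseriesZl; last by move=> n _; case: pickle_inv => //=.
by apply: eq_eseriesr => n _; case: pickle_inv => //=; rewrite mule0.
Qed.

Lemma ge0_integral_esum d (T : measurableType d) (m : {measure set T -> \bar R})
    (I : countType) (F : I -> T -> \bar R) :
  (forall i, measurable_fun setT (F i)) -> (forall i x, 0 <= F i x) ->
  \int[m]_x (\esum_(i in setT) F i x) = \esum_(i in setT) (\int[m]_x F i x).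
Proof.
move=> mF F0; rewrite esum_countE; last by move=> i; exact: integral_ge0.
under eq_integral do rewrite esum_countE//.
rewrite integral_nneseries//.
- apply: eq_eseriesr => n _; case: pickle_inv => //=.
  by rewrite integral0.
- by move=> n; case: pickle_inv => //=.
- by move=> n x _; case: pickle_inv => //=.
Qed.

Lemma measurable_esum d (T : measurableType d) (I : countType)
    (F : I -> T -> \bar R) :
  (forall i, measurable_fun setT (F i)) -> (forall i x, 0 <= F i x) ->
  measurable_fun setT (fun x => \esum_(i in setT) F i x).
Proof.
move=> mF F0; under eq_fun do rewrite esum_countE//.
apply: ge0_emeasurable_sum => [n x _ _|n _]; case: pickle_inv => //=.
Qed.

(** Distributivity for finitely many non-negative series: a tuple splits into head and tail, and the
    inner sum is the induction hypothesis. *)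
Lemma esum_tuple_prod n (f : 'I_n -> nat -> R) (s : 'I_n -> R) :
  (forall i k, 0 <= f i k)%R ->
  (forall i, \sum_(k <oo) (f i k)%:E = (s i)%:E) ->
  \esum_(v in [set: n.-tuple nat]) (\prod_(i < n) f i (tnth v i))%:E =
  (\prod_(i < n) s i)%:E.
Proof.
move=> f0 fs; elim: n f s f0 fs => [|n IH] f s f0 fs.
  rewrite big_ord0 (_ : [set: 0.-tuple nat] = [set [tuple]]); last first.
    by apply/seteqP; split => // v _ /=; rewrite tuple0.
  by rewrite esum_set1 ?big_ord0// lee_fin.
pose e (k : nat * n.-tuple nat) : n.+1.-tuple nat := [tuple of k.1 :: k.2].
rewrite (@reindex_esum _ _ _ setT setT e)//; last first.
  split => //.
  - move=> [k1 v1] [k2 v2] _ _ /(congr1 val)/= [-> /val_inj ->] //.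
  - move=> v _; exists (thead v, [tuple of behead v]) => //.
    by rewrite /e /= [RHS]tuple_eta.
pose a k v := (\prod_(i < n.+1) f i (tnth (e (k, v)) i))%:E.
have a0 k v : 0 <= a k v by rewrite lee_fin; exact: prodr_ge0.
have -> : \esum_(i in setT) (\prod_(i0 < n.+1) f i0 (tnth (e i) i0))%:E =
    \esum_(k in [set: nat]) \esum_(v in [set: n.-tuple nat]) a k v.
  rewrite (esum_esum (J := fun=> setT))//.
  by rewrite (_ : _ `*`` _ = setT); [apply: eq_esum => -[]|apply/seteqP].
have E k : \esum_(v in [set: n.-tuple nat]) a k v =
    (f ord0 k)%:E * (\prod_(i < n) s (lift ord0 i))%:E.
  rewrite -(IH (fun i => f (lift ord0 i))) => [|i j|i]; [|exact: f0|exact: fs].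
  rewrite -esumZl ?lee_fin//; last by move=> v; rewrite lee_fin; exact: prodr_ge0.
  apply: eq_esum => v _; rewrite /a big_ord_recl/= -EFinM; congr (_ * _)%:E.
  by apply: eq_bigr => i _; rewrite tnthS.
under eq_esum do rewrite E muleC.
rewrite esumZl; [|by apply: prodr_ge0 => i _; rewrite -lee_fin -fs; apply: nneseries_ge0
  => k _ _; rewrite lee_fin|by move=> k; rewrite lee_fin].
rewrite -nneseries_esumT; last by move=> k; rewrite lee_fin.
by rewrite fs -EFinM big_ord_recl mulrC.
Qed.

Lemma poisson_pgf (a r : R) : (0 < a)%R -> (0 <= r)%R ->
  \sum_(k <oo) (poisson_pmf a k * r ^+ k)%:E = (expR (- (a * (1 - r))))%:E.
Proof.
move=> a0 r0; apply/cvg_lim => //.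
rewrite (_ : (fun n => _) = (fun n => (expR (- a) * series (exp_coeff (a * r)) n)%R%:E)).
  apply: cvg_EFin; first exact: nearW.
  rewrite (_ : (- (a * (1 - r)) = - a + a * r)%R); last by ring.
  by rewrite expRD; apply: cvgMl_tmp; exact: cvg_series_exp_coeff.
apply/funext => n; rewrite sumEFin /series/= mulr_sumr; congr EFin.
by apply: eq_bigr => k _; rewrite /poisson_pmf a0 /exp_coeff/= exprMn; ring.
Qed.

End esum_tuple.

(** * Laplace transforms on the orthant *)

Section mgamma_laplace.
Context {R : realType}.

(** Shape 0 has to be included because an exponent [z_k] of the mixture may vanish; the vector is
    then almost surely 0. For positive shape, continuity at 0 provides the neighbourhood required by
    [laplace_power_extend]. *)
Lemma mgamma_laplaceE d (T : measurableType d) (Pr : probability T R) n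
    (X : T -> n.-tuple R) (P : 'rV[R]_n -> R) (l : R) : 0 <= l ->
  affine_in_each P -> {for 0, continuous P} ->
  (forall t : 'rV[R]_n, (forall i, 0 <= t 0 i) -> 0 < P t) ->
  mgamma Pr X P l ->
  forall t : 'rV[R]_n, (forall i, 0 <= t 0 i) -> laplace Pr X t = (P t `^ (- l))%:E.
Proof.
move=> l0 affP cP posP [mX H] t t0; move: H; case: ifPn => [/eqP -> X0|ln0 HP].
  rewrite oppr0 powRr0 /laplace.
  have mB : measurable [set w | forall i, tnth (X w) i = 0].
    rewrite (_ : [set w | _] = \bigcap_(i in [set: 'I_n]) ((fun w => tnth (X w) i) @^-1` [set 0])).
      apply: fin_bigcap_measurable => // i _.
      by rewrite -[X in measurable X]setTI; exact: measurable_tnth_comp.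
    by apply/seteqP; split => w /= H i; [move=> _; exact: H|exact: (H i)].
  rewrite (_ : 1%:E = (\int[Pr]_w (1%R)%:E)%E); last first.
    by rewrite integral_cst// mul1e; apply/esym; exact: probability_setT.
  apply: ge0_ae_eq_integral => //.
  - by apply/measurable_EFinP; exact: measurable_laplace_fun.
  exists (~` [set w | forall i, tnth (X w) i = 0]); split.
  - exact: measurableC.
  - by have := probability_setC Pr mB; rewrite X0 subee.
  - move=> w /= H; apply: contra_not H => Hw _; congr EFin.
    by rewrite big1 ?oppr0 ?expR0// => i _; rewrite Hw mulr0.
have lpos : 0 < l by rewrite lt_neqAle eq_sym ln0.
have [rho rho0 Hrho] : exists2 rho, 0 < rho &
    forall t : 'rV[R]_n, (forall i, `|t 0 i| < rho) -> 0 < P t.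
  have P00 : 0 < P 0 by apply: posP => i; rewrite mxE.
  have /nbhs_ballP[e /= e0 He] : \forall u \near (0 : 'rV[R]_n), 0 < P u.
    exact: (cvgr_gt _ cP).
  exists e => // u Hu; apply: He; split => // i j.
  by rewrite (ord1 i) /ball/= mxE sub0r normrN.
have [|_ ->//] := laplace_power_extend mX lpos affP _ rho0 Hrho posP HP t0.
by apply: le_lt_trans (probability_le1 _ _) _; rewrite ?ltry.
Qed.

(** Chernoff bound: the probability of [X <= 0] is at most the transform at any [s >= 0], which
    tends to 0 as [s] grows. *)
Lemma gamma1_ae_gt0 d (T : measurableType d) (Pr : probability T R) (X : {RV Pr >-> R})
    (c l : R) : 0 < c -> 0 < l ->
  (forall s, 0 <= s -> mgf Pr X (- s) = ((1 + c * s) `^ (- l))%:E) ->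
  Pr (X @^-1` `]-oo, 0%R]) = 0%E.
Proof.
move=> c0 l0 H.
have mB : measurable (X @^-1` `]-oo, 0%R]) by rewrite -[X in measurable X]setTI; exact: measurable_funP.
have bnd s : 0 <= s -> (Pr (X @^-1` `]-oo, 0%R]) <= ((1 + c * s) `^ (- l))%:E)%E.
  move=> s0; rewrite -H// -(setIT (_ @^-1` _)) -integral_indic//.
  apply: ge0_le_integral => //.
  - by apply/measurable_EFinP; exact: measurable_indic.
  - exact: measurable_mgf_fun.
  move=> w _; rewrite lee_fin indicE; case: (boolP (w \in _)) => [|_]; last exact: expR_ge0.
  rewrite inE/= in_itv/= => Xw; rewrite -expR0 ler_expR mulNr oppr_ge0.
  exact: mulr_ge0_le0.
apply/eqP; rewrite eq_le measure_ge0 andbT; apply/lee_addgt0Pr => e e0; rewrite add0e.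
(* The solution of [(c * s) ^ (- l) = e]. *)
pose s := ((e^-1 `^ l^-1)) / c.
have s0 : 0 <= s by rewrite divr_ge0 ?powR_ge0// ltW.
apply: (le_trans (bnd s s0)); rewrite lee_fin powRN mulrCA divff ?gt_eqF// mulr1.
rewrite -[leRHS]invrK lef_pV2 ?posrE ?invr_gt0 ?powR_gt0//; last by rewrite ltr_wpDr ?powR_ge0.
have e1 : 0 <= e^-1 by rewrite invr_ge0 ltW.
rewrite -[leLHS](powRr1 e1) -[X in _ `^ X](mulVf (lt0r_neq0 l0)) powRrM.
apply: ge0_ler_powR; rewrite ?nnegrE ?powR_ge0 ?addr_ge0 ?powR_ge0//; first exact: ltW.
by rewrite lerDr.
Qed.

End mgamma_laplace.

Section cond_laplace.
Context {R : realType} (p : {set 'I_4} -> R) (lambda : R).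
Hypothesis p0 : p finset.set0 = 1.
Hypothesis p_gt0 : forall T : {set 'I_4}, T != finset.set0 -> 0 < p T.
Hypothesis b_gt0 : forall T : {set 'I_4}, (1 < #|T|)%N -> 0 < btilde p T.

Definition mixture_rate (t2 t3 t4 : R) : R :=
  \sum_(i < 40) tnth (alpha p) i * (1 - mixture_ratio p t2 t3 t4 i).

Lemma mixture_rate_ge0 t2 t3 t4 : 0 <= t2 -> 0 <= t3 -> 0 <= t4 ->
  0 <= mixture_rate t2 t3 t4.
Proof.
move=> h2 h3 h4; apply: sumr_ge0 => i _; apply: mulr_ge0.
  by apply/ltW; exact: alpha_gt0.
by rewrite subr_ge0; have /andP[] := mixture_ratio_gt0_le1 p0 p_gt0 i h2 h3 h4.
Qed.

(** [S234 ^ (- z7)] belongs to the monomials and [S234 ^ (- lambda)] is common to all terms, so a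
    product of forty Poisson generating functions remains. Positivity of [x] makes their parameters
    positive. *)
Lemma cond_laplaceE t2 t3 t4 x : 0 <= t2 -> 0 <= t3 -> 0 <= t4 -> 0 < x ->
  cond_laplace p lambda t2 t3 t4 x =
  (expR (- (x * mixture_rate t2 t3 t4)) * S234 p t2 t3 t4 `^ (- lambda))%:E.
Proof.
move=> h2 h3 h4 x0; rewrite /cond_laplace.
have [s2 s3 s4 [s23 s24 s34 s234]] := S_ge1 p0 p_gt0 h2 h3 h4.
have s0 : 0 < S234 p t2 t3 t4 by exact: lt_le_trans s234.
pose g (i : 'I_40) k := poisson_pmf (tnth (alpha p) i * x) k *
  mixture_ratio p t2 t3 t4 i ^+ k.
have r0 (i : 'I_40) : 0 <= mixture_ratio p t2 t3 t4 i.
  by have /andP[/ltW] := mixture_ratio_gt0_le1 p0 p_gt0 i h2 h3 h4.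
have g0 i k : 0 <= g i k by rewrite mulr_ge0 ?poisson_pmf_ge0 ?exprn_ge0.
transitivity (\esum_(v in [set: 40.-tuple nat])
    ((S234 p t2 t3 t4 `^ (- lambda))%:E * (\prod_(i < 40) g i (tnth v i))%:E))%E.
  apply: eq_esum => v _; rewrite -EFinM; congr EFin.
  rewrite /g big_split/= prod_mixture_monomial opprD powRD; last by rewrite (gt_eqF s0) implybT.
  by rewrite powR_invn ?(ltW s0)// !exprVn; ring.
rewrite esumZl ?powR_ge0//; last by move=> v; rewrite lee_fin prodr_ge0.
rewrite (@esum_tuple_prod _ _ g (fun i => expR (- ((tnth (alpha p) i * x) *
   (1 - mixture_ratio p t2 t3 t4 i)))))//; last first.
  move=> i; apply: poisson_pgf => //; rewrite mulr_gt0//; exact: alpha_gt0.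
rewrite -EFinM mulrC -expR_sum; congr (expR _ * _)%:E.
rewrite sumrN mulr_sumr; congr (- _); apply: eq_bigr => i _; ring.
Qed.

End cond_laplace.

(** * Infinite divisibility *)

Section gamma_mixture.
Context {R : realType}.
Local Notation leb := (@lebesgue_measure R).

(** Normalization serves to obtain the type [probability]: with total mass 1 it changes nothing, and
    the Dirac mass is its default for degenerate masses. *)
Lemma measure_probability d (T : measurableType d) (x : T)
    (mu : {measure set T -> \bar R}) : mu setT = 1%E ->
  exists P : probability T R, (P : set T -> \bar R) = mu.
Proof.
move=> mu1; exists (mnormalize mu (dirac x : probability T R)).
apply/funext => U; rewrite /= /mnormalize mu1 /= onee_eq0/=.
by rewrite invr1 mule1.
Qed.

Lemma pushforward_measure_ex d1 d2 (T1 : measurableType d1) (T2 : measurableType d2)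
    (m : {measure set T1 -> \bar R}) (f : T1 -> T2) : measurable_fun setT f ->
  exists mu : {measure set T2 -> \bar R}, forall g : T2 -> \bar R,
    measurable_fun setT g -> (forall y, 0 <= g y)%E ->
    (\int[mu]_y g y = \int[m]_x g (f x))%E.
Proof.
move=> mf; unshelve eexists (pushforward m f : {measure set T2 -> \bar R}).
  exact: mf.
by move=> g mg g0; rewrite ge0_integral_pushforward// preimage_setT.
Qed.

(** The gamma law of shape [l] and rate [a], built as the image under [exp] of a density on the
    whole line, so that [gamma_integral] applies at [s + a]. *)
Lemma gamma_probability (l a : R) : 0 < l -> 0 < a ->
  exists P : probability R R, forall s, 0 <= s ->
    (\int[P]_x (expR (- (s * x)))%:E = (a `^ l * (s + a) `^ (- l))%:E)%E.
Proof.
move=> l0 a0; have [c c0 Hc] := gamma_integral l0.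
pose g (y : measurableTypeR R) : R := a `^ l * (c * expR (l * y - a * expR y)).
have mg : measurable_fun setT g.
  by do 2 (apply: measurable_funM => //); exact: measurable_log_gamma.
have g0 y : 0 <= g y by rewrite !mulr_ge0 ?powR_ge0 ?expR_ge0// ltW.
have [m [_ mi]] := density_measure_ex leb mg g0.
have mE : measurable_fun setT (expR : measurableTypeR R -> R) by exact: measurable_expR.
have mex s : measurable_fun setT (fun x : R => (expR (- (s * x)))%:E).
  by apply/measurable_EFinP; apply: measurableT_comp => //; apply: measurableT_comp => //;
    exact: measurable_funM.
have [mu mui] := pushforward_measure_ex m mE.
have H s : 0 <= s -> (\int[mu]_x (expR (- (s * x)))%:E =
    (a `^ l * (s + a) `^ (- l))%:E)%E.
  move=> s0; rewrite mui//.
  rewrite mi; last 2 first.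
  - exact: (measurableT_comp (mex s) mE).
  - by move=> x; rewrite /= lee_fin expR_ge0.
  rewrite EFinM -Hc ?ltr_wpDl// -ge0_integralZl//; last 3 first.
  - by apply/measurable_EFinP; apply: measurable_funM => //; exact: measurable_log_gamma.
  - by move=> y _; rewrite lee_fin mulr_ge0 ?expR_ge0// ltW.
  - by rewrite lee_fin powR_ge0.
  apply: eq_integral => y _; rewrite /= -!EFinM; congr EFin.
  by rewrite /g mulrC -!mulrA -expRD; congr (_ * (_ * expR _)); ring.
have mu1 : mu setT = 1%E.
  have := H 0 (lexx _); rewrite add0r -powRD ?subrr ?powRr0; last by apply/implyP => _; rewrite gt_eqF.
  move=> <-; under eq_integral do rewrite mul0r oppr0 expR0.
  by rewrite integral_cst// mul1e.
have [P PE] := measure_probability (0 : R) mu1.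
by exists P => s s0; rewrite -H// PE.
Qed.

Lemma ge0_integral_prod d1 d2 (T1 : measurableType d1) (T2 : measurableType d2)
    (P1 : probability T1 R) (P2 : probability T2 R) (f : T1 -> R) (g : T2 -> R) (a b : R) :
  measurable_fun setT f -> measurable_fun setT g ->
  (forall x, 0 <= f x) -> (forall x, 0 <= g x) ->
  (\int[P1]_x (f x)%:E = a%:E)%E -> (\int[P2]_x (g x)%:E = b%:E)%E ->
  (\int[(P1 \x P2)%E : probability _ R]_z (f z.1 * g z.2)%:E = (a * b)%:E)%E.
Proof.
move=> mf mg f0 g0 fa gb.
have mge : measurable_fun setT (fun x => (g x)%:E) by exact/measurable_EFinP.
have mfe : measurable_fun setT (fun x => (f x)%:E) by exact/measurable_EFinP.
have b0 : 0 <= b by rewrite -lee_fin -gb integral_ge0// => x _; rewrite lee_fin.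
have m2e : measurable_fun setT (fun z : T1 * T2 => (f z.1 * g z.2)%:E).
  by apply/measurable_EFinP; apply: measurable_funM; exact: measurableT_comp.
have E := @fubini_tonelli1 _ _ _ _ R P1 P2 _ m2e (fun z => mulr_ge0 (f0 z.1) (g0 z.2)).
rewrite [LHS]E.
transitivity (\int[P1]_z ((f z)%:E * b%:E))%E.
  apply: eq_integral => z _; rewrite /fubini_F -gb -ge0_integralZl//.
    by move=> y _; rewrite lee_fin.
  by rewrite lee_fin.
by rewrite ge0_integralZr// ?fa ?EFinM// => z _; rewrite lee_fin.
Qed.

(** The measure may have any total mass, which makes the property stable under countable sums and
    non-negative scaling; mass 1 is recovered from the value at 0 in [mgamma_infdiv_laplace]. *)
Definition is_laplace n (F : 'rV[R]_n -> \bar R) :=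
  exists mu : {measure set (n.-tuple R) -> \bar R},
    forall t : 'rV[R]_n, (forall i, 0 <= t 0 i) -> laplace mu id t = F t.

Lemma sum_tuple3 (t : 'rV[R]_3) (x : 3.-tuple R) :
  \sum_(i < 3) t 0 i * tnth x i =
  t 0 0 * tnth x 0 + t 0 1 * tnth x 1 + t 0 ord_max * tnth x ord_max.
Proof.
rewrite !big_ord_recl big_ord0 addr0 addrA.
by congr (_ * _ + _ * _ + _ * _); congr (_ _); exact: val_inj.
Qed.

Lemma is_laplace_gamma (k l1 l2 l3 a1 a2 a3 : R) : 0 <= k ->
  0 < l1 -> 0 < l2 -> 0 < l3 -> 0 < a1 -> 0 < a2 -> 0 < a3 ->
  is_laplace (fun t : 'rV[R]_3 => (k * ((t 0 0 + a1) `^ (- l1) * (t 0 1 + a2) `^ (- l2)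
    * (t 0 ord_max + a3) `^ (- l3)))%:E).
Proof.
move=> k0 l10 l20 l30 a10 a20 a30.
have [P1 H1] := gamma_probability l10 a10.
have [P2 H2] := gamma_probability l20 a20.
have [P3 H3] := gamma_probability l30 a30.
(* Removes the normalizing constants of the three gamma laws. *)
pose K := k / (a1 `^ l1 * a2 `^ l2 * a3 `^ l3).
have K0 : 0 <= K by rewrite divr_ge0// !mulr_ge0 ?powR_ge0.
pose phi (z : R * R * R) : 3.-tuple R := [tuple z.1.1; z.1.2; z.2].
have mphi : measurable_fun setT phi.
  apply/measurable_fun_tnthP => -[[|[|[|//]]] i3].
  - exact: (measurableT_comp measurable_fst measurable_fst).
  - exact: (measurableT_comp measurable_snd measurable_fst).
  - exact: measurable_snd.
pose P12 : probability (R * R)%type R := (P1 \x P2)%E.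
pose P123 : probability (R * R * R)%type R := (P12 \x P3)%E.
have [m mi] := pushforward_measure_ex P123 mphi.
have [mu [_ mui]] := density_measure_ex m (measurable_cst K : measurable_fun setT (fun=> K)) (fun=> K0).
exists mu => t t0.
have mid : measurable_fun setT (@id (3.-tuple R)) by exact: measurable_id.
have ml := (measurable_EFinP _ _).2 (measurable_laplace_fun mid t).
rewrite /laplace mui//; under eq_integral do rewrite muleC.
rewrite ge0_integralZl// mi//.
transitivity (K%:E * \int[P123]_z (expR (- (t 0 0%R * z.1.1)) *
   expR (- (t 0 1%R * z.1.2)) * expR (- (t 0 ord_max * z.2)))%:E)%E.
  congr (_ * _)%E; apply: eq_integral => z _; congr EFin.
  by rewrite sum_tuple3 /phi !(tnth_nth 0)/= -!expRD; congr expR; ring.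
have me s : measurable_fun setT (fun x : R => expR (- (s * x))).
  by apply: measurableT_comp => //; apply: measurableT_comp => //; exact: measurable_funM.
have I12 := ge0_integral_prod (me _) (me _) (fun=> expR_ge0 _) (fun=> expR_ge0 _)
  (H1 _ (t0 0)) (H2 _ (t0 1)).
have m12 : measurable_fun setT (fun z : R * R =>
    expR (- (t 0 0 * z.1)) * expR (- (t 0 1 * z.2))).
  by apply: measurable_funM; apply: (measurableT_comp (me _)).
have I123 := ge0_integral_prod m12 (me _) (fun=> mulr_ge0 (expR_ge0 _) (expR_ge0 _))
  (fun=> expR_ge0 _) I12 (H3 _ (t0 ord_max)).
rewrite I123.
rewrite -EFinM; congr EFin; rewrite /K; field.
by rewrite !gt_eqF// powR_gt0.
Qed.

Lemma is_laplace_esum n (I : countType) (F : I -> 'rV[R]_n -> \bar R) :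
  (forall i, is_laplace (F i)) ->
  is_laplace (fun t : 'rV[R]_n => \esum_(i in [set: I]) F i t)%E.
Proof.
move=> /choice[mu Hmu].
pose mu_ k : {measure set (n.-tuple R) -> \bar R} :=
  if @pickle_inv I k is Some i then mu i else mzero.
exists (mseries mu_ 0) => t t0.
have mid : measurable_fun setT (@id (n.-tuple R)) by exact: measurable_id.
have F0 i : (0 <= F i t)%E by rewrite -Hmu//; exact: laplace_ge0.
have ml := (measurable_EFinP _ _).2 (measurable_laplace_fun mid t).
rewrite esum_countE// /laplace ge0_integral_measure_series//.
apply: eq_eseriesr => k _; rewrite /mu_; case: pickle_inv => [i|]/=.
  exact: Hmu.
by rewrite integral_measure_zero.
Qed.

End gamma_mixture.

(** * Negative powers of the cubic polynomial as Laplace transforms *)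

Section trivariate_gamma.
Context {R : realType}.
Local Notation leb := (@lebesgue_measure R).

Lemma nneseries_exp_coeff (u : R) : 0 <= u ->
  (\sum_(k <oo) (exp_coeff u k)%:E = (expR u)%:E)%E.
Proof.
move=> u0; apply/cvg_lim => //.
rewrite (_ : (fun n => _) = (fun n => (series (exp_coeff u) n)%:E)).
  by apply: cvg_EFin; [exact: nearW|exact: cvg_series_exp_coeff].
by apply/funext => n; rewrite sumEFin.
Qed.

Definition cubic (a1 a2 a3 b12 b13 b23 b123 : R) (t : 'rV[R]_3) : R :=
  let x := t 0 0 + a1 in let y := t 0 1 + a2 in let z := t 0 ord_max + a3 in
  x * y * z - b12 * z - b13 * y - b23 * x - b123.

(* With [D = x y z (1 - u)] the power [D ^ (-l)] is the gamma mixture of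
   [(x y z) ^ (-l) exp (u s)], and expanding the exponential gives a positive
   series of products of one-dimensional gamma transforms. *)
Lemma is_laplace_cubic (l a1 a2 a3 b12 b13 b23 b123 : R) : 0 < l ->
  0 < a1 -> 0 < a2 -> 0 < a3 -> 0 <= b12 -> 0 <= b13 -> 0 <= b23 -> 0 <= b123 ->
  (forall t : 'rV[R]_3, (forall i, 0 <= t 0 i) ->
    0 < cubic a1 a2 a3 b12 b13 b23 b123 t) ->
  is_laplace (fun t : 'rV[R]_3 => (cubic a1 a2 a3 b12 b13 b23 b123 t `^ (- l))%:E).
Proof.
move=> l0 a10 a20 a30 b120 b130 b230 b1230 Dpos.
have [c c0 Hc] := gamma_integral l0.
pose b (i : 'I_4) := [tuple b12; b13; b23; b123]`_i.
(* The first variable occurs in the denominators [x * y], [x * z] and [x * y * z], attached to the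
   indices 0, 1 and 3; the other two counts arise in the same way. *)
pose n1 (v : 4.-tuple nat) := (nth 0%N v 0 + nth 0%N v 1 + nth 0%N v 3)%N.
pose n2 (v : 4.-tuple nat) := (nth 0%N v 0 + nth 0%N v 2 + nth 0%N v 3)%N.
pose n3 (v : 4.-tuple nat) := (nth 0%N v 1 + nth 0%N v 2 + nth 0%N v 3)%N.
(* The mean of the product of the [(b_i * s) ^ v_i / v_i!], where [s = exp y] has the gamma law of
   shape [l]. *)
pose w (v : 4.-tuple nat) : \bar R :=
  (\int[leb]_y (c * expR (l * y - expR y) * \prod_(i < 4) exp_coeff (b i * expR y) (tnth v i))%:E)%E.
pose F (v : 4.-tuple nat) (t : 'rV[R]_3) : \bar R :=
  (w v * ((t 0 0 + a1) `^ (- (l + (n1 v)%:R)) * (t 0 1 + a2) `^ (- (l + (n2 v)%:R))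
    * (t 0 ord_max + a3) `^ (- (l + (n3 v)%:R)))%:E)%E.
have b0 i : 0 <= b i by case: i => -[|[|[|[|//]]]] i4.
have w0 v : (0 <= w v)%E.
  apply: integral_ge0 => y _; rewrite lee_fin !mulr_ge0 ?expR_ge0 ?(ltW c0)// prodr_ge0// => i _.
  by rewrite exp_coeff_ge0// mulr_ge0 ?expR_ge0.
have wfin v : w v \is a fin_num.
  rewrite ge0_fin_numE//.
  (* A monomial of degree [J] in [exp y] raises the shape to [l + J], so the weight is again a gamma
     integral up to a constant. *)
  pose J := \sum_(i < 4) tnth v i.
  have [c' c'0 Hc'] := @gamma_integral R (l + J%:R) (ltr_wpDr (ler0n _ _) l0).
  pose K := c / c' * \prod_(i < 4) exp_coeff (b i) (tnth v i).
  have K0 : 0 <= K.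
    rewrite mulr_ge0 ?divr_ge0 ?(ltW c0) ?(ltW c'0)// prodr_ge0// => i _; exact: exp_coeff_ge0.
  rewrite (_ : w v = K%:E * \int[leb]_y (c' * expR ((l + J%:R) * y - 1 * expR y))%:E)%E.
    by rewrite Hc'// -EFinM ltry.
  rewrite -ge0_integralZl//; last 2 first.
  - apply/measurable_EFinP; apply: measurable_funM => //; exact: measurable_log_gamma.
  - by move=> y _; rewrite lee_fin mulr_ge0 ?expR_ge0// ltW.
  apply: eq_integral => y _; rewrite -EFinM; congr EFin.
  have -> : \prod_(i < 4) exp_coeff (b i * expR y) (tnth v i) =
      \prod_(i < 4) exp_coeff (b i) (tnth v i) * expR (J%:R * y).
    rewrite /J natr_sum mulr_suml expR_sum -big_split /=; apply: eq_bigr => i _.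
    by rewrite /exp_coeff /= exprMn expRM_natl; ring.
  have -> : (l + J%:R) * y - 1 * expR y = (l * y - expR y) + J%:R * y by ring.
  rewrite !expRD /K.
  by field; rewrite gt_eqF.
have LF v : is_laplace (F v).
  rewrite /F -(fineK (wfin v)).
  by apply: is_laplace_gamma; rewrite ?fine_ge0// ltr_wpDr.
have [mu Hmu] := is_laplace_esum LF.
exists mu => t t0; rewrite Hmu//.
set D := cubic _ _ _ _ _ _ _ _; have D0 : 0 < D by exact: Dpos.
pose x := t 0 0 + a1; pose y := t 0 1 + a2; pose z := t 0 ord_max + a3.
have [x0 y0 z0] : [/\ 0 < x, 0 < y & 0 < z] by rewrite !ltr_wpDl.
pose d (i : 'I_4) := [tuple (x * y)^-1; (x * z)^-1; (y * z)^-1; (x * y * z)^-1]`_i.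
have d0 i : 0 <= d i.
  by case: i => -[|[|[|[|//]]]] i4; rewrite /d/= invr_ge0 !mulr_ge0// ltW.
pose u := \sum_(i < 4) b i * d i.
have Du : D = x * y * z * (1 - u).
  rewrite /D /cubic /u !big_ord_recl big_ord0 /b /d /= -/x -/y -/z.
  by field; rewrite !gt_eqF.
have xyz0 : 0 < x * y * z by rewrite !mulr_gt0.
have u1 : 0 < 1 - u by move: D0; rewrite Du pmulr_rgt0.
rewrite Du powRM ?(ltW u1) ?(ltW xyz0)// EFinM -(Hc _ u1).
rewrite -ge0_integralZl//; last 3 first.
- apply/measurable_EFinP; apply: measurable_funM => //; exact: measurable_log_gamma.
- by move=> s _; rewrite lee_fin mulr_ge0 ?expR_ge0// ltW.
- by rewrite lee_fin powR_ge0.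
have mfull v : measurable_fun setT (fun s : measurableTypeR R =>
    (c * expR (l * s - expR s) * \prod_(i < 4) exp_coeff (b i * expR s) (tnth v i))%:E).
  apply/measurable_EFinP; apply: measurable_funM.
    apply: measurable_funM => //.
    have := @measurable_log_gamma R l 1; congr measurable_fun.
    by apply/funext => s; rewrite mul1r.
  apply: (@measurable_prod _ _ _ _ _ _ (fun i (s : measurableTypeR R) => exp_coeff (b i * expR s) (tnth v i))) => i _.
  by apply: measurable_funM => //; apply: measurable_funX; exact: measurable_funM.
have full0 v (s : measurableTypeR R) : (0 <= (c * expR (l * s - expR s) *
    \prod_(i < 4) exp_coeff (b i * expR s) (tnth v i))%:E)%E.
  rewrite lee_fin !mulr_ge0 ?expR_ge0 ?(ltW c0)// prodr_ge0// => i _.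
  by rewrite exp_coeff_ge0// mulr_ge0 ?expR_ge0.
pose X v := x `^ (- (l + (n1 v)%:R)) * y `^ (- (l + (n2 v)%:R)) * z `^ (- (l + (n3 v)%:R)).
have X0 v : 0 <= X v by rewrite !mulr_ge0 ?powR_ge0.
have XE v : X v = (x * y * z) `^ (- l) * \prod_(i < 4) d i ^+ tnth v i.
  have pw r n : 0 < r -> r `^ (- (l + n%:R)) = r `^ (- l) * r^-1 ^+ n.
    move=> r0; rewrite opprD powRD; last by rewrite (gt_eqF r0) implybT.
    by rewrite powR_invn ?(ltW r0)// exprVn.
  rewrite /X !pw// !powRM ?mulr_ge0 ?(ltW x0) ?(ltW y0) ?(ltW z0)//.
  rewrite !big_ord_recl big_ord0 /d !(tnth_nth 0%N) /n1 /n2 /n3 /= !invfM.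
  rewrite !exprD !exprMn; ring.
transitivity (\esum_(v in [set: 4.-tuple nat]) \int[leb]_s ((X v)%:E * (c * expR (l * s - expR s) *
    \prod_(i < 4) exp_coeff (b i * expR s) (tnth v i))%:E))%E.
  apply: eq_esum => v _; rewrite ge0_integralZl//; last by rewrite lee_fin.
  by rewrite muleC.
rewrite -ge0_integral_esum//; last 2 first.
- by move=> v; apply: emeasurable_funM.
- by move=> v s; rewrite mule_ge0// lee_fin.
apply: eq_integral => s _.
transitivity (\esum_(v in [set: 4.-tuple nat]) (((x * y * z) `^ (- l) * (c * expR (l * s - expR s)))%:E *
  (\prod_(i < 4) exp_coeff (b i * d i * expR s) (tnth v i))%:E))%E.
  apply: eq_esum => v _; rewrite -!EFinM XE; congr EFin.
  have -> : \prod_(i < 4) exp_coeff (b i * d i * expR s) (tnth v i) =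
      \prod_(i < 4) d i ^+ tnth v i * \prod_(i < 4) exp_coeff (b i * expR s) (tnth v i).
    rewrite -big_split/=; apply: eq_bigr => i _.
    by rewrite /exp_coeff/= (mulrAC (b i)) exprMn; ring.
  ring.
rewrite esumZl; last 2 first.
- by rewrite !mulr_ge0 ?powR_ge0 ?expR_ge0// ltW.
- move=> v; rewrite lee_fin prodr_ge0// => i _.
  by rewrite exp_coeff_ge0// !mulr_ge0 ?expR_ge0.
rewrite (@esum_tuple_prod _ _ (fun i => exp_coeff (b i * d i * expR s))
  (fun i => expR (b i * d i * expR s))); last 2 first.
- by move=> i k; rewrite exp_coeff_ge0// !mulr_ge0 ?expR_ge0.
- by move=> i; apply: nneseries_exp_coeff; rewrite !mulr_ge0 ?expR_ge0.
rewrite -!EFinM; congr EFin; rewrite -[LHS]mulrA; congr (_ * _); rewrite -[LHS]mulrA; congr (_ * _).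
rewrite -expR_sum -mulr_suml -/u -expRD; congr expR; ring.
Qed.

End trivariate_gamma.

Section infinite_divisibility.
Context {R : realType}.
Local Notation origin n := ([tuple 0 | _ < n] : n.-tuple R).

Lemma orthant_interior n : [set t : 'rV[R]_n | forall i, 0 <= t 0 i]° !=set0.
Proof.
exists (const_mx 1); apply/nbhs_ballP; exists 2^-1 => /=; first by rewrite invr_gt0.
move=> t [_ /(_ 0) H] i; have := H i; rewrite /ball/= mxE => /ltW.
by rewrite ler_distlC => /andP[h _]; apply: le_trans h; lra.
Qed.

Lemma laplace_dirac n (t : 'rV[R]_n) :
  laplace (dirac (origin n)) id t = 1%E.
Proof.
have mid : measurable_fun setT (@id (n.-tuple R)) by exact: measurable_id.
have ml := (measurable_EFinP _ _).2 (measurable_laplace_fun mid t).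
rewrite /laplace integral_dirac// diracT mul1e.
by rewrite big1 ?oppr0 ?expR0// => i _; rewrite tnth_mktuple mulr0.
Qed.

(** [l * t] is again a positive exponent, so representability for all exponents contains infinite
    divisibility, and [P 0 = 1] gives total mass 1. At shape 0 the Dirac mass at the origin serves
    for every [t]. *)
Lemma mgamma_infdiv_laplace n (P : 'rV[R]_n -> R) : P 0 = 1 ->
  (forall t : 'rV[R]_n, (forall i, 0 <= t 0 i) -> 0 < P t) ->
  (forall l, 0 < l -> is_laplace (fun t => (P t `^ (- l))%:E)) ->
  forall l, 0 <= l -> mgamma_infdiv P l.
Proof.
move=> P1 Pgt0 H l l0.
have mid : measurable_fun setT (@id (n.-tuple R)) by exact: measurable_id.
have [->|ln0] := eqVneq l 0; split.
- exists (dirac (origin n)); split => //; rewrite eqxx [LHS]diracE mem_set//.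
  by move=> i; rewrite tnth_mktuple.
- move=> t t0; exists (dirac (origin n)).
  exists [set t : 'rV[R]_n | forall i, 0 <= t 0 i]; first exact: orthant_interior.
  move=> th th0; split; first exact: Pgt0.
  by rewrite mul0r oppr0 powRr0 laplace_dirac.
- have [|mu Hmu] := H l; first by rewrite lt_neqAle eq_sym ln0.
  have mu1 : mu setT = 1%E.
    have z0 i : 0 <= (0 : 'rV[R]_n) 0 i by rewrite mxE.
    have := Hmu 0 z0; rewrite P1 powR1 => <-.
    rewrite /laplace -[LHS]mul1e -integral_cst//; apply: eq_integral => w _.
    by rewrite big1 ?oppr0 ?expR0// => i _; rewrite mxE mul0r.
  have [Q QE] := measure_probability (origin n) mu1.
  exists Q; split => //; rewrite (negbTE ln0).
  exists [set t : 'rV[R]_n | forall i, 0 <= t 0 i]; first exact: orthant_interior.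
  by move=> th th0; split; [exact: Pgt0|rewrite -Hmu// /laplace -QE].
- move=> t t0; have [|mu Hmu] := H (l * t).
    by rewrite mulr_gt0// lt_neqAle eq_sym ln0.
  exists mu; exists [set t : 'rV[R]_n | forall i, 0 <= t 0 i]; first exact: orthant_interior.
  by move=> th th0; split; [exact: Pgt0|exact: Hmu].
Qed.

Lemma is_laplaceZ n (F : 'rV[R]_n -> \bar R) (k : R) : 0 <= k -> is_laplace F ->
  is_laplace (fun t => k%:E * F t)%E.
Proof.
move=> k0 [mu Hmu].
have [nu [_ H]] := density_measure_ex mu (measurable_cst k : measurable_fun setT (fun=> k)) (fun=> k0).
exists nu => t t0; rewrite -Hmu//.
have mid : measurable_fun setT (@id (n.-tuple R)) by exact: measurable_id.
have ml := (measurable_EFinP _ _).2 (measurable_laplace_fun mid t).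
rewrite /laplace H//; under eq_integral do rewrite muleC.
by rewrite ge0_integralZl.
Qed.

(** [psi] is the transpose of [phi]. Applied to coordinate projections, this yields the one- and
    two-dimensional laws as marginals of trivariate ones. *)
Lemma is_laplace_map m n (phi : m.-tuple R -> n.-tuple R) (psi : 'rV[R]_n -> 'rV[R]_m)
    (F : 'rV[R]_m -> \bar R) : measurable_fun setT phi ->
  (forall (t : 'rV[R]_n) x, \sum_(i < n) t 0 i * tnth (phi x) i = \sum_(i < m) psi t 0 i * tnth x i) ->
  (forall t : 'rV[R]_n, (forall i, 0 <= t 0 i) -> forall i, 0 <= psi t 0 i) ->
  is_laplace F -> is_laplace (F \o psi).
Proof.
move=> mphi sumE psi0 [mu Hmu].
have [nu H] := pushforward_measure_ex mu mphi.
exists nu => t t0; rewrite /= -Hmu; last exact: psi0.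
have mid : measurable_fun setT (@id (n.-tuple R)) by exact: measurable_id.
have ml := (measurable_EFinP _ _).2 (measurable_laplace_fun mid t).
rewrite /laplace H; last 2 first.
- exact: ml.
- by move=> y; rewrite lee_fin expR_ge0.
by apply: eq_integral => w _; rewrite sumE.
Qed.

Lemma powR_div_scale (x K l : R) : 0 < x -> 0 < K ->
  ((x / K) `^ (- l))%:E = ((K `^ l)%:E * (x `^ (- l))%:E)%E.
Proof.
move=> x0 K0; rewrite powRM ?invr_ge0 ?ltW// -EFinM mulrC; congr (_ * _)%:E.
by rewrite -powR_inv1 ?ltW// -powRrM mulN1r opprK.
Qed.

Lemma mgamma_infdiv_on3 (a1 a2 a3 b12 b13 b23 b123 K : R) (f : R -> R -> R -> R) :
  0 < a1 -> 0 < a2 -> 0 < a3 -> 0 <= b12 -> 0 <= b13 -> 0 <= b23 -> 0 <= b123 ->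
  0 < K -> f 0 0 0 = 1 ->
  (forall t1 t2 t3, 0 <= t1 -> 0 <= t2 -> 0 <= t3 -> 0 < f t1 t2 t3) ->
  (forall t1 t2 t3, f t1 t2 t3 = ((t1 + a1) * (t2 + a2) * (t3 + a3) - b12 * (t3 + a3)
     - b13 * (t2 + a2) - b23 * (t1 + a1) - b123) / K) ->
  forall l, 0 <= l -> mgamma_infdiv (on3 f) l.
Proof.
move=> a10 a20 a30 b120 b130 b230 b1230 K0 f1 fpos fE.
have fC t : on3 f t = cubic a1 a2 a3 b12 b13 b23 b123 t / K by rewrite /on3 fE.
have cpos (t : 'rV[R]_3) : (forall i, 0 <= t 0 i) -> 0 < cubic a1 a2 a3 b12 b13 b23 b123 t.
  by move=> t0; have := fpos _ _ _ (t0 0) (t0 1) (t0 ord_max);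
    rewrite -/(on3 f t) fC pmulr_lgt0// invr_gt0.
apply: mgamma_infdiv_laplace; first by rewrite /on3 !mxE.
  by move=> t t0; exact: fpos.
move=> l l0.
have [mu Hmu] := is_laplaceZ (powR_ge0 K l)
  (is_laplace_cubic l0 a10 a20 a30 b120 b130 b230 b1230 cpos).
by exists mu => t t0; rewrite Hmu// fC powR_div_scale// cpos.
Qed.

(** The cubic with a third shift equal to 1 and no other [b] than [b12] factors as the quadratic
    times [z + 1], where [z] is the third coordinate; [psi] sets [z] to 0, where the extra factor is
    1. *)
Lemma mgamma_infdiv_on2 (a1 a2 b K : R) (f : R -> R -> R) :
  0 < a1 -> 0 < a2 -> 0 <= b -> 0 < K -> f 0 0 = 1 ->
  (forall t1 t2, 0 <= t1 -> 0 <= t2 -> 0 < f t1 t2) ->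
  (forall t1 t2, f t1 t2 = ((t1 + a1) * (t2 + a2) - b) / K) ->
  forall l, 0 <= l -> mgamma_infdiv (on2 f) l.
Proof.
move=> a10 a20 b0 K0 f1 fpos fE.
pose psi (t : 'rV[R]_2) : 'rV[R]_3 := \row_i nth 0 [:: t 0 0; t 0 1; 0] i.
have fC t : on2 f t = cubic a1 a2 1 b 0 0 0 (psi t) / K.
  by rewrite /on2 fE /cubic !mxE/=; congr (_ / _); ring.
have cpos (t : 'rV[R]_3) : (forall i, 0 <= t 0 i) -> 0 < cubic a1 a2 1 b 0 0 0 t.
  move=> t0; have := fpos _ _ (t0 0) (t0 1); rewrite fE pmulr_lgt0 ?invr_gt0// => D0.
  rewrite /cubic; have := t0 ord_max; move: (t 0 ord_max) => z z0.
  rewrite (_ : _ - _ = ((t 0 0 + a1) * (t 0 1 + a2) - b) * (z + 1)); last by ring.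
  by rewrite mulr_gt0// ltr_wpDl.
have psi0 (t : 'rV[R]_2) : (forall i, 0 <= t 0 i) -> forall i, 0 <= psi t 0 i.
  by move=> t0 [[|[|[|//]]] i3]; rewrite mxE/=.
apply: mgamma_infdiv_laplace; first by rewrite /on2 !mxE.
  by move=> t t0; exact: fpos.
move=> l l0.
pose phi (x : 3.-tuple R) : 2.-tuple R := [tuple tnth x 0; tnth x 1].
have mphi : measurable_fun setT phi.
  by apply/measurable_fun_tnthP => -[[|[|//]] i2]; exact: measurable_tnth.
have sumE (t : 'rV[R]_2) x :
    \sum_(i < 2) t 0 i * tnth (phi x) i = \sum_(i < 3) psi t 0 i * tnth x i.
  rewrite sum_tuple3 !big_ord_recl big_ord0 !mxE/= mul0r !addr0.
  by congr (_ * _ + _ * _); rewrite ?(tnth_nth 0) //=; congr (t _ _); exact: val_inj.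
have [mu Hmu] := is_laplace_map mphi sumE psi0 (is_laplaceZ (powR_ge0 K l)
  (is_laplace_cubic l0 a10 a20 ltr01 b0 (lexx 0) (lexx 0) (lexx 0) cpos)).
by exists mu => t t0; rewrite Hmu//= fC powR_div_scale//; exact/cpos/psi0.
Qed.

Lemma mgamma_infdiv_on1 (a : R) (f : R -> R) : 0 < a ->
  (forall t, f t = (t + a) / a) ->
  forall l, 0 <= l -> mgamma_infdiv (on1 f) l.
Proof.
move=> a0 fE.
pose psi (t : 'rV[R]_1) : 'rV[R]_3 := \row_i nth 0 [:: t 0 0; 0; 0] i.
have fC t : on1 f t = cubic a 1 1 0 0 0 0 (psi t) / a.
  by rewrite /on1 fE /cubic !mxE/=; congr (_ / _); ring.
have cpos (t : 'rV[R]_3) : (forall i, 0 <= t 0 i) -> 0 < cubic a 1 1 0 0 0 0 t.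
  move=> t0; rewrite /cubic !mul0r !subr0 !mulr_gt0// ltr_wpDl//.
have psi0 (t : 'rV[R]_1) : (forall i, 0 <= t 0 i) -> forall i, 0 <= psi t 0 i.
  by move=> t0 [[|[|[|//]]] i3]; rewrite mxE/=.
apply: mgamma_infdiv_laplace; first by rewrite /on1 fE mxE add0r divff ?gt_eqF.
  by move=> t t0; rewrite /on1 fE divr_gt0// ltr_wpDl.
move=> l l0.
pose phi (x : 3.-tuple R) : 1.-tuple R := [tuple tnth x 0].
have mphi : measurable_fun setT phi.
  by apply/measurable_fun_tnthP => -[[|//] i2]; exact: measurable_tnth.
have sumE (t : 'rV[R]_1) x :
    \sum_(i < 1) t 0 i * tnth (phi x) i = \sum_(i < 3) psi t 0 i * tnth x i.
  rewrite sum_tuple3 big_ord_recl big_ord0 !mxE/= !mul0r !addr0.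
  by congr (_ * _); rewrite ?(tnth_nth 0).
have [mu Hmu] := is_laplace_map mphi sumE psi0 (is_laplaceZ (powR_ge0 a l)
  (is_laplace_cubic l0 a0 ltr01 ltr01 (lexx 0) (lexx 0) (lexx 0) (lexx 0) cpos)).
by exists mu => t t0; rewrite Hmu//= fC powR_div_scale//; exact/cpos/psi0.
Qed.

End infinite_divisibility.

Section infdiv_components.
Context {R : realType} (p : {set 'I_4} -> R).
Hypothesis p0 : p finset.set0 = 1.
Hypothesis p_gt0 : forall T : {set 'I_4}, T != finset.set0 -> 0 < p T.
Hypothesis b_gt0 : forall T : {set 'I_4}, (1 < #|T|)%N -> 0 < btilde p T.

Lemma S_at0 :
  [/\ S2 p 0 = 1, S3 p 0 = 1, S4 p 0 = 1 &
  [/\ S23 p 0 0 = 1, S24 p 0 0 = 1, S34 p 0 0 = 1 & S234 p 0 0 0 = 1]].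
Proof.
by split; [..|split]; rewrite /S2 /S3 /S4 /S23 /S24 /S34 /S234 !mulr0 !addr0.
Qed.

Lemma mgamma_infdiv_S (l : R) : 0 <= l ->
  [/\ mgamma_infdiv (on1 (S2 p)) l, mgamma_infdiv (on1 (S3 p)) l,
      mgamma_infdiv (on1 (S4 p)) l &
  [/\ mgamma_infdiv (on2 (S23 p)) l, mgamma_infdiv (on2 (S24 p)) l,
      mgamma_infdiv (on2 (S34 p)) l & mgamma_infdiv (on3 (S234 p)) l]].
Proof.
move=> l0.
have A0 := a_gt0 p0 p_gt0; have B0 := b_set4_gt0 b_gt0.
have S1 := S_ge1 p0 p_gt0; have SEE := SE p0 p_gt0.
have [_ _ _ [e23 e24 e34 e234]] := S_at0.
split; [..|split].
- apply: (mgamma_infdiv_on1 (A0 false true false false)) => // t.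
  by have [-> _ _ _] := SEE t 0 0.
- apply: (mgamma_infdiv_on1 (A0 false false true false)) => // t.
  by have [_ -> _ _] := SEE 0 t 0.
- apply: (mgamma_infdiv_on1 (A0 false false false true)) => // t.
  by have [_ _ -> _] := SEE 0 0 t.
- apply: (mgamma_infdiv_on2 (A0 _ _ _ _) (A0 _ _ _ _) (ltW (B0 _ _ _ _ _)) (A0 _ _ _ _) e23) => //;
    last (by move=> t1 t2; have [_ _ _ [-> _ _ _]] := SEE t1 t2 0); first by [].
  by move=> t1 t2 h1 h2; have [_ _ _ [h _ _ _]] := S1 _ _ _ h1 h2 (lexx 0); exact: lt_le_trans h.
- apply: (mgamma_infdiv_on2 (A0 _ _ _ _) (A0 _ _ _ _) (ltW (B0 _ _ _ _ _)) (A0 _ _ _ _) e24) => //;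
    last (by move=> t1 t2; have [_ _ _ [_ -> _ _]] := SEE t1 0 t2); first by [].
  by move=> t1 t2 h1 h2; have [_ _ _ [_ h _ _]] := S1 _ _ _ h1 (lexx 0) h2; exact: lt_le_trans h.
- apply: (mgamma_infdiv_on2 (A0 _ _ _ _) (A0 _ _ _ _) (ltW (B0 _ _ _ _ _)) (A0 _ _ _ _) e34) => //;
    last (by move=> t1 t2; have [_ _ _ [_ _ -> _]] := SEE 0 t1 t2); first by [].
  by move=> t1 t2 h1 h2; have [_ _ _ [_ _ h _]] := S1 _ _ _ (lexx 0) h1 h2; exact: lt_le_trans h.
- apply: (mgamma_infdiv_on3 (A0 _ _ _ _) (A0 _ _ _ _) (A0 _ _ _ _) (ltW (B0 _ _ _ _ _)) (ltW (B0 _ _ _ _ _))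
    (ltW (B0 _ _ _ _ _)) (ltW (B0 _ _ _ _ _)) (A0 _ _ _ _) e234) => //;
    last (by move=> t1 t2 t3; have [_ _ _ [_ _ _ ->]] := SEE t1 t2 t3); try by [].
  by move=> t1 t2 t3 h1 h2 h3; have [_ _ _ [_ _ _ h]] := S1 _ _ _ h1 h2 h3; exact: lt_le_trans h.
Qed.

End infdiv_components.

(** * Polynomial functions *)

Section regularity.
Context {R : realType} (p : {set 'I_4} -> R).
Hypothesis p0 : p finset.set0 = 1.
Hypothesis p_gt0 : forall T : {set 'I_4}, T != finset.set0 -> 0 < p T.

Definition continuous0 n (f : 'rV[R]_n -> R) := {for 0, continuous f}.

(* The conditions under which a Laplace transform that is a power of [P]
   on some open set is the same power of [P] on the whole orthant. *)
Definition gamma_polynomial n (P : 'rV[R]_n -> R) :=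
  [/\ affine_in_each P, continuous0 P &
      forall t : 'rV[R]_n, (forall i, 0 <= t 0 i) -> 0 < P t].

(** An affine function is determined by its values at 0 and 1, so affinity becomes an identity that
    [ring] can check. *)
Lemma affine_in_each_interp n (P : 'rV[R]_n -> R) :
  (forall t i s, P (row_set t i s) =
     P (row_set t i 0) + (P (row_set t i 1) - P (row_set t i 0)) * s) ->
  affine_in_each P.
Proof. by move=> H t i; exists (P (row_set t i 0)); exists (P (row_set t i 1) - P (row_set t i 0)). Qed.

Lemma continuous0D n (f g : 'rV[R]_n -> R) : continuous0 f -> continuous0 g ->
  continuous0 (fun t => f t + g t).
Proof. exact: continuousD. Qed.

Lemma continuous0M n (f g : 'rV[R]_n -> R) : continuous0 f -> continuous0 g ->
  continuous0 (fun t => f t * g t).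
Proof. exact: continuousM. Qed.

Lemma continuous0_coord n (i : 'I_n) : continuous0 (fun t => t 0 i).
Proof. exact: coord_continuous. Qed.

Lemma continuous0_cst n (c : R) : continuous0 (fun _ : 'rV[R]_n => c).
Proof. exact: cst_continuous. Qed.

(* Matches syntactically, since unifying a sum with a product unfolds the ring
   operations of [R]. *)
Ltac polynomial_continuous :=
  repeat lazymatch goal with
  | |- continuous0 (fun t => @?f t + @?g t) => apply: (@continuous0D _ f g)
  | |- continuous0 (fun t => @?f t * @?g t) => apply: (@continuous0M _ f g)
  | |- continuous0 (fun _ => ?c) => exact: (@continuous0_cst _ c)
  | |- continuous0 _ => exact: continuous0_coord
  end.

Lemma gamma_polynomial1 (a : R) (f : R -> R) : (forall t, f t = 1 + a * t) ->
  (forall t, 0 <= t -> 0 < f t) -> gamma_polynomial (on1 f).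
Proof.
move=> fE fpos; split.
- by apply: affine_in_each_interp => t [[|//] i1] s; rewrite /on1 !fE !mxE/=; ring.
- rewrite (_ : on1 f = fun t => 1 + a * t 0 0); last by apply/funext => t; rewrite /on1 fE.
  by polynomial_continuous.
- by move=> t t0; exact: fpos.
Qed.

Lemma gamma_polynomial2 (a b c : R) (f : R -> R -> R) :
  (forall t u, f t u = 1 + a * t + b * u + c * (t * u)) ->
  (forall t u, 0 <= t -> 0 <= u -> 0 < f t u) -> gamma_polynomial (on2 f).
Proof.
move=> fE fpos; split.
- by apply: affine_in_each_interp => t [[|[|//]] i1] s; rewrite /on2 !fE !mxE/=; ring.
- rewrite (_ : on2 f = fun t => 1 + a * t 0 0 + b * t 0 1 + c * (t 0 0 * t 0 1)); last first.
    by apply/funext => t; rewrite /on2 fE.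
  by polynomial_continuous.
- by move=> t t0; exact: fpos.
Qed.

Lemma gamma_polynomial_S234 : gamma_polynomial (on3 (S234 p)).
Proof.
split.
- by apply: affine_in_each_interp => t [[|[|[|//]]] i1] s; rewrite /on3 /S234 !mxE/=; ring.
- rewrite /on3 /S234.
  by polynomial_continuous.
- move=> t t0; rewrite /on3.
  have [_ _ _ [_ _ _ h]] := S_ge1 p0 p_gt0 (t0 0) (t0 1) (t0 ord_max).
  exact: lt_le_trans h.
Qed.

Lemma gamma_polynomial_S :
  [/\ gamma_polynomial (on1 (S2 p)), gamma_polynomial (on1 (S3 p)),
      gamma_polynomial (on1 (S4 p)) &
  [/\ gamma_polynomial (on2 (S23 p)), gamma_polynomial (on2 (S24 p)),
      gamma_polynomial (on2 (S34 p)) & gamma_polynomial (on3 (S234 p))]].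
Proof.
have S1 := S_ge1 p0 p_gt0; have z : 0 <= 0 :> R by [].
split; [..|split; last exact: gamma_polynomial_S234].
- apply: (@gamma_polynomial1 _ (S2 p) (fun=> erefl)) => t t0.
  by have [h _ _ _] := S1 _ _ _ t0 z z; exact: lt_le_trans h.
- apply: (@gamma_polynomial1 _ (S3 p) (fun=> erefl)) => t t0.
  by have [_ h _ _] := S1 _ _ _ z t0 z; exact: lt_le_trans h.
- apply: (@gamma_polynomial1 _ (S4 p) (fun=> erefl)) => t t0.
  by have [_ _ h _] := S1 _ _ _ z z t0; exact: lt_le_trans h.
- apply: (@gamma_polynomial2 _ _ _ (S23 p) (fun _ _ => erefl)) => t u t0 u0.
  by have [_ _ _ [h _ _ _]] := S1 _ _ _ t0 u0 z; exact: lt_le_trans h.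
- apply: (@gamma_polynomial2 _ _ _ (S24 p) (fun _ _ => erefl)) => t u t0 u0.
  by have [_ _ _ [_ h _ _]] := S1 _ _ _ t0 z u0; exact: lt_le_trans h.
- apply: (@gamma_polynomial2 _ _ _ (S34 p) (fun _ _ => erefl)) => t u t0 u0.
  by have [_ _ _ [_ _ h _]] := S1 _ _ _ z t0 u0; exact: lt_le_trans h.
Qed.

Lemma gamma_polynomial_P1 : gamma_polynomial (on1 (P1 p)).
Proof.
apply: (@gamma_polynomial1 _ (P1 p) (fun=> erefl)) => t t0.
rewrite /P1 ltr_wpDr// mulr_ge0// ltW//.
by apply: p_gt0; rewrite idx4E set4_neq0.
Qed.

Lemma gamma_polynomial_affine4 : gamma_polynomial (affine4 p).
Proof.
have aE (t : 'rV[R]_4) := affine4E p0 (erefl (t 0 (@Ordinal 4 0 isT)))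
  (erefl (t 0 (@Ordinal 4 1 isT))) (erefl (t 0 (@Ordinal 4 2 isT)))
  (erefl (t 0 (@Ordinal 4 3 isT))).
split.
- apply: affine_in_each_interp => t i s; rewrite !aE !mxE/=.
  by case: i => [[|[|[|[|//]]]] i4] /=; ring.
- rewrite (funext aE).
  by polynomial_continuous.
- move=> t t0; rewrite /affine4 (bigD1 finset.set0)//= p0 big_set0 mul1r ltr_wpDr//.
  apply: sumr_ge0 => S S0; rewrite mulr_ge0 ?prodr_ge0// ltW//; exact: p_gt0.
Qed.

End regularity.

(** * The conditional law *)

Section conditional_law.
Context d (T : measurableType d) (R : realType) (Pr : probability T R).
Variables (p : {set 'I_4} -> R) (lambda : R).
Hypothesis lambda_gt0 : 0 < lambda.
Hypothesis p0 : p finset.set0 = 1.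
Hypothesis p_gt0 : forall T : {set 'I_4}, T != finset.set0 -> 0 < p T.
Hypothesis b_gt0 : forall T : {set 'I_4}, (1 < #|T|)%N -> 0 < btilde p T.

Lemma p1_gt0 : 0 < p (idx4 [:: 1]).
Proof. by apply: p_gt0; rewrite idx4E set4_neq0. Qed.

Lemma ae_gt0P (X : {RV Pr >-> R}) : Pr (X @^-1` `]-oo, 0%R]) = 0%E ->
  {ae Pr, forall w, 0 < X w}.
Proof.
move=> X0; exists (X @^-1` `]-oo, 0%R]); split => //.
  by rewrite -[X in measurable X]setTI; exact: measurable_funP.
by move=> w /= /negP; rewrite -leNgt in_itv.
Qed.

Lemma affine4_power (th : 'rV[R]_4) t1 t2 t3 t4 :
  th 0 (@Ordinal 4 0 isT) = t1 -> th 0 (@Ordinal 4 1 isT) = t2 ->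
  th 0 (@Ordinal 4 2 isT) = t3 -> th 0 (@Ordinal 4 3 isT) = t4 ->
  0 <= t1 -> 0 <= t2 -> 0 <= t3 -> 0 <= t4 ->
  affine4 p th `^ (- lambda) = S234 p t2 t3 t4 `^ (- lambda) *
    (1 + p (idx4 [:: 1]) * (t1 + mixture_rate p t2 t3 t4)) `^ (- lambda).
Proof.
move=> e1 e2 e3 e4 h1 h2 h3 h4.
rewrite (affine4_mixture p0 p_gt0 e1 e2 e3 e4)// powRM//.
  have [_ _ _ [_ _ _ h]] := S_ge1 p0 p_gt0 h2 h3 h4; exact: le_trans h.
rewrite addr_ge0// mulr_ge0 ?(ltW p1_gt0)// addr_ge0//.
exact: mixture_rate_ge0.
Qed.

Variables X1 X2 X3 X4 : {RV Pr >-> R}.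
Hypothesis X_gamma :
  mgamma Pr (fun w => [tuple X1 w; X2 w; X3 w; X4 w]) (affine4 p) lambda.

Lemma laplace_gamma4 t1 t2 t3 t4 : 0 <= t1 -> 0 <= t2 -> 0 <= t3 -> 0 <= t4 ->
  (\int[Pr]_w (expR (- (t1 * X1 w + t2 * X2 w + t3 * X3 w + t4 * X4 w)))%:E =
   (affine4 p (\row_i [:: t1; t2; t3; t4]`_i) `^ (- lambda))%:E)%E.
Proof.
move=> h1 h2 h3 h4; have [aff cont pos] := gamma_polynomial_affine4 p0 p_gt0.
rewrite -(mgamma_laplaceE (ltW lambda_gt0) aff cont pos X_gamma); last first.
  by case=> -[|[|[|[|//]]]] i4; rewrite mxE.
rewrite /laplace; apply: eq_integral => w _; congr (expR (- _))%:E.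
by rewrite !big_ord_recl big_ord0 !mxE !(tnth_nth 0)/= addr0 !addrA.
Qed.

Lemma mgf_gamma4_first s : 0 <= s ->
  mgf Pr X1 (- s) = ((1 + p (idx4 [:: 1]) * s) `^ (- lambda))%:E.
Proof.
move=> s0; have := laplace_gamma4 s0 (lexx 0) (lexx 0) (lexx 0).
rewrite (@affine4E _ _ p0 _ s 0 0 0) ?mxE// !(mulr0, mul0r, addr0) idx4E => <-.
by apply: eq_integral => w _; rewrite !mul0r !addr0 mulNr.
Qed.

Lemma gamma4_first_ae_gt0 : Pr (X1 @^-1` `]-oo, 0%R]) = 0%E.
Proof. exact: gamma1_ae_gt0 p1_gt0 lambda_gt0 mgf_gamma4_first. Qed.

Variables t2 t3 t4 : R.
Hypotheses (t2_ge0 : 0 <= t2) (t3_ge0 : 0 <= t3) (t4_ge0 : 0 <= t4).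

Let Z w : R := expR (- (t2 * X2 w + t3 * X3 w + t4 * X4 w)).
Let K : R := S234 p t2 t3 t4 `^ (- lambda).
Let r : R := mixture_rate p t2 t3 t4.
Let g (x : R) : R := expR (- (x * r)) * K.

Let mZ : measurable_fun setT Z.
Proof.
apply: measurableT_comp => //; apply: measurableT_comp => //.
by do 2?apply: measurable_funD; apply: measurable_funM.
Qed.

Let mg : measurable_fun setT g.
Proof.
apply: measurable_funM => //; apply: measurableT_comp => //.
by apply: measurableT_comp => //; exact: measurable_funM.
Qed.

Let g_ge0 x : 0 <= g x. Proof. by rewrite mulr_ge0 ?expR_ge0 ?powR_ge0. Qed.

Let r_ge0 : 0 <= r. Proof. exact: mixture_rate_ge0. Qed.

(** The left side is the joint transform at [(k, t2, t3, t4)]. On the right, [g] only shifts the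
    argument, which gives [K] times the transform of [X1] at [k + r]; [affine4_power] equates the
    two. *)
Lemma integral_gamma4_X1 (k : R) : 0 <= k ->
  (\int[Pr]_w (expR (- k * X1 w) * Z w)%:E =
   \int[Pr]_w (expR (- k * X1 w) * g (X1 w))%:E)%E.
Proof.
move=> k0.
transitivity ((K * (1 + p (idx4 [:: 1]) * (k + r)) `^ (- lambda))%:E).
  rewrite -(@affine4_power (\row_i [:: k; t2; t3; t4]`_i) k t2 t3 t4) ?mxE//.
  rewrite -laplace_gamma4//; apply: eq_integral => w _.
  by congr EFin; rewrite -expRD; congr expR; ring.
rewrite EFinM -mgf_gamma4_first ?addr_ge0// -ge0_integralZl//; last 2 first.
- by apply: measurable_mgf_fun.
- by rewrite lee_fin powR_ge0.
apply: eq_integral => w _; rewrite -EFinM; congr EFin.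
by rewrite /g mulrA -expRD mulrC; congr (expR _ * _); ring.
Qed.

Lemma integral_preimage_gamma4 (A : set R) : measurable A -> A `<=` `]0, +oo[ ->
  (\int[Pr]_(w in X1 @^-1` A) (Z w)%:E =
   \int[Pr]_(w in X1 @^-1` A) (g (X1 w))%:E)%E.
Proof.
move=> mA A0.
(* [laplace_nat_unique] asks for a variable that is non-negative everywhere, whereas [X1] is
   positive only almost surely. Truncation at 0 changes neither the integrals nor the preimage of a
   set of positive numbers. *)
pose Y w := Num.max (X1 w) 0.
have mY : measurable_fun setT Y by exact: measurable_maxr.
have mgX : measurable_fun setT (g \o X1) by exact: measurableT_comp.
have [m1 [m1E m1I]] := density_measure_ex Pr mZ (fun w => expR_ge0 _).
have [m2 [m2E m2I]] := density_measure_ex Pr mgX (fun w => g_ge0 _).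
have mexp k (U : T -> R) : measurable_fun setT U ->
    measurable_fun setT (fun w => expR (- k * U w)).
  by move=> mU; apply: measurableT_comp => //; exact: measurable_funM.
have aeY k (h : T -> R) : measurable_fun setT h -> (forall w, 0 <= h w) ->
    (\int[Pr]_w ((expR (- k * Y w))%:E * (h w)%:E) =
     \int[Pr]_w (expR (- k * X1 w) * h w)%:E)%E.
  move=> mh h0; apply: ge0_ae_eq_integral => //.
  - by apply/measurable_EFinP; apply: measurable_funM => //; exact: mexp.
  - by apply/measurable_EFinP; apply: measurable_funM => //; exact: mexp.
  - by move=> w _; rewrite lee_fin mulr_ge0 ?expR_ge0.
  - by move=> w _; rewrite lee_fin mulr_ge0 ?expR_ge0.
  apply: filterS (ae_gt0P gamma4_first_ae_gt0) => w Xw _.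
  by rewrite -EFinM /Y max_l// ltW.
have mgfE k : 0 <= k -> mgf m1 Y (- k) = mgf m2 Y (- k).
  move=> k0; rewrite /mgf m1I ?m2I; last 4 first.
  - exact: measurable_mgf_fun.
  - by move=> w; rewrite lee_fin expR_ge0.
  - exact: measurable_mgf_fun.
  - by move=> w; rewrite lee_fin expR_ge0.
  apply: etrans (aeY k Z mZ (fun w => expR_ge0 _)) _.
  apply: etrans (integral_gamma4_X1 k0) _.
  exact/esym/(aeY k (g \o X1) mgX (fun w => g_ge0 _)).
have m1T : m1 setT = (affine4 p (\row_i [:: 0; t2; t3; t4]`_i) `^ (- lambda))%:E.
  rewrite m1E//; apply: etrans (laplace_gamma4 (lexx 0) t2_ge0 t3_ge0 t4_ge0).
  apply: eq_integral => w _.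
  by rewrite mul0r add0r.
have mT m : mgf m Y (- 0) = m setT.
  rewrite /mgf -[RHS]mul1e -integral_cst//; apply: eq_integral => w _.
  by rewrite oppr0 mul0r expR0.
have Y0 w : 0 <= Y w by rewrite le_max lexx orbT.
have m1fin : (m1 setT < +oo)%E by rewrite m1T ltry.
have m2fin : (m2 setT < +oo)%E by rewrite -mT -mgfE// mT.
have := laplace_nat_unique mY mY Y0 Y0 m1fin m2fin (fun k => mgfE _ (ler0n _ k)) mA.
rewrite m1E ?m2E; last 2 first.
- by rewrite -[X in measurable X]setTI; exact: mY.
- by rewrite -[X in measurable X]setTI; exact: mY.
have -> : Y @^-1` A = X1 @^-1` A.
  apply/seteqP; split => w /= Aw.
    have := A0 _ Aw; rewrite /= in_itv/= andbT /Y; case: (leP (X1 w) 0) => h; rewrite ?ltxx//.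
    by move=> _; move: Aw; rewrite /Y max_l// ltW.
  by have := A0 _ Aw; rewrite /= in_itv/= andbT => h; rewrite /Y max_l// ltW.
exact.
Qed.

(** The closed form of the series is valid for [x > 0], and [gamma4_first_ae_gt0] places the whole
    law of [X1] on that half-line. *)
Lemma cond_laplace_version :
  cond_expectation_version X1 `]0, +oo[
    (fun w => expR (- (t2 * X2 w + t3 * X3 w + t4 * X4 w)))
    (cond_laplace p lambda t2 t3 t4).
Proof.
have cE x : 0 < x -> cond_laplace p lambda t2 t3 t4 x = (g x)%:E.
  by move=> x0; rewrite (cond_laplaceE lambda p0 p_gt0 b_gt0).
split.
- rewrite /distribution /pushforward.
  rewrite (_ : X1 @^-1` `]0, +oo[ = ~` (X1 @^-1` `]-oo, 0%R])); last first.
    by apply/seteqP; split => w /=; rewrite !in_itv/= andbT ltNge => /negP.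
  rewrite probability_setC ?gamma4_first_ae_gt0 ?sube0//.
  by rewrite -[X in measurable X]setTI; exact: measurable_funP.
- apply/integrableP; split; first exact/measurable_EFinP.
  under eq_integral do rewrite gee0_abs ?lee_fin ?expR_ge0//.
  rewrite (_ : integral _ _ _ = (affine4 p (\row_i [:: 0; t2; t3; t4]`_i) `^ (- lambda))%:E) ?ltry//.
  apply: etrans (laplace_gamma4 (lexx 0) t2_ge0 t3_ge0 t4_ge0).
  by apply: eq_integral => w _; rewrite mul0r add0r.
- apply: (eq_measurable_fun (EFin \o g)).
    by move=> x; rewrite inE/= in_itv/= andbT => x0; rewrite cE.
  by apply: measurable_funTS; exact/measurable_EFinP.
- move=> A mA A0; rewrite integral_preimage_gamma4//.
  rewrite [RHS](_ : _ = \int[distribution Pr X1]_(x in A) (g x)%:E)%E; last first.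
    apply: eq_integral => x /[!inE] /A0; rewrite /= in_itv/= andbT => x0.
    by rewrite cE.
  rewrite ge0_integral_pushforward//.
  + by apply: measurable_funTS; exact/measurable_EFinP.
  + by move=> x _; rewrite lee_fin.
Qed.

End conditional_law.

(** * The mixture *)

Section product_rule.
Context d (T : measurableType d) (R : realType) (m : {measure set T -> \bar R}).

(** Bundling a variable with its law and one test function lets factors with values in different
    spaces stand in a single list. *)
Record test_factor := TestFactor {
  tf_disp : measure_display;
  tf_type : measurableType tf_disp;
  tf_var : T -> tf_type;
  tf_law : probability tf_type R;
  tf_test : tf_type -> R;
  tf_mean : R;
  measurable_tf_var : measurable_fun setT tf_var;
  measurable_tf_test : measurable_fun setT tf_test;
  tf_test_ge0 : forall y, 0 <= tf_test y;
  tf_meanE : (\int[tf_law]_y (tf_test y)%:E = tf_mean%:E)%E }.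

Arguments tf_var : clear implicits.
Arguments tf_test : clear implicits.
Arguments measurable_tf_var : clear implicits.
Arguments measurable_tf_test : clear implicits.

(* Weighted by [g], the variables of [s] are independent with their laws, as
   far as events are concerned. *)
Fixpoint product_rule (s : seq test_factor) (g : T -> R) (C : R) : Prop :=
  if s is F :: s' then
    forall B, measurable B ->
      product_rule s' (fun w => g w * \1_(tf_var F @^-1` B) w)
        (C * fine (tf_law F B))
  else (\int[m]_w (g w)%:E = C%:E)%E.

Lemma tf_mean_ge0 F : 0 <= tf_mean F.
Proof.
by rewrite -lee_fin -tf_meanE integral_ge0// => y _; rewrite lee_fin tf_test_ge0.
Qed.

Lemma measurable_prod_tf (s : seq test_factor) :
  measurable_fun setT (fun w => \prod_(F <- s) tf_test F (tf_var F w)).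
Proof.
elim: s => [|F s IH]; first by under eq_fun do rewrite big_nil; exact: measurable_cst.
under eq_fun do rewrite big_cons. apply: measurable_funM => //.
exact: measurableT_comp (measurable_tf_test F) (measurable_tf_var F).
Qed.

Lemma integral_preimage_indic d' (T' : measurableType d') (Z : T -> T') (B : set T') (g : T -> R) :
  (\int[m]_(w in Z @^-1` B) (g w)%:E = \int[m]_w (g w * \1_(Z @^-1` B) w)%:E)%E.
Proof.
by rewrite integral_mkcond epatch_indic; apply: eq_integral => w _.
Qed.

(** Events are replaced by test functions one variable at a time. The induction hypothesis, applied
    to the weight restricted to an event of the head variable, integrates the remaining tests. *)
Lemma integral_product_rule (s : seq test_factor) (g : T -> R) (C : R) :
  measurable_fun setT g -> (forall w, 0 <= g w) -> 0 <= C ->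
  product_rule s g C ->
  (\int[m]_w (g w * \prod_(F <- s) tf_test F (tf_var F w))%:E =
   (C * \prod_(F <- s) tf_mean F)%:E)%E.
Proof.
elim: s g C => [|F s IH] g C mg g0 C0 /= H.
  by rewrite big_nil mulr1 -H; apply: eq_integral => w _; rewrite big_nil mulr1.
have mI B : measurable B -> measurable_fun setT (\1_(tf_var F @^-1` B) : T -> R).
  move=> mB; apply: measurable_indic; rewrite -[X in measurable X]setTI.
  exact: measurable_tf_var.
pose g' w := g w * \prod_(F <- s) tf_test F (tf_var F w).
pose C' := C * \prod_(F <- s) tf_mean F.
have mg' : measurable_fun setT g' by apply: measurable_funM => //; exact: measurable_prod_tf.
have g'0 w : 0 <= g' w by rewrite mulr_ge0// prodr_ge0// => i _; exact: tf_test_ge0.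
have C'0 : 0 <= C' by rewrite mulr_ge0// prodr_ge0// => i _; exact: tf_mean_ge0.
(* Under the weight [g'] the image of the measure by [tf_var F] is [C'] times [tf_law F]. For
   [ge0_integral_comp_unique] this is phrased as the map [id] with the constant density [C']. *)
have HB B : measurable B ->
    (\int[m]_(w in tf_var F @^-1` B) (g' w)%:E = \int[tf_law F]_(y in id @^-1` B) C'%:E)%E.
  move=> mB; rewrite integral_cst// integral_preimage_indic.
  transitivity ((C * fine (tf_law F B) * \prod_(F <- s) tf_mean F)%:E).
    rewrite -(IH (fun w => g w * \1_(tf_var F @^-1` B) w)) => [|||//|]; last exact: H.
    - by apply: eq_integral => w _; rewrite /g' mulrAC.
    - by apply: measurable_funM => //; exact: mI.
    - by move=> w; rewrite mulr_ge0.
    - by rewrite mulr_ge0// fine_ge0.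
  rewrite mulrAC EFinM fineK//; exact: fin_num_measure.
have := ge0_integral_comp_unique (measurable_tf_var F) (@measurable_id _ _ setT) mg'
  (measurable_cst C') g'0 (fun=> C'0) HB.
have mt : measurable_fun setT (fun y => (tf_test F y)%:E).
  by apply/measurable_EFinP; exact: measurable_tf_test.
move=> /(_ _ mt (fun y => _)) E.
transitivity (\int[m]_x ((tf_test F (tf_var F x))%:E * (g' x)%:E))%E.
  apply: eq_integral => w _; rewrite big_cons -EFinM /g'; congr EFin; ring.
rewrite E; last by move=> y; rewrite lee_fin tf_test_ge0.
rewrite -[LHS]/(\int[tf_law F]_y ((tf_test F y)%:E * C'%:E))%E.
rewrite ge0_integralZr//; last by move=> y _; rewrite lee_fin tf_test_ge0.
rewrite tf_meanE -EFinM big_cons /C'; congr EFin; ring.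
Qed.

End product_rule.

Section mixture_law.
Context d (T : measurableType d) (R : realType) (Pr : probability T R).
Variables (p : {set 'I_4} -> R) (lambda : R).
Hypothesis lambda_gt0 : 0 < lambda.
Hypothesis p0 : p finset.set0 = 1.
Hypothesis p_gt0 : forall T : {set 'I_4}, T != finset.set0 -> 0 < p T.
Hypothesis b_gt0 : forall T : {set 'I_4}, (1 < #|T|)%N -> 0 < btilde p T.

Lemma gamma_law_laplace n (G : probability (n.-tuple R) R) (P : 'rV[R]_n -> R) (l : R) :
  0 <= l -> gamma_polynomial P -> mgamma_law G P l ->
  forall t : 'rV[R]_n, (forall i, 0 <= t 0 i) -> laplace G id t = (P t `^ (- l))%:E.
Proof. by move=> l0 [aff cont pos] GP t t0; exact: mgamma_laplaceE. Qed.

Definition gamma_factor n (Z : T -> n.-tuple R) (mZ : measurable_fun setT Z)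
    (G : probability (n.-tuple R) R) (P : 'rV[R]_n -> R) (l : R) (l0 : 0 <= l)
    (polyP : gamma_polynomial P) (GP : mgamma_law G P l)
    (t : 'rV[R]_n) (t0 : forall i, 0 <= t 0 i) : test_factor T R :=
  @TestFactor _ _ _ _ (n.-tuple R) Z G
    (fun x => expR (- \sum_(i < n) t 0 i * tnth x i)) (P t `^ (- l)) mZ
    (measurable_laplace_fun (@measurable_id _ _ setT) t) (fun=> expR_ge0 _)
    (gamma_law_laplace l0 polyP GP t0).

(** At a rate that is not positive the law is the point mass at 0. This branch is carried along
    pointwise and discarded in [prob_X1_V], where [X1 > 0] almost surely. *)
Lemma poisson_prob_set1 (r : R) k n :
  poisson_prob r k [set n] = (if 0 < r then poisson_pmf r n else (n == 0%N)%:R)%:E.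
Proof.
rewrite /poisson_prob; case: ifPn => _.
  by rewrite esum_set1// lee_fin poisson_pmf_ge0.
by rewrite /dirac indicE; congr (nat_of_bool _)%:R%:E; apply/idP/eqP => [/set_mem|->]//; rewrite inE.
Qed.

Variables (X1 : {RV Pr >-> R}) (V : 'I_40 -> {RV Pr >-> nat}).
Variables Y2 Y3 Y4 U12 U13 U22 U24 U33 U34 W2 W3 W4 : {RV Pr >-> R}.
Variables G2 G3 G4 : 40.-tuple nat -> probability (1.-tuple R) R.
Variables G23 G24 G34 : 40.-tuple nat -> probability (2.-tuple R) R.
Variable G234 : 40.-tuple nat -> probability (3.-tuple R) R.
Hypothesis X1_gamma : mgamma Pr (fun w => [tuple X1 w]) (on1 (P1 p)) lambda.
Hypothesis V_poisson : cond_indep_poisson X1 (alpha p) V.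
Hypothesis G2_gamma : forall v, mgamma_law (G2 v) (on1 (S2 p)) (z1 v)%:R.
Hypothesis G3_gamma : forall v, mgamma_law (G3 v) (on1 (S3 p)) (z2 v)%:R.
Hypothesis G4_gamma : forall v, mgamma_law (G4 v) (on1 (S4 p)) (z3 v)%:R.
Hypothesis G23_gamma : forall v, mgamma_law (G23 v) (on2 (S23 p)) (z4 v)%:R.
Hypothesis G24_gamma : forall v, mgamma_law (G24 v) (on2 (S24 p)) (z5 v)%:R.
Hypothesis G34_gamma : forall v, mgamma_law (G34 v) (on2 (S34 p)) (z6 v)%:R.
Hypothesis G234_gamma :
  forall v, mgamma_law (G234 v) (on3 (S234 p)) (lambda + (z7 v)%:R).
Hypothesis YUW_indep :
  cond_indep_given_X1_V X1 V Y2 Y3 Y4 U12 U13 U22 U24 U33 U34 W2 W3 W4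
    G2 G3 G4 G23 G24 G34 G234.

Variables t1 t2 t3 t4 : R.
Hypotheses (t1_ge0 : 0 <= t1) (t2_ge0 : 0 <= t2) (t3_ge0 : 0 <= t3) (t4_ge0 : 0 <= t4).

Let Vt w : 40.-tuple nat := [tuple V i w | i < 40].

Let E w : R := expR (- (t2 * (Y2 w + U12 w + U22 w + W2 w) +
  t3 * (Y3 w + U13 w + U33 w + W3 w) + t4 * (Y4 w + U24 w + U34 w + W4 w))).

Let K (v : 40.-tuple nat) : R :=
  S2 p t2 ^- z1 v * S3 p t3 ^- z2 v * S4 p t4 ^- z3 v *
  S23 p t2 t3 ^- z4 v * S24 p t2 t4 ^- z5 v * S34 p t3 t4 ^- z6 v *
  S234 p t2 t3 t4 `^ (- (lambda + (z7 v)%:R)).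

Let q (v : 40.-tuple nat) (x : R) : R :=
  \prod_(i < 40) poisson_pmf (tnth (alpha p) i * x) (tnth v i).

Let D v : set T := [set w | Vt w = v].

Let mD v : measurable (D v).
Proof.
rewrite (_ : D v = \bigcap_(i in [set: 'I_40]) (V i @^-1` [set tnth v i])).
  apply: fin_bigcap_measurable => // i _.
  by rewrite -[X in measurable X]setTI; exact: measurable_funP.
apply/seteqP; split => [w /= <- i _|w /= H]; first by rewrite /= /Vt tnth_mktuple.
by apply: eq_from_tnth => i; rewrite tnth_mktuple; exact: H.
Qed.

Let mpre (A : set R) : measurable A -> measurable (X1 @^-1` A).
Proof. by move=> mA; rewrite -[X in measurable X]setTI; exact: measurable_funP. Qed.

Let K_ge0 v : 0 <= K v.
Proof.
have [s2 s3 s4 [s23 s24 s34 _]] := S_ge1 p0 p_gt0 t2_ge0 t3_ge0 t4_ge0.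
by rewrite /K !mulr_ge0 ?powR_ge0// invr_ge0 exprn_ge0//; exact: le_trans ler01 _.
Qed.

Let q_ge0 v x : 0 <= q v x.
Proof. by apply: prodr_ge0 => i _; exact: poisson_pmf_ge0. Qed.

Let mq v : measurable_fun setT (q v).
Proof.
apply: (@measurable_prod _ _ _ _ _ _ (fun i x => poisson_pmf (tnth (alpha p) i * x) (tnth v i))) => i _.
apply: (@measurableT_comp _ _ _ _ _ _ (fun r => poisson_pmf r (tnth v i)) _ (fun x => tnth (alpha p) i * x)).
  exact: measurable_poisson_pmf.
exact: measurable_funM.
Qed.

Let mE : measurable_fun setT E.
Proof.
apply: measurableT_comp => //; apply: measurableT_comp => //.
by do 2?[apply: measurable_funD]; apply: measurable_funM => //;
  do 3?[apply: measurable_funD].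
Qed.

(** On this event the seven blocks are independent, with laws that depend on [v] only. [E] is a
    product of one exponential per block, with the [t_i] of the coordinates to which the block is
    added, and [K v] is the product of the seven transforms. *)
Lemma integral_test_event (A : set R) v : measurable A ->
  (\int[Pr]_w (\1_(X1 @^-1` A `&` D v) w * E w)%:E =
   (fine (Pr (X1 @^-1` A `&` D v)) * K v)%:E)%E.
Proof.
move=> mA; set C := _ `&` _; have mC : measurable C by exact: measurableI (mpre mA) (mD v).
have m2 (f g : {RV Pr >-> R}) : measurable_fun setT (fun w => [tuple f w; g w]).
  by apply/measurable_fun_tnthP => -[[|[|//]] i2]; exact: measurable_funP.
have m1 (f : {RV Pr >-> R}) : measurable_fun setT (fun w => [tuple f w]).
  by apply/measurable_fun_tnthP => -[[|//] i2]; exact: measurable_funP.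
have m3 (f g h : {RV Pr >-> R}) : measurable_fun setT (fun w => [tuple f w; g w; h w]).
  by apply/measurable_fun_tnthP => -[[|[|[|//]]] i2]; exact: measurable_funP.
have r1 (a : R) : 0 <= a -> forall i, 0 <= (\row_(i < 1) [:: a]`_i) 0 i.
  by move=> a0 [[|//] i1]; rewrite mxE.
have r2 (a b : R) : 0 <= a -> 0 <= b -> forall i, 0 <= (\row_(i < 2) [:: a; b]`_i) 0 i.
  by move=> a0 b0 [[|[|//]] i1]; rewrite mxE.
have r3 (a b c : R) : 0 <= a -> 0 <= b -> 0 <= c ->
    forall i, 0 <= (\row_(i < 3) [:: a; b; c]`_i) 0 i.
  by move=> a0 b0 c0 [[|[|[|//]]] i1]; rewrite mxE.
have [g2 g3 g4 [g23 g24 g34 g234]] := gamma_polynomial_S p0 p_gt0.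
have l0 : 0 <= lambda + (z7 v)%:R by rewrite addr_ge0// ltW.
pose s := [::
  gamma_factor (m1 Y2) (ler0n R _) g2 (G2_gamma v) (r1 _ t2_ge0);
  gamma_factor (m1 Y3) (ler0n R _) g3 (G3_gamma v) (r1 _ t3_ge0);
  gamma_factor (m1 Y4) (ler0n R _) g4 (G4_gamma v) (r1 _ t4_ge0);
  gamma_factor (m2 U12 U13) (ler0n R _) g23 (G23_gamma v) (r2 _ _ t2_ge0 t3_ge0);
  gamma_factor (m2 U22 U24) (ler0n R _) g24 (G24_gamma v) (r2 _ _ t2_ge0 t4_ge0);
  gamma_factor (m2 U33 U34) (ler0n R _) g34 (G34_gamma v) (r2 _ _ t3_ge0 t4_ge0);
  gamma_factor (m3 W2 W3 W4) l0 g234 (G234_gamma v) (r3 _ _ _ t2_ge0 t3_ge0 t4_ge0)].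
have PC0 : 0 <= fine (Pr C) by rewrite fine_ge0.
have C0 w : 0 <= \1_C w :> R by [].
have mIC : measurable_fun setT (\1_C : T -> R) by exact: measurable_indic.
(* The seven nested conditions amount to the indicator of one intersection, whose probability is
   given by [YUW_indep]. *)
have rule : product_rule Pr s \1_C (fine (Pr C)).
  move=> B2 mB2 B3 mB3 B4 mB4 B23 mB23 B24 mB24 B34 mB34 B234 mB234.
  have := YUW_indep v mA mB2 mB3 mB4 mB23 mB24 mB34 mB234.
  have m0 d' (T' : measurableType d') (f : T -> T') (B : set T') :
    measurable_fun setT f -> measurable B -> measurable (f @^-1` B).
    by move=> mf mB; rewrite -[X in measurable X]setTI; exact: mf.
  set S := [set w | [/\ _, _, _ & _]]; rewrite /= => HS.
  transitivity (\int[Pr]_w (\1_(C `&` (fun w => [tuple Y2 w]) @^-1` B2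
      `&` (fun w => [tuple Y3 w]) @^-1` B3
      `&` (fun w => [tuple Y4 w]) @^-1` B4 `&` (fun w => [tuple U12 w; U13 w]) @^-1` B23
      `&` (fun w => [tuple U22 w; U24 w]) @^-1` B24 `&` (fun w => [tuple U33 w; U34 w]) @^-1` B34
      `&` (fun w => [tuple W2 w; W3 w; W4 w]) @^-1` B234) w)%:E)%E.
    by apply: eq_integral => w _; rewrite !indicI.
  rewrite integral_indic//; last by do ?[apply: measurableI]; rewrite ?mC//; exact: m0.
  rewrite setIT; set I := _ `&` _.
  have -> : I = C `&` S.
    apply/seteqP; split => w /=.
      by move=> [[[[[[[Cw h2] h3] h4] h23] h24] h34] h234]; split.
    by move=> [Cw [h2 h3 h4 [h23 h24 h34 h234]]].
  by apply: (etrans HS); rewrite !EFinM !fineK//; exact: fin_num_measure.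
have pn (x : R) n : 1 <= x -> x `^ (- n%:R) = x ^- n.
  by move=> x1; rewrite powR_invn ?exprVn// (le_trans ler01).
apply: etrans (etrans (integral_product_rule mIC C0 PC0 rule) _).
  apply: eq_integral => w _; congr EFin; congr (_ * _).
  rewrite /s !big_cons big_nil /= mulr1 -!expRD; congr expR.
  by rewrite !big_ord_recl !big_ord0 !mxE !(tnth_nth 0)/=; ring.
have [s2 s3 s4 [s23 s24 s34 _]] := S_ge1 p0 p_gt0 t2_ge0 t3_ge0 t4_ge0.
congr EFin; congr (_ * _); rewrite /s !big_cons big_nil /= /on1 /on2 /on3 !mxE/=.
by rewrite !pn// mulr1 /K !mulrA.
Qed.

Lemma mgf_gamma1 s : 0 <= s ->
  mgf Pr X1 (- s) = ((1 + p (idx4 [:: 1]) * s) `^ (- lambda))%:E.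
Proof.
move=> s0; have [aff cont pos] := gamma_polynomial_P1 p_gt0.
have th0 i : 0 <= (\row_(i < 1) [:: s]`_i) 0 i by case: i => -[|//] i1; rewrite mxE.
have := mgamma_laplaceE (ltW lambda_gt0) aff cont pos X1_gamma th0.
rewrite /on1 mxE /= => <-; apply: eq_integral => w _; congr (expR _)%:E.
by rewrite big_ord_recl big_ord0 addr0 mxE (tnth_nth 0)/= mulNr.
Qed.

Let X1_ae_gt0 : {ae Pr, forall w, 0 < X1 w}.
Proof.
apply: ae_gt0P; exact: gamma1_ae_gt0 (p1_gt0 p_gt0) lambda_gt0 mgf_gamma1.
Qed.

Lemma prob_X1_V (A : set R) v : measurable A ->
  (Pr (X1 @^-1` A `&` D v) = \int[Pr]_(w in X1 @^-1` A) (q v (X1 w))%:E)%E.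
Proof.
move=> mA.
have -> : D v = \bigcap_(i in [set: 'I_40]) (V i @^-1` [set tnth v i]).
  apply/seteqP; split => [w /= <- i _|w /= H]; first by rewrite /= /Vt tnth_mktuple.
  by apply: eq_from_tnth => i; rewrite tnth_mktuple; exact: H.
rewrite V_poisson//.
pose f i x : R := if 0 < tnth (alpha p) i * x
  then poisson_pmf (tnth (alpha p) i * x) (tnth v i) else (tnth v i == 0%N)%:R.
have mf : measurable_fun setT (fun x => \prod_(i < 40) f i x).
  apply: (@measurable_prod _ _ _ _ _ _ f) => i _; apply: measurable_fun_if => //.
  - by apply: measurable_fun_ltr => //; exact: measurable_funM.
  - apply: measurable_funTS.
    apply: (@measurableT_comp _ _ _ _ _ _ (fun r => poisson_pmf r (tnth v i)) _ (fun x => tnth (alpha p) i * x)).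
      exact: measurable_poisson_pmf.
    exact: measurable_funM.
transitivity (\int[Pr]_(w in X1 @^-1` A) (\prod_(i < 40) f i (X1 w))%:E)%E.
  by apply: eq_integral => w _; rewrite -prodEFin; apply: eq_bigr => i _; rewrite poisson_prob_set1.
apply: ge0_ae_eq_integral.
- exact: mpre.
- apply: measurable_funTS; apply/measurable_EFinP.
  exact: measurableT_comp mf (measurable_funP X1).
- apply: measurable_funTS; apply/measurable_EFinP.
  exact: measurableT_comp (mq v) (measurable_funP X1).
- move=> w _; rewrite lee_fin prodr_ge0// => i _; rewrite /f; case: ifP => // _.
  exact: poisson_pmf_ge0.
- by move=> w _; rewrite lee_fin.
apply: filterS X1_ae_gt0 => w Xw _; congr EFin; apply: eq_bigr => i _.
by rewrite /f mulr_gt0// alpha_gt0.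
Qed.

Let eX x : R := expR (- (t1 * x)).

Let meX : measurable_fun setT eX.
Proof. by apply: measurableT_comp => //; apply: measurableT_comp => //; exact: measurable_funM. Qed.

(** [integral_test_event] and [prob_X1_V] identify the two weights on every event that depends on
    [X1] alone, and [ge0_integral_comp_unique] replaces such events by the exponential in [X1]. *)
Lemma integral_test_V v :
  (\int[Pr]_w (eX (X1 w) * (\1_(D v) w * E w))%:E =
   \int[Pr]_w (eX (X1 w) * (K v * q v (X1 w)))%:E)%E.
Proof.
have mDE : measurable_fun setT (fun w => \1_(D v) w * E w).
  by apply: measurable_funM => //; exact: measurable_indic.
have mqX : measurable_fun setT (q v \o X1) by exact: measurableT_comp.
have mKq : measurable_fun setT (fun w => K v * q v (X1 w)) by exact: measurable_funM.
have DE0 w : 0 <= \1_(D v) w * E w by rewrite mulr_ge0 ?expR_ge0.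
have Kq0 w : 0 <= K v * q v (X1 w) by rewrite mulr_ge0.
have H A : measurable A -> (\int[Pr]_(w in X1 @^-1` A) (\1_(D v) w * E w)%:E =
    \int[Pr]_(w in X1 @^-1` A) (K v * q v (X1 w))%:E)%E.
  move=> mA; rewrite integral_preimage_indic.
  transitivity (\int[Pr]_w (\1_(X1 @^-1` A `&` D v) w * E w)%:E)%E.
    by apply: eq_integral => w _; rewrite indicI/=; congr EFin; ring.
  rewrite integral_test_event// EFinM fineK ?fin_num_measure//; last first.
    exact: measurableI (mpre mA) (mD v).
  rewrite prob_X1_V// muleC -ge0_integralZl//.
  - exact: mpre.
  - by apply: measurable_funTS; exact/measurable_EFinP.
  - by move=> w _; rewrite lee_fin.
  - by rewrite lee_fin.
have meXe : measurable_fun setT (fun x => (eX x)%:E) by exact/measurable_EFinP.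
have eX0 x : (0 <= (eX x)%:E)%E by rewrite lee_fin expR_ge0.
have mX1 : measurable_fun setT X1 by [].
exact: (ge0_integral_comp_unique mX1 mX1 mDE mKq DE0 Kq0 H meXe eX0).
Qed.

Lemma integral_mixture :
  (\int[Pr]_w (eX (X1 w) * E w)%:E =
   (S234 p t2 t3 t4 `^ (- lambda) *
    (1 + p (idx4 [:: 1]) * (t1 + mixture_rate p t2 t3 t4)) `^ (- lambda))%:E)%E.
Proof.
have meXX : measurable_fun setT (eX \o X1) by exact: measurableT_comp.
have mKq v : measurable_fun setT (fun w => (eX (X1 w) * (K v * q v (X1 w)))%:E).
  have mqX : measurable_fun setT (q v \o X1) by exact: measurableT_comp.
  by apply/measurable_EFinP; apply: measurable_funM => //; exact: measurable_funM.
have eX0 x : 0 <= eX x by exact: expR_ge0.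
have E0 w : 0 <= E w by exact: expR_ge0.
have Kq0 v w : 0 <= K v * q v (X1 w) by exact: mulr_ge0.
have eKq0 v w : 0 <= eX (X1 w) * (K v * q v (X1 w)) by exact: mulr_ge0.
(* Only the term [v = Vt w] is non-zero; the sum over [v] stands for conditioning on [V]. *)
transitivity (\int[Pr]_w \esum_(v in [set: 40.-tuple nat]) (eX (X1 w) * (\1_(D v) w * E w))%:E)%E.
  apply: eq_integral => w _.
  rewrite -(@esum_set1 _ _ (Vt w) (fun=> (eX (X1 w) * E w)%:E)); last first.
    by rewrite lee_fin mulr_ge0.
  rewrite esum_mkcond; apply: eq_esum => v _; rewrite indicE.
  have -> : (v \in [set Vt w]) = (w \in D v).
    by apply/idP/idP => /set_mem/= h; apply/mem_set => /=.
  by case: (w \in D v); rewrite ?(mul1r, mul0r, mulr0).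
rewrite ge0_integral_esum; last 2 first.
- move=> v; apply/measurable_EFinP; apply: measurable_funM => //.
  by apply: measurable_funM => //; exact: measurable_indic.
- by move=> v w; rewrite lee_fin !mulr_ge0.
under eq_esum do rewrite integral_test_V.
rewrite -ge0_integral_esum; last 2 first.
- exact: mKq.
- by move=> v w; rewrite lee_fin.
(* The right side is read as the transform of [X1] at [t1 + mixture_rate], so that the integrands
   can be compared pointwise where [X1 > 0]. *)
rewrite EFinM -mgf_gamma1 ?addr_ge0 ?mixture_rate_ge0// -ge0_integralZl//; last 2 first.
- by apply: measurable_mgf_fun.
- by rewrite lee_fin powR_ge0.
apply: ge0_ae_eq_integral => //.
- apply: measurable_esum => [v|v w]; last by rewrite lee_fin.
  exact: mKq.
- apply: emeasurable_funM => //; exact: measurable_mgf_fun.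
- by move=> w _; apply: esum_ge0 => v _; rewrite lee_fin.
- by move=> w _; rewrite -EFinM lee_fin mulr_ge0 ?powR_ge0 ?expR_ge0.
apply: filterS X1_ae_gt0 => w Xw _.
under eq_esum do rewrite EFinM.
rewrite esumZl//; last by move=> v; rewrite lee_fin.
have -> : (\esum_(v in [set: 40.-tuple nat]) (K v * q v (X1 w))%:E)%E =
    cond_laplace p lambda t2 t3 t4 (X1 w).
  by apply: eq_esum => v _; rewrite /K /q; congr EFin; ring.
rewrite (cond_laplaceE lambda p0 p_gt0 b_gt0)// -!EFinM; congr EFin.
by rewrite mulrA mulrC /eX -expRD; congr (_ * expR _); ring.
Qed.

End mixture_law.

Theorem theorem39 (R : realType) (lambda : R) (p : {set 'I_4} -> R)
    (lambda_gt0 : 0 < lambda)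
    (p0 : p finset.set0 = 1)
    (p_gt0 : forall T : {set 'I_4}, T != finset.set0 -> 0 < p T)
    (b_gt0 : forall T : {set 'I_4}, (1 < #|T|)%N -> 0 < btilde p T) :
  (* (a) *)
  (forall (d : measure_display) (T : measurableType d) (Pr : probability T R)
      (X1 X2 X3 X4 : {RV Pr >-> R}),
    mgamma Pr (fun w => [tuple X1 w; X2 w; X3 w; X4 w]) (affine4 p) lambda ->
    forall t2 t3 t4 : R, 0 <= t2 -> 0 <= t3 -> 0 <= t4 ->
      cond_expectation_version X1 `]0, +oo[
        (fun w => expR (- (t2 * X2 w + t3 * X3 w + t4 * X4 w)))
        (cond_laplace p lambda t2 t3 t4))
  /\
  (* (b) *)
  ((forall v : 40.-tuple nat,
      [/\ mgamma_infdiv (on1 (S2 p)) (z1 v)%:R,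
          mgamma_infdiv (on1 (S3 p)) (z2 v)%:R,
          mgamma_infdiv (on1 (S4 p)) (z3 v)%:R &
      [/\ mgamma_infdiv (on2 (S23 p)) (z4 v)%:R,
          mgamma_infdiv (on2 (S24 p)) (z5 v)%:R,
          mgamma_infdiv (on2 (S34 p)) (z6 v)%:R &
          mgamma_infdiv (on3 (S234 p)) (lambda + (z7 v)%:R)]])
   /\
   forall (d : measure_display) (T : measurableType d) (Pr : probability T R)
      (X1 : {RV Pr >-> R}) (V : 'I_40 -> {RV Pr >-> nat})
      (Y2 Y3 Y4 U12 U13 U22 U24 U33 U34 W2 W3 W4 : {RV Pr >-> R})
      (G2 G3 G4 : 40.-tuple nat -> probability (1.-tuple R) R)
      (G23 G24 G34 : 40.-tuple nat -> probability (2.-tuple R) R)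
      (G234 : 40.-tuple nat -> probability (3.-tuple R) R),
    mgamma Pr (fun w => [tuple X1 w]) (on1 (P1 p)) lambda ->
    cond_indep_poisson X1 (alpha p) V ->
    (forall v, mgamma_law (G2 v) (on1 (S2 p)) (z1 v)%:R) ->
    (forall v, mgamma_law (G3 v) (on1 (S3 p)) (z2 v)%:R) ->
    (forall v, mgamma_law (G4 v) (on1 (S4 p)) (z3 v)%:R) ->
    (forall v, mgamma_law (G23 v) (on2 (S23 p)) (z4 v)%:R) ->
    (forall v, mgamma_law (G24 v) (on2 (S24 p)) (z5 v)%:R) ->
    (forall v, mgamma_law (G34 v) (on2 (S34 p)) (z6 v)%:R) ->
    (forall v, mgamma_law (G234 v) (on3 (S234 p)) (lambda + (z7 v)%:R)) ->
    cond_indep_given_X1_V X1 V Y2 Y3 Y4 U12 U13 U22 U24 U33 U34 W2 W3 W4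
      G2 G3 G4 G23 G24 G34 G234 ->
    mgamma Pr
      (fun w => [tuple X1 w;
                       Y2 w + U12 w + U22 w + W2 w;
                       Y3 w + U13 w + U33 w + W3 w;
                       Y4 w + U24 w + U34 w + W4 w])
      (affine4 p) lambda).
Proof.
split.
  move=> d T Pr X1 X2 X3 X4 XG t2 t3 t4 h2 h3 h4.
  exact: cond_laplace_version.
split.
  move=> v; have S l (l0 : 0 <= l) := mgamma_infdiv_S p0 p_gt0 b_gt0 l0.
  have l0 : 0 <= lambda + (z7 v)%:R by rewrite addr_ge0// ltW.
  have [i2 _ _ _] := S _ (ler0n R (z1 v)); have [_ i3 _ _] := S _ (ler0n R (z2 v)).
  have [_ _ i4 _] := S _ (ler0n R (z3 v)); have [_ _ _ [i23 _ _ _]] := S _ (ler0n R (z4 v)).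
  have [_ _ _ [_ i24 _ _]] := S _ (ler0n R (z5 v)).
  have [_ _ _ [_ _ i34 _]] := S _ (ler0n R (z6 v)).
  by have [_ _ _ [_ _ _ i234]] := S _ l0.
move=> d T Pr X1 V Y2 Y3 Y4 U12 U13 U22 U24 U33 U34 W2 W3 W4 G2 G3 G4 G23 G24 G34
  G234 X1_gamma V_poisson G2_gamma G3_gamma G4_gamma G23_gamma G24_gamma G34_gamma
  G234_gamma YUW_indep.
split.
  apply/measurable_fun_tnthP => -[[|[|[|[|//]]]] i4].
  - exact: measurable_funP.
  - by do 3?[apply: measurable_funD]; exact: measurable_funP.
  - by do 3?[apply: measurable_funD]; exact: measurable_funP.
  - by do 3?[apply: measurable_funD]; exact: measurable_funP.
(* [lambda > 0] selects the Laplace condition, and the whole orthant serves as the set on which it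
   holds. *)
rewrite gt_eqF//; exists [set t : 'rV[R]_4 | forall i, 0 <= t 0 i].
  exact: orthant_interior.
move=> th th0; split; first by have [_ _] := gamma_polynomial_affine4 p0 p_gt0; exact.
rewrite (affine4_power lambda p0 p_gt0 b_gt0 (erefl (th 0 (@Ordinal 4 0 isT)))
  (erefl (th 0 (@Ordinal 4 1 isT))) (erefl (th 0 (@Ordinal 4 2 isT)))
  (erefl (th 0 (@Ordinal 4 3 isT))))//.
rewrite -(integral_mixture lambda_gt0 p0 p_gt0 b_gt0 X1_gamma V_poisson G2_gamma
  G3_gamma G4_gamma G23_gamma G24_gamma G34_gamma G234_gamma YUW_indep)//.
apply: eq_integral => w _; congr EFin; rewrite -expRD; congr expR.
rewrite !big_ord_recl big_ord0 addr0 !(tnth_nth 0)/=.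
rewrite (_ : th 0 ord0 = th 0 (@Ordinal 4 0 isT)); last by congr (th _ _); exact: val_inj.
rewrite (_ : lift ord0 ord0 = @Ordinal 4 1 isT); last exact: val_inj.
rewrite (_ : lift ord0 (lift ord0 ord0) = @Ordinal 4 2 isT); last exact: val_inj.
rewrite (_ : lift ord0 (lift ord0 (lift ord0 ord0)) = @Ordinal 4 3 isT); last exact: val_inj.
ring.
Qed.
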